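(* Let $H^s(S^1,S^1\times\mathbb{R})$ denote the closure of $C^\infty(S^1,S^1\times\mathbb{R})$ in the Sobolev $H^s$ topology, and consider the weak Riemannian metric $\langle\langle\cdot,\cdot\rangle\rangle$ with $\lambda(\rho)=3/\rho$. Then for no $s>3/2$ is the Riemannian exponential map of this metric $C^1$ (in the $H^s$ topology).
   Context: $N=M=S^1$ with the standard metric and length form $dx$ on both. For an orientation-preserving diffeomorphism $\eta$ of $S^1$, its density $\rho:S^1\to\mathbb{R}^+$ is defined by $\rho(\eta(x))\,\eta'(x)=1$. At points $(\eta,F)$ with $\eta$ a diffeomorphism, tangent vectors to $C^\infty(S^1,S^1\times\mathbb{R})=C^\infty(S^1,S^1)\times C^\infty(S^1,\mathbb{R})$ are written $(u\circ\eta,f\circ\eta)$ with $u$ a vector field and $f$ a function on $S^1$, and the weak Riemannian metric is $$\langle\langle(u\circ\eta,f\circ\eta),(v\circ\eta,g\circ\eta)\rangle\rangle_{(\eta,F)}=\int_{S^1}\big[\lambda(\rho)fg+\rho\,uv\big]\,dx .$$ With $\varphi(\rho)=\frac12(\lambda(\rho)-\rho\lambda'(\rho))$, a curve $(\eta(t),F(t))$ with $\eta_t=u\circ\eta$, $F_t=f\circ\eta$ is a geodesic iff $$u_t+uu_x+\frac1\rho\big(\varphi(\rho)f^2\big)_x=0,\qquad f_t+uf_x+\frac{2\varphi(\rho)}{\lambda(\rho)}f\,u_x=0 .$$ The Riemannian exponential map sends an initial velocity $U_0$ at a base point $\gamma_0$ to $\gamma(1)$, where $\gamma$ is the geodesic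 with $\gamma(0)=\gamma_0$, $\gamma'(0)=U_0$, wherever defined. *)

(* Defs.v *)
From Stdlib Require Import Reals Lra ClassicalEpsilon.
From Coquelicot Require Import Coquelicot.
Open Scope R_scope.

(** * Conventions

    [S^1] is [R / 2 pi Z].  A real function on [S^1] is a [2 pi]-periodic
    function [R -> R]; a map [S^1 -> S^1] of degree [d] is represented by a
    lift [g : R -> R], so that [g (x + 2 pi) = g x + 2 pi d].  Lifts are unique
    up to a constant in [2 pi Z], so passing to lifts is a covering of the space
    of maps: it does not affect differentiability, and the tangent vectors,
    which are pairs of periodic functions, are the same. *)

Definition lift (d : Z) (g : R -> R) : Prop :=
  (forall x, continuous g x) /\
  (forall x, g (x + 2 * PI) = g x + 2 * PI * IZR d).

Definition smooth (g : R -> R) : Prop := forall k x, ex_derive_n g k x.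

(** * Sobolev spaces on the circle *)

(** [|ghat n|^2] with [ghat n = (1 / 2 pi) int_0^{2 pi} g(x) e^{-inx} dx];
    [g] is real-valued, so [|ghat (-n)| = |ghat n|]. *)
Definition fourier_sq (g : R -> R) (n : nat) : R :=
  (RInt (fun x => g x * cos (INR n * x)) 0 (2 * PI) / (2 * PI)) ^ 2 +
  (RInt (fun x => g x * sin (INR n * x)) 0 (2 * PI) / (2 * PI)) ^ 2.

(** [sum over n in Z of (1 + n^2)^s |ghat n|^2], with [n] and [-n] grouped. *)
Definition Hs_term (s : R) (g : R -> R) (n : nat) : R :=
  (if Nat.eqb n 0 then 1 else 2) * Rpower (1 + INR n ^ 2) s * fourier_sq g n.

Definition Hs_finite (s : R) (g : R -> R) : Prop := ex_series (Hs_term s g).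

(** Meaningful only when [Hs_finite s g]; below it is applied to differences of
    elements of one and the same [Hs_lift s d], and these have finite norm. *)
Definition Hs_norm (s : R) (g : R -> R) : R := sqrt (Series (Hs_term s g)).

(** The [H^s]-closure of the smooth maps of degree [d], taken among continuous
    maps, which is no restriction for [s > 1/2] by the Sobolev embedding. *)
Definition Hs_lift (s : R) (d : Z) (g : R -> R) : Prop :=
  lift d g /\
  exists gk : nat -> R -> R,
    (forall k, lift d (gk k) /\ smooth (gk k) /\
               Hs_finite s (fun x => gk k x - g x)) /\
    is_lim_seq (fun k => Hs_norm s (fun x => gk k x - g x)) 0.

(** * Pairs: points [(eta, F)] and tangent vectors [(U, V)] *)

Definition fpair : Type := ((R -> R) * (R -> R))%type.

Definition fadd (w z : fpair) : fpair :=
  (fun x => fst w x + fst z x, fun x => snd w x + snd z x).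
Definition fscal (c : R) (w : fpair) : fpair :=
  (fun x => c * fst w x, fun x => c * snd w x).
Definition fsub (w z : fpair) : fpair := fadd w (fscal (-1) z).

Definition fnorm (s : R) (w : fpair) : R := Hs_norm s (fst w) + Hs_norm s (snd w).

(** A tangent vector of [H^s(S^1, S^1 x R)]. *)
Definition tangent (s : R) (w : fpair) : Prop :=
  Hs_lift s 0 (fst w) /\ Hs_lift s 0 (snd w).

(** Orientation-preserving [C^1] diffeomorphism of the circle, through its lift. *)
Definition diffeo (eta : R -> R) : Prop :=
  lift 1 eta /\
  (forall x, ex_derive eta x /\ continuous (Derive eta) x /\ 0 < Derive eta x).

(** The points [(eta, F)] of [H^s(S^1, S^1 x R)] with [eta] a diffeomorphism,
    which are those where the metric is defined. *)
Definition point (s : R) (p : fpair) : Prop :=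
  Hs_lift s 1 (fst p) /\ diffeo (fst p) /\ Hs_lift s 0 (snd p).

(** * The metric *)

Definition inverse (eta : R -> R) (x : R) : R :=
  epsilon (inhabits 0) (fun y => eta y = x).

Definition density (eta : R -> R) (x : R) : R := / Derive eta (inverse eta x).

Lemma inverse_spec (eta : R -> R) (x : R) :
  diffeo eta -> inverse eta (eta x) = x.
Proof.
intros [_ H].
assert (Hy : eta (inverse eta (eta x)) = eta x).
{ apply (epsilon_spec (inhabits 0) (fun y => eta y = eta x)). now exists x. }
assert (Hinc : forall a b, a < b -> eta a < eta b).
{ intros a b ab.
  destruct (MVT_gen eta a b (Derive eta)) as [c [_ Hc]].
  - intros y _. apply Derive_correct, H.
  - intros y _. apply continuity_pt_filterlim.
    apply (ex_derive_continuous eta y), H.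
  - destruct (H c) as [_ [_ Hc0]].
    assert (0 < Derive eta c * (b - a)) by (apply Rmult_lt_0_compat; lra).
    lra. }
destruct (Rtotal_order (inverse eta (eta x)) x) as [h|[h|h]]; auto;
  apply Hinc in h; lra.
Qed.

Lemma density_spec (eta : R -> R) (x : R) :
  diffeo eta -> density eta (eta x) * Derive eta x = 1.
Proof.
intros H. unfold density. rewrite (inverse_spec eta x H).
destruct H as [_ H]. destruct (H x) as [_ [_ Hx]]. field. lra.
Qed.

(** [w1 = (u o eta, f o eta)] and [w2 = (v o eta, g o eta)] are tangent at
    [p = (eta, F)]. *)
Definition metric (lam : R -> R) (p w1 w2 : fpair) : R :=
  let eta := fst p in
  let rho := density eta in
  let u x := fst w1 (inverse eta x) in
  let f x := snd w1 (inverse eta x) in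
  let v x := fst w2 (inverse eta x) in
  let g x := snd w2 (inverse eta x) in
  RInt (fun x => lam (rho x) * f x * g x + rho x * u x * v x) 0 (2 * PI).

(** * Geodesics *)

(** [dgam] is the velocity of [gam]. *)
Definition energy (lam : R -> R) (gam dgam : R -> fpair) : R :=
  / 2 * RInt (fun t => metric lam (gam t) (dgam t) (dgam t)) 0 1.

(** [gam] restricted to [0,1] is a [C^1] curve of points in the [H^s] topology,
    with velocity [dgam]. *)
Definition C1_curve (s : R) (gam dgam : R -> fpair) : Prop :=
  (forall t, 0 <= t <= 1 -> point s (gam t) /\ tangent s (dgam t)) /\
  (forall t, 0 <= t <= 1 -> forall eps, 0 < eps -> exists delta, 0 < delta /\
     forall r, 0 <= r <= 1 -> Rabs (r - t) < delta ->
       fnorm s (fsub (fsub (gam r) (gam t)) (fscal (r - t) (dgam t)))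
         <= eps * Rabs (r - t) /\
       fnorm s (fsub (dgam r) (dgam t)) <= eps).

(** [h] is of class [C^infinity] in both variables: [D i j] is the partial
    derivative of order [i] in [t] and [j] in [x]. *)
Definition smooth2 (h : R -> R -> R) : Prop :=
  exists D : nat -> nat -> R -> R -> R,
    (forall t x, D 0%nat 0%nat t x = h t x) /\
    (forall i j t x,
       is_derive (fun r => D i j r x) t (D (S i) j t x) /\
       is_derive (fun y => D i j t y) x (D i (S j) t x) /\
       continuity_2d_pt (D i j) t x).

Definition variation (h : R -> R -> R) : Prop :=
  smooth2 h /\
  (forall t x, h t (x + 2 * PI) = h t x) /\
  (forall x, h 0 x = 0 /\ h 1 x = 0).

Definition dtime (h : R -> R -> R) (t x : R) : R := Derive (fun r => h r x) t.

(** Geodesics on [0,1] are the [C^1] curves in [H^s] that are critical for the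
    energy under smooth variations with fixed endpoints; since the metric is
    weak, no Levi-Civita connection is presupposed. *)
Definition geodesic (lam : R -> R) (s : R) (gam dgam : R -> fpair) : Prop :=
  C1_curve s gam dgam /\
  forall h k : R -> R -> R, variation h -> variation k ->
    is_derive
      (fun e => energy lam
                  (fun t => fadd (gam t) (fscal e (h t, k t)))
                  (fun t => fadd (dgam t) (fscal e (dtime h t, dtime k t))))
      0 0.

(** * The exponential map *)

(** Elements of the tangent bundle are written [(p, U)]: as the points [p] form
    an open subset of an affine space, the bundle is trivial and its topology is
    the product topology. *)
Definition bpair : Type := (fpair * fpair)%type.

Definition badd (W Z : bpair) : bpair :=
  (fadd (fst W) (fst Z), fadd (snd W) (snd Z)).
Definition bscal (c : R) (W : bpair) : bpair :=
  (fscal c (fst W), fscal c (snd W)).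
Definition bsub (W Z : bpair) : bpair := badd W (bscal (-1) Z).
Definition bnorm (s : R) (W : bpair) : R := fnorm s (fst W) + fnorm s (snd W).
Definition btangent (s : R) (W : bpair) : Prop :=
  tangent s (fst W) /\ tangent s (snd W).

(** The graph of the exponential map: [exp_{fst z} (snd z) = q]. *)
Definition exp_graph (lam : R -> R) (s : R) (z : bpair) (q : fpair) : Prop :=
  exists gam dgam : R -> fpair,
    geodesic lam s gam dgam /\
    gam 0 = fst z /\ dgam 0 = snd z /\ gam 1 = q.

Definition exp_domain (lam : R -> R) (s : R) (z : bpair) : Prop :=
  exists q, exp_graph lam s z q.

Definition bounded_linear (s : R) (L : bpair -> fpair) : Prop :=
  (forall W, btangent s W -> tangent s (L W)) /\
  (forall W Z, btangent s W -> btangent s Z ->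
     L (badd W Z) = fadd (L W) (L Z)) /\
  (forall c W, btangent s W -> L (bscal c W) = fscal c (L W)) /\
  (exists M, forall W, btangent s W -> fnorm s (L W) <= M * bnorm s W).

(** [E] is [C^1] on the subset [dom] of the tangent bundle, with Frechet
    derivative [DE z] at [z], continuous in [z] for the operator norm.  When
    [dom] is not known to be open, increments are taken inside [dom]. *)
Definition C1_on (s : R) (dom : bpair -> Prop) (E : bpair -> fpair) : Prop :=
  exists DE : bpair -> bpair -> fpair,
    forall z, dom z ->
      bounded_linear s (DE z) /\
      (forall eps, 0 < eps -> exists delta, 0 < delta /\
         forall z', dom z' -> bnorm s (bsub z' z) < delta ->
           fnorm s (fsub (fsub (E z') (E z)) (DE z (bsub z' z)))
             <= eps * bnorm s (bsub z' z)) /\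
      (forall eps, 0 < eps -> exists delta, 0 < delta /\
         forall z', dom z' -> bnorm s (bsub z' z) < delta ->
           forall W, btangent s W ->
             fnorm s (fsub (DE z' W) (DE z W)) <= eps * bnorm s W).

(** The exponential map of the metric given by [lam] is [C^1] in the [H^s]
    topology, wherever it is defined. *)
Definition exp_is_C1 (lam : R -> R) (s : R) : Prop :=
  exists E : bpair -> fpair,
    (forall z q, exp_graph lam s z q -> E z = q) /\
    C1_on s (exp_domain lam s) E.

(* Main.v *)
(** In Lagrangian coordinates the energy is [1/2 int int (3 eta_x^2 F_t^2 + eta_t^2)], so that
    [eta_x^2 F_t] is conserved in time; if it is a constant [b], then [eta] solves the gas dynamics
    equation [eta_tt = 9 b^2 eta_xx / eta_x^4], whose simple waves are given explicitly by straight
    characteristics.  Linearizing at [eta = x, F = b t] gives the wave equation [h_tt = 9 b^2 h_xx],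
    so the derivative of the exponential map at [(id, 0; 0, b)] maps [(0, 0; sin (n x), 0)] to a
    vector whose first component is [sin (3 b n) / (3 b n) sin (n x)] (a difference of two simple waves).
    For [3 b n = pi / 2] and [3 b n = pi] these images differ by [(2 / pi) sin (n x)], although both
    base points tend to [(id, 0; 0, 0)] as [n] tends to infinity: in the operator norm the
    derivative is not continuous there. *)

Require Import Defs.
From Stdlib Require Import Reals ZArith Lra Lia ClassicalEpsilon FunctionalExtensionality.
From Coquelicot Require Import Coquelicot.
Open Scope R_scope.

(** * Periodic functions and functions of two variables *)

(* [ring] and [field] do not see through Coquelicot's structures to the carrier [R]. *)
Ltac eqR := match goal with |- @eq _ ?a ?b => change (@eq R a b) end.

(** The exponential map is accessible only where a geodesic is explicit, and its domain is not known
    to be open. The direction [(0, 0; sin (n x), 0)] is therefore reached indirectly: for the data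
    to stay a simple wave, the base point is deformed along with the velocity, to
    [eta0 = y + a cos (n y)]. Waves running in opposite directions, [beta = b] and [beta = - b],
    change the base point and the velocity of [F] in the same way to first order, and the velocity
    of [eta] in opposite ways, so linearity of the derivative isolates the sine. Since [E] takes
    every value allowed by [exp_graph], one explicit geodesic per initial datum determines [E]
    there. The Sobolev exponent drops out because only the n-th sine coefficient of the image is
    followed: the weight that measures [sin (n x)] also controls this coefficient. All other
    estimates are made in [C^m] with an integer [m > s], where differentiation under the integral
    sign and compactness of the circle suffice. *)

Definition periodic (f : R -> R) : Prop := forall x, f (x + 2 * PI) = f x.

Lemma continuous_ex_RInt (f : R -> R) (a b : R) :
  (forall x, continuous f x) -> ex_RInt f a b.
Proof. intros H. apply (ex_RInt_continuous (V := R_CompleteNormedModule)). intros; apply H. Qed.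

Lemma shift_nat (f : R -> R) (c : R) :
  (forall x, f (x + 2 * PI) = f x + c) ->
  forall (k : nat) x, f (x + 2 * PI * INR k) = f x + c * INR k.
Proof.
intros H k; induction k as [|k IH]; intros x.
- simpl. replace (x + 2 * PI * 0) with x by ring. ring.
- rewrite S_INR. replace (x + 2 * PI * (INR k + 1)) with ((x + 2 * PI * INR k) + 2 * PI) by ring.
  rewrite H, IH. ring.
Qed.

(** The point [y] is congruent to [x] modulo [2 PI], and subtracting the linear part makes [f]
    periodic. The quantifier on [f] comes after [y], so that one representative serves several
    functions at once. *)
Lemma fundamental_domain (x : R) :
  exists y, 0 <= y <= 2 * PI /\ forall f c,
    (forall x, f (x + 2 * PI) = f x + c) -> f x - c / (2 * PI) * x = f y - c / (2 * PI) * y.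
Proof.
assert (Hpi := PI_RGT_0).
assert (E : exists y, 0 <= y <= 2 * PI /\ exists k : nat, x = y + 2 * PI * INR k \/ y = x + 2 * PI * INR k).
{ destruct (Rle_dec 0 x) as [hx|hx].
  - assert (A : forall k : nat, x <= 2 * PI * INR k ->
       exists y, 0 <= y <= 2 * PI /\ exists k : nat, x = y + 2 * PI * INR k).
    { intros k; induction k as [|k IH]; intros H.
      - exists x. split. { simpl in H; lra. } exists 0%nat. simpl; ring.
      - rewrite S_INR in H. destruct (Rle_dec x (2 * PI * INR k)) as [h|h]; [auto|].
        exists (x - 2 * PI * INR k). split; [lra|]. exists k. ring. }
    destruct (INR_unbounded (x / (2 * PI))) as [k Hk].
    destruct (A k) as [y [Hy [j Hj]]].
    { apply Rlt_le. apply Rmult_lt_compat_l with (r := 2 * PI) in Hk; [|lra].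
      replace (2 * PI * (x / (2 * PI))) with x in Hk by (field; lra). lra. }
    exists y; split; auto. exists j; auto.
  - assert (A : forall k : nat, - (2 * PI * INR k) <= x -> x <= 2 * PI ->
       exists y, 0 <= y <= 2 * PI /\ exists k : nat, y = x + 2 * PI * INR k).
    { intros k; induction k as [|k IH]; intros H H2.
      - exists x. split. { simpl in H; lra. } exists 0%nat. simpl; ring.
      - rewrite S_INR in H. destruct (Rle_dec (- (2 * PI * INR k)) x) as [h|h]; [auto|].
        exists (x + 2 * PI * INR (S k)). rewrite S_INR. split; [lra|]. exists (S k).
        rewrite S_INR; ring. }
    destruct (INR_unbounded (- x / (2 * PI))) as [k Hk].
    destruct (A k) as [y [Hy [j Hj]]]; [|lra|].
    { apply Rmult_lt_compat_l with (r := 2 * PI) in Hk; [|lra].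
      replace (2 * PI * (- x / (2 * PI))) with (- x) in Hk by (field; lra). lra. }
    exists y; split; auto. exists j; auto. }
destruct E as [y [Hy [k Hk]]]. exists y; split; auto. intros f c Hf.
destruct Hk as [-> | ->]; rewrite (shift_nat f c Hf k); field; lra.
Qed.

Lemma periodic_reduce (x : R) :
  exists y, 0 <= y <= 2 * PI /\ forall f, periodic f -> f x = f y.
Proof.
destruct (fundamental_domain x) as [y [Hy H]]. exists y; split; auto.
intros f Hf. specialize (H f 0). unfold Rdiv in H. rewrite !Rmult_0_l, !Rminus_0_r in H.
apply H. intros z. rewrite Hf; ring.
Qed.

Lemma periodic_bounded (f : R -> R) :
  (forall x, continuous f x) -> periodic f -> exists B, 0 < B /\ forall x, Rabs (f x) <= B.
Proof.
intros Hc Hp. assert (Hpi := PI_RGT_0).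
destruct (continuity_ab_maj (fun x => Rabs (f x)) 0 (2 * PI)) as [M [HM _]]; [lra| |].
{ intros c _. apply continuity_pt_filterlim.
  apply (continuous_comp f Rabs); [apply Hc|]. apply continuous_Rabs. }
exists (Rabs (f M) + 1). split. { assert (h := Rabs_pos (f M)); lra. }
intros x. destruct (periodic_reduce x) as [y [Hy H]]. rewrite (H f Hp). specialize (HM y Hy). simpl in HM; lra.
Qed.

Lemma RInt_periodic_shift (f : R -> R) (a : R) :
  (forall x, continuous f x) -> periodic f -> RInt f a (a + 2 * PI) = RInt f 0 (2 * PI).
Proof.
intros Hc Hp.
assert (I : forall u v, ex_RInt f u v) by (intros; apply continuous_ex_RInt, Hc).
rewrite <- (RInt_Chasles f a 0 (a + 2 * PI)), <- (RInt_Chasles f 0 (2 * PI) (a + 2 * PI)) by apply I.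
assert (E : RInt f (2 * PI) (a + 2 * PI) = RInt f 0 a).
{ assert (J := RInt_comp_lin (V := R_CompleteNormedModule) f 1 (2 * PI) 0 a (I _ _)).
  replace (1 * 0 + 2 * PI) with (2 * PI) in J by ring.
  replace (1 * a + 2 * PI) with (a + 2 * PI) in J by ring. rewrite <- J.
  apply RInt_ext. intros x _. change (1 * f (1 * x + 2 * PI) = f x). rewrite !Rmult_1_l. apply Hp. }
rewrite E. rewrite <- (opp_RInt_swap f) by apply I.
unfold plus, opp; simpl. ring.
Qed.

(** The increment [c] is left free in order to cover lifts of degree one as well as periodic
    functions. *)
Lemma is_derive_periodic (f f' : R -> R) :
  (forall x, is_derive f x (f' x)) -> (exists c, forall x, f (x + 2 * PI) = f x + c) -> periodic f'.
Proof.
intros H [c Hc] x.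
assert (A : is_derive f x (f' (x + 2 * PI))).
{ apply (is_derive_ext (fun y => f (y + 2 * PI) - c)). { intros t. rewrite Hc. eqR. ring. }
  auto_derive. { exists (f' (x + 2 * PI)). apply H. }
  rewrite Rmult_1_l. apply is_derive_unique, H. }
rewrite <- (is_derive_unique _ _ _ A). apply is_derive_unique, H.
Qed.

(** * Joint continuity and integrals depending on a parameter *)

Definition continuous2 (f : R -> R -> R) : Prop := forall t y, continuity_2d_pt f t y.

Lemma continuous2_slice (f : R -> R -> R) (t y : R) :
  continuity_2d_pt f t y -> continuous (f t) y.
Proof.
intros H. apply continuity_pt_filterlim, continuity_pt_locally. intros eps.
destruct (H eps) as [d Hd]. exists d. intros z Hz. apply Hd; auto.
rewrite Rminus_diag, Rabs_R0. apply cond_pos.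
Qed.

Lemma continuous2_swap (f : R -> R -> R) (t y : R) :
  continuity_2d_pt f t y -> continuity_2d_pt (fun y t => f t y) y t.
Proof. intros H eps. destruct (H eps) as [d Hd]. exists d. intros; apply Hd; auto. Qed.

Lemma continuous2_slice_l (f : R -> R -> R) (t y : R) :
  continuity_2d_pt f t y -> continuous (fun t => f t y) t.
Proof. intros H. apply (continuous2_slice (fun y t => f t y)), continuous2_swap, H. Qed.

Lemma continuous2_comp (f g : R -> R -> R) :
  continuous2 f -> continuous2 g -> continuous2 (fun t y => f t (g t y)).
Proof.
intros Hf Hg t y eps. destruct (Hf t (g t y) eps) as [d Hd].
destruct (Hg t y d) as [d' Hd'].
exists (mkposreal _ (Rmin_pos _ _ (cond_pos d) (cond_pos d'))). simpl. intros u v Hu Hv.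
apply Hd. { eapply Rlt_le_trans; [apply Hu|apply Rmin_l]. }
apply Hd'; eapply Rlt_le_trans; eauto using Rmin_r.
Qed.

Lemma continuous2_of_l (c : R -> R) : (forall t, continuous c t) -> continuous2 (fun t _ => c t).
Proof.
intros H t y. apply (continuity_1d_2d_pt_comp c (fun t _ => t)).
- apply continuity_pt_filterlim, H.
- apply continuity_2d_pt_id1.
Qed.

Lemma continuous2_of_r (c : R -> R) : (forall t, continuous c t) -> continuous2 (fun _ y => c y).
Proof.
intros H t y. apply (continuity_1d_2d_pt_comp c (fun _ t => t)).
- apply continuity_pt_filterlim, H.
- apply continuity_2d_pt_id2.
Qed.

(** Uniform continuity near the compact set [{t0} x [0, 2 PI]]; both [f t] and [f t0] are carried to
    the same point of the fundamental domain. *)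
Lemma periodic_uniform (f : R -> R -> R) (t0 : R) :
  continuous2 f -> (forall t, periodic (f t)) -> forall eps, 0 < eps ->
  exists delta, 0 < delta /\ forall t y, Rabs (t - t0) < delta -> Rabs (f t y - f t0 y) < eps.
Proof.
intros Hc Hp eps He.
destruct (uniform_continuity_2d_1d' f 0 (2 * PI) t0 (fun x _ => Hc t0 x) (mkposreal _ He)) as [d Hd].
exists d. split; [apply cond_pos|]. intros t y Ht.
destruct (periodic_reduce y) as [z [Hz H]].
rewrite (H _ (Hp t)), (H _ (Hp t0)). assert (h := cond_pos d).
apply Rabs_def2 in Ht.
apply (Hd z t0 z t); auto; try lra. rewrite Rminus_diag, Rabs_R0; auto.
Qed.

Lemma continuous_RInt_param (f : R -> R -> R) (a b : R) :
  continuous2 f -> forall t, continuous (fun t => RInt (f t) a b) t.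
Proof.
intros Hc.
assert (A : forall a b, a <= b -> forall t, continuous (fun t => RInt (f t) a b) t).
{ clear a b. intros a b ab t. apply continuity_pt_filterlim, continuity_pt_locally. intros eps.
  (* The summand 1 covers [a = b] and makes the final inequality strict. *)
  assert (He : 0 < eps / (b - a + 1)) by (apply Rdiv_lt_0_compat; [apply cond_pos|lra]).
  destruct (uniform_continuity_2d_1d' f a b t (fun x _ => Hc t x) (mkposreal _ He)) as [d Hd].
  exists d. intros u Hu. assert (h := cond_pos d). change (Rabs (u - t) < d) in Hu. apply Rabs_def2 in Hu.
  assert (E : RInt (f u) a b - RInt (f t) a b = RInt (fun y => f u y - f t y) a b).
  { symmetry. apply (RInt_minus (f u) (f t)); apply continuous_ex_RInt; intros; apply continuous2_slice, Hc. }
  rewrite E. apply Rle_lt_trans with ((b - a) * (eps / (b - a + 1))).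
  - apply abs_RInt_le_const; auto.
    + apply continuous_ex_RInt. intros y. apply (continuous_minus (f u) (f t)); apply continuous2_slice, Hc.
    + intros y Hy. apply Rlt_le, (Hd y t y u); auto; try lra. rewrite Rminus_diag, Rabs_R0; auto.
  - apply Rlt_le_trans with ((b - a + 1) * (eps / (b - a + 1))).
    + apply Rmult_lt_compat_r; lra.
    + right. field. lra. }
intros t. destruct (Rle_dec a b) as [h|h]; [apply A, h|].
apply continuous_ext with (fun t => opp (RInt (f t) b a)).
{ intros u. apply opp_RInt_swap. apply continuous_ex_RInt; intros; apply continuous2_slice, Hc. }
apply (continuous_opp (fun t => RInt (f t) b a)). apply A. lra.
Qed.

Lemma is_derive_RInt_continuous2 (V V' : R -> R -> R) (a b y : R) :
  (forall t y, is_derive (V t) y (V' t y)) -> continuous2 V -> continuous2 V' ->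
  is_derive (fun y => RInt (fun t => V t y) a b) y (RInt (fun t => V' t y) a b).
Proof.
intros HD Hc Hc'.
assert (E : RInt (fun t => Derive (fun u => V t u) y) a b = RInt (fun t => V' t y) a b).
{ apply RInt_ext. intros t _. apply is_derive_unique, HD. }
rewrite <- E. apply (is_derive_RInt_param (fun y t => V t y)).
- exists (mkposreal 1 Rlt_0_1). intros z _ t _. exists (V' t z); apply HD.
- intros t _. apply (continuity_2d_pt_ext (fun u v => V' v u)).
  { intros u v. symmetry. apply is_derive_unique, HD. }
  apply continuous2_swap, Hc'.
- exists (mkposreal 1 Rlt_0_1). intros z _. apply continuous_ex_RInt. intros t. apply continuous2_slice_l, Hc.
Qed.

(** Only continuity is asked in [t]: Sobolev norms see derivatives in [y] alone, and the time
    dependence below passes through a clamp that is merely Lipschitz. The derivative is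
    existentially quantified, so closure under an operation amounts to exhibiting a formula of the
    same kind. *)
Fixpoint ydiff (n : nat) (f : R -> R -> R) : Prop :=
  continuous2 f /\
  match n with
  | O => True
  | S m => exists g, (forall t y, is_derive (f t) y (g t y)) /\ ydiff m g
  end.

Lemma ydiff_continuous2 (n : nat) (f : R -> R -> R) : ydiff n f -> continuous2 f.
Proof. destruct n; intros [H _]; exact H. Qed.

Lemma ydiff_pred (n : nat) (f : R -> R -> R) : ydiff (S n) f -> ydiff n f.
Proof.
revert f; induction n as [|n IH]; intros f [Hc [g [Hg H]]]; split; auto.
exists g; split; auto.
Qed.

Lemma ydiff_plus (n : nat) (f g : R -> R -> R) :
  ydiff n f -> ydiff n g -> ydiff n (fun t y => f t y + g t y).
Proof.
revert f g; induction n as [|n IH]; intros f g [Hf Hf'] [Hg Hg']; split.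
1, 3: intros t y; apply continuity_2d_pt_plus; auto.
- exact I.
- destruct Hf' as [f' [Hf1 Hf2]], Hg' as [g' [Hg1 Hg2]].
  exists (fun t y => f' t y + g' t y). split; auto.
  intros t y. apply (is_derive_plus (f t) (g t)); auto.
Qed.

Lemma ydiff_mult (n : nat) (f g : R -> R -> R) :
  ydiff n f -> ydiff n g -> ydiff n (fun t y => f t y * g t y).
Proof.
revert f g; induction n as [|n IH]; intros f g Hf Hg; split.
1, 3: intros t y; apply continuity_2d_pt_mult; eapply ydiff_continuous2; eauto.
- exact I.
- assert (Hf0 := ydiff_pred _ _ Hf). assert (Hg0 := ydiff_pred _ _ Hg).
  destruct Hf as [_ [f' [Hf1 Hf2]]], Hg as [_ [g' [Hg1 Hg2]]].
  exists (fun t y => f' t y * g t y + f t y * g' t y). split.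
  + intros t y. apply (is_derive_mult (f t) (g t)); auto. intros; apply Rmult_comm.
  + apply ydiff_plus; apply IH; auto.
Qed.

Lemma ydiff_of_l (n : nat) (c : R -> R) :
  (forall t, continuous c t) -> ydiff n (fun t _ => c t).
Proof.
assert (Z : forall n c, (forall t, continuous c t) -> ydiff n (fun t _ => c t)); auto.
clear. induction n as [|n IH]; intros c Hc; split; auto; try (apply continuous2_of_l, Hc).
exists (fun _ _ => 0). split.
- intros t y. apply (is_derive_const (c t)).
- apply (IH (fun _ => 0)). intros; apply continuous_const.
Qed.

Lemma ydiff_const (n : nat) (c : R) : ydiff n (fun _ _ => c).
Proof. apply (ydiff_of_l n (fun _ => c)). intros; apply continuous_const. Qed.

(** The derivative is written as a product of [f'] and copies of [/ f], so that the induction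
    hypothesis and [ydiff_mult] apply to it. *)
Lemma ydiff_inv (n : nat) (f : R -> R -> R) :
  (forall t y, f t y <> 0) -> ydiff n f -> ydiff n (fun t y => / f t y).
Proof.
intros Hn; induction n as [|n IH]; intros Hf; split.
1, 3: intros t y; apply continuity_2d_pt_inv; auto; eapply ydiff_continuous2; eauto.
- exact I.
- assert (Hf0 := ydiff_pred _ _ Hf). destruct Hf as [_ [f' [Hf1 Hf2]]].
  exists (fun t y => -1 * (f' t y * (/ f t y * / f t y))). split.
  + intros t y. replace (-1 * (f' t y * (/ f t y * / f t y))) with (- f' t y / f t y ^ 2) by (field; auto).
    apply is_derive_inv; auto.
  + apply ydiff_mult; [apply ydiff_const|]. apply ydiff_mult; auto. apply ydiff_mult; auto.
Qed.

(** Since [Y] solves the differential equation [Y' = d t Y], the derivative of [a t (Y t y)] is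
    [d a'] evaluated at [Y], again a composition with [Y]. Regularity is bootstrapped from the mere
    continuity of [Y], without ever differentiating [Y] twice. *)
Lemma ydiff_comp (n : nat) (a d Y : R -> R -> R) :
  continuous2 Y -> (forall t y, is_derive (Y t) y (d t (Y t y))) ->
  ydiff n d -> ydiff n a -> ydiff n (fun t y => a t (Y t y)).
Proof.
intros HY HD. revert a; induction n as [|n IH]; intros a Hd Ha; split.
1, 3: apply continuous2_comp; auto; eapply ydiff_continuous2; eauto.
- exact I.
- destruct Ha as [_ [a' [Ha1 Ha2]]].
  exists (fun t y => d t (Y t y) * a' t (Y t y)). split.
  + intros t y. apply (is_derive_comp (a t) (Y t)); auto.
  + apply (IH (fun t z => d t z * a' t z)); [apply ydiff_pred; auto|].
    apply ydiff_mult; auto. apply ydiff_pred; auto.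
Qed.

Lemma ydiff_trig (k : R) (n : nat) :
  ydiff n (fun _ y => cos (k * y)) /\ ydiff n (fun _ y => sin (k * y)).
Proof.
induction n as [|n [IHc IHs]]; repeat split.
1, 3: apply (continuous2_of_r (fun y => cos (k * y))); intros t; apply (ex_derive_continuous (fun y => cos (k * y))); auto_derive; auto.
1, 3: apply (continuous2_of_r (fun y => sin (k * y))); intros t; apply (ex_derive_continuous (fun y => sin (k * y))); auto_derive; auto.
- exists (fun _ y => - k * sin (k * y)). split.
  + intros t y. auto_derive; auto; ring.
  + apply ydiff_mult; auto. apply ydiff_const.
- exists (fun _ y => k * cos (k * y)). split.
  + intros t y. auto_derive; auto; ring.
  + apply ydiff_mult; auto. apply ydiff_const.
Qed.

Lemma ydiff_smooth (f : R -> R -> R) (t : R) : (forall n, ydiff n f) -> smooth (f t).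
Proof.
intros H k.
assert (A : forall k f, ydiff k f -> forall y, ex_derive_n (f t) k y).
{ clear. induction k as [|k IH]; intros f H y; [exact I|].
  destruct H as [_ [g [Hg H]]]. destruct k as [|k].
  - exists (g t y). apply Hg.
  - apply (ex_derive_ext (Derive_n (g t) k)).
    + intros z. transitivity (Derive_n (Derive_n (f t) 1) k z).
      { apply Derive_n_ext. intros x. symmetry. apply is_derive_unique, Hg. }
      rewrite Derive_n_comp. f_equal. lia.
    + apply (IH g H y). }
apply A, H.
Qed.

(** * Fourier coefficients and Sobolev norms *)

(** The inequality [||g||_{C^n} <= B], kept as a relation with one bound for all the derivatives
    instead of a norm. *)
Fixpoint bounded_C (n : nat) (g : R -> R) (B : R) : Prop :=
  (forall y, continuous g y) /\ (forall y, Rabs (g y) <= B) /\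
  match n with
  | O => True
  | S m => exists g', (forall y, is_derive g y (g' y)) /\ bounded_C m g' B
  end.

Lemma bounded_C_le (n : nat) (g : R -> R) (A B : R) :
  A <= B -> bounded_C n g A -> bounded_C n g B.
Proof.
intros H; revert g; induction n as [|n IH]; intros g [H1 [H2 H3]]; repeat split; auto.
1, 2: intros y; eapply Rle_trans; eauto.
destruct H3 as [g' [H3 H4]]. exists g'; auto.
Qed.

Lemma bounded_C_scal (n : nat) (g : R -> R) (B c : R) :
  bounded_C n g B -> bounded_C n (fun y => c * g y) (Rabs c * B).
Proof.
revert g; induction n as [|n IH]; intros g [H1 [H2 H3]]; repeat split.
1, 3: intros y; apply (continuous_mult (fun _ => c) g); [apply continuous_const|auto].
1, 2: intros y; rewrite Rabs_mult; apply Rmult_le_compat_l; auto; apply Rabs_pos.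
- destruct H3 as [g' [H3 H4]]. exists (fun y => c * g' y); split; auto.
  intros y. apply (is_derive_scal g y c (g' y)), H3.
Qed.

Lemma bounded_C_plus (n : nat) (f g : R -> R) (A B : R) :
  bounded_C n f A -> bounded_C n g B -> bounded_C n (fun y => f y + g y) (A + B).
Proof.
revert f g; induction n as [|n IH]; intros f g [F1 [F2 F3]] [H1 [H2 H3]]; repeat split.
1, 3: intros y; apply (continuous_plus f g); auto.
1, 2: intros y; eapply Rle_trans; [apply Rabs_triang|]; apply Rplus_le_compat; auto.
- destruct H3 as [g' [H3 H4]], F3 as [f' [F3 F4]]. exists (fun y => f' y + g' y); split; auto.
  intros y. apply (is_derive_plus f g); auto.
Qed.

Lemma bounded_C_continuous (n : nat) (g : R -> R) (B : R) :
  bounded_C n g B -> forall y, continuous g y.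
Proof. destruct n; intros [H _]; exact H. Qed.

Lemma bounded_C_bound (n : nat) (g : R -> R) (B : R) :
  bounded_C n g B -> forall y, Rabs (g y) <= B.
Proof. destruct n; intros [_ [H _]]; exact H. Qed.

Lemma smooth_derive (g : R -> R) : smooth g -> smooth (Derive g).
Proof.
intros H k. destruct k as [|k]; intros x; [exact I|].
apply (ex_derive_ext (Derive_n g (S k))); [|apply (H (S (S k)))].
intros y. change (Derive g) with (Derive_n g 1). rewrite Derive_n_comp. f_equal; lia.
Qed.

Lemma smooth_continuous (g : R -> R) : smooth g -> forall x, continuous g x.
Proof. intros H x. apply (ex_derive_continuous g x), (H 1%nat x). Qed.

Lemma smooth_bounded_C (n : nat) (g : R -> R) :
  smooth g -> periodic g -> exists B, 0 < B /\ bounded_C n g B.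
Proof.
revert g; induction n as [|n IH]; intros g Hs Hp;
  destruct (periodic_bounded g (smooth_continuous g Hs) Hp) as [B [HB H]].
- exists B; repeat split; auto. apply smooth_continuous, Hs.
- destruct (IH (Derive g)) as [B' [HB' H']].
  + apply smooth_derive, Hs.
  + apply (is_derive_periodic g).
    * intros x. apply Derive_correct, (Hs 1%nat x).
    * exists 0. intros x; rewrite Hp; ring.
  + exists (Rmax B B'). split; [eapply Rlt_le_trans; [apply HB|apply Rmax_l]|].
    repeat split; [apply smooth_continuous, Hs| |].
    * intros y. eapply Rle_trans; [apply H|apply Rmax_l].
    * exists (Derive g). split; [intros x; apply Derive_correct, (Hs 1%nat x)|].
      eapply bounded_C_le; [apply Rmax_r|apply H'].
Qed.

(** Continuity of [t |-> f t] as a map into [C^n] of the circle. *)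
Lemma ydiff_bounded_C_uniform (n : nat) (f : R -> R -> R) (t0 : R) :
  ydiff n f -> (forall t, periodic (f t)) -> forall eps, 0 < eps ->
  exists delta, 0 < delta /\
    forall t, Rabs (t - t0) < delta -> bounded_C n (fun y => f t y - f t0 y) eps.
Proof.
intros Hf Hp eps He. revert f Hf Hp; induction n as [|n IH]; intros f Hf Hp;
  assert (Hc := ydiff_continuous2 _ _ Hf);
  assert (C : forall t y, continuous (fun y => f t y - f t0 y) y)
   by (intros; apply (continuous_minus (f t) (f t0)); apply continuous2_slice, Hc);
  destruct (periodic_uniform f t0 Hc Hp eps He) as [d [Hd H]].
- exists d; split; auto. intros t Ht; repeat split; auto. intros; apply Rlt_le, H, Ht.
- destruct Hf as [_ [g [Hg Hf]]].
  destruct (IH g Hf) as [d' [Hd' H']].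
  { intros t. apply (is_derive_periodic (f t)); auto. exists 0. intros x. rewrite Hp; ring. }
  exists (Rmin d d'). split; [apply Rmin_pos; auto|]. intros t Ht; repeat split; auto.
  + intros; apply Rlt_le, H. eapply Rlt_le_trans; [apply Ht|apply Rmin_l].
  + exists (fun y => g t y - g t0 y). split.
    * intros y. apply (is_derive_minus (f t) (f t0)); auto.
    * apply H'. eapply Rlt_le_trans; [apply Ht|apply Rmin_r].
Qed.

Lemma abs_RInt_le_sym (f : R -> R) (a b M : R) :
  (forall x, continuous f x) -> (forall x, Rmin a b <= x <= Rmax a b -> Rabs (f x) <= M) ->
  Rabs (RInt f a b) <= Rabs (b - a) * M.
Proof.
intros Hc H. destruct (Rle_dec a b) as [h|h].
- rewrite (Rabs_pos_eq (b - a)) by lra. apply abs_RInt_le_const; auto.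
  + apply continuous_ex_RInt, Hc.
  + intros t Ht; apply H. rewrite Rmin_left, Rmax_right by lra. lra.
- rewrite <- opp_RInt_swap by apply continuous_ex_RInt, Hc. unfold opp; simpl.
  rewrite Rabs_Ropp, Rabs_minus_sym, (Rabs_pos_eq (a - b)) by lra. apply abs_RInt_le_const; [lra| |].
  + apply continuous_ex_RInt, Hc.
  + intros t Ht; apply H. rewrite Rmin_right, Rmax_left by lra. lra.
Qed.

(** This integral is the first-order Taylor remainder of a curve with velocity [V]. Differentiation
    in [y] passes under the integral and yields the same expression for [V'], whence the
    induction. *)
Lemma bounded_C_RInt_increment (n : nat) (V : R -> R -> R) (t0 : R) :
  ydiff n V -> (forall t, periodic (V t)) -> forall eps, 0 < eps ->
  exists delta, 0 < delta /\ forall r, Rabs (r - t0) < delta ->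
    bounded_C n (fun y => RInt (fun t => V t y - V t0 y) t0 r) (eps * Rabs (r - t0)).
Proof.
intros HV Hp eps He. revert V HV Hp; induction n as [|n IH]; intros V HV Hp.
all: assert (Hc := ydiff_continuous2 _ _ HV);
  assert (C : continuous2 (fun t y => V t y - V t0 y))
   by (intros t y; apply continuity_2d_pt_minus; [apply Hc|];
       apply (continuous2_of_r (V t0)); intros; apply continuous2_slice, Hc);
  assert (C' : forall r y, continuous (fun y => RInt (fun t => V t y - V t0 y) t0 r) y)
   by (intros r; apply (continuous_RInt_param (fun y t => V t y - V t0 y));
       intros t y; apply continuous2_swap, C);
  destruct (periodic_uniform V t0 Hc Hp eps He) as [d [Hd H]];
  assert (B : forall r y, Rabs (r - t0) < d ->
    Rabs (RInt (fun t => V t y - V t0 y) t0 r) <= eps * Rabs (r - t0)).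
1, 3: intros r y Hr; rewrite Rmult_comm; apply abs_RInt_le_sym;
  [intros t; apply (continuous2_slice_l (fun t y => V t y - V t0 y)), C|];
  intros t Ht; apply Rlt_le, H; eapply Rle_lt_trans; [|apply Hr];
  unfold Rmin, Rmax in Ht; destruct (Rle_dec t0 r);
  [rewrite !Rabs_pos_eq by lra; lra| rewrite !(Rabs_minus_sym _ t0), !Rabs_pos_eq by lra; lra].
- exists d; split; auto. intros r Hr; repeat split; auto.
- destruct HV as [_ [V' [HV' HV]]].
  destruct (IH V' HV) as [d' [Hd' H']].
  { intros t. apply (is_derive_periodic (V t)); auto. exists 0. intros x. rewrite Hp; ring. }
  exists (Rmin d d'). split; [apply Rmin_pos; auto|]. intros r Hr.
  assert (Hr1 := Rlt_le_trans _ _ _ Hr (Rmin_l _ _)). assert (Hr2 := Rlt_le_trans _ _ _ Hr (Rmin_r _ _)).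
  repeat split; auto.
  exists (fun y => RInt (fun t => V' t y - V' t0 y) t0 r). split; auto.
  intros y. apply (is_derive_RInt_continuous2 (fun t y => V t y - V t0 y) (fun t y => V' t y - V' t0 y)).
  + intros t z. apply (is_derive_minus (V t) (V t0)); auto.
  + exact C.
  + assert (Hc' := ydiff_continuous2 _ _ HV).
    intros t z. apply continuity_2d_pt_minus; [apply Hc'|].
    apply (continuous2_of_r (V' t0)). intros; apply continuous2_slice, Hc'.
Qed.

(** * Decay of Fourier coefficients and comparison with [C^m] *)

Definition fcos (g : R -> R) (n : nat) : R := RInt (fun x => g x * cos (INR n * x)) 0 (2 * PI).
Definition fsin (g : R -> R) (n : nat) : R := RInt (fun x => g x * sin (INR n * x)) 0 (2 * PI).

Lemma continuous_cos_mode (n : nat) (x : R) : continuous (fun x => cos (INR n * x)) x.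
Proof. apply (ex_derive_continuous (fun x => cos (INR n * x))). auto_derive; auto. Qed.

Lemma continuous_sin_mode (n : nat) (x : R) : continuous (fun x => sin (INR n * x)) x.
Proof. apply (ex_derive_continuous (fun x => sin (INR n * x))). auto_derive; auto. Qed.

Lemma ex_RInt_cos_mode (g : R -> R) (n : nat) (a b : R) :
  (forall x, continuous g x) -> ex_RInt (fun x => g x * cos (INR n * x)) a b.
Proof.
intros H. apply continuous_ex_RInt. intros x.
apply (continuous_mult g (fun x => cos (INR n * x))); auto. apply continuous_cos_mode.
Qed.

Lemma ex_RInt_sin_mode (g : R -> R) (n : nat) (a b : R) :
  (forall x, continuous g x) -> ex_RInt (fun x => g x * sin (INR n * x)) a b.
Proof.
intros H. apply continuous_ex_RInt. intros x.
apply (continuous_mult g (fun x => sin (INR n * x))); auto. apply continuous_sin_mode.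
Qed.

Lemma cos_mode_period (n : nat) : cos (INR n * (2 * PI)) = 1.
Proof. rewrite <- cos_0. rewrite <- (cos_period 0 n). f_equal; ring. Qed.

Lemma sin_mode_period (n : nat) : sin (INR n * (2 * PI)) = 0.
Proof. rewrite <- sin_0. rewrite <- (sin_period 0 n). f_equal; ring. Qed.

Lemma RInt_derive_continuous (f f' : R -> R) (a b : R) :
  (forall x, is_derive f x (f' x)) -> (forall x, continuous f' x) -> RInt f' a b = f b - f a.
Proof. intros H Hc. apply is_RInt_unique, (is_RInt_derive f f'); auto. Qed.

Lemma fcos_derive (g g' : R -> R) (n : nat) :
  periodic g -> (forall x, is_derive g x (g' x)) -> (forall x, continuous g' x) ->
  fcos g' n = INR n * fsin g n.
Proof.
intros Hp HD Hc.
assert (Hg : forall x, continuous g x).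
{ intros x. apply (ex_derive_continuous g). exists (g' x); apply HD. }
assert (E : RInt (fun x => g' x * cos (INR n * x) - INR n * (g x * sin (INR n * x))) 0 (2 * PI) = 0).
{ rewrite (RInt_derive_continuous (fun x => g x * cos (INR n * x))).
  - rewrite cos_mode_period. assert (h := Hp 0). rewrite Rplus_0_l in h. rewrite h, Rmult_0_r, cos_0. eqR; ring.
  - intros x. auto_derive. { exists (g' x); apply HD. }
    assert (Dx : Derive (fun x : R => g x) x = g' x) by apply is_derive_unique, HD. rewrite Dx. eqR; ring.
  - intros x. apply (continuous_minus (fun x => g' x * cos (INR n * x)) (fun x => INR n * (g x * sin (INR n * x)))).
    + apply (continuous_mult g' (fun x => cos (INR n * x))); auto. apply continuous_cos_mode.
    + apply (continuous_mult (fun _ => INR n)); [apply continuous_const|].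
      apply (continuous_mult g (fun x => sin (INR n * x))); auto. apply continuous_sin_mode. }
assert (E2 : RInt (fun x => INR n * (g x * sin (INR n * x))) 0 (2 * PI) = INR n * fsin g n).
{ apply (RInt_scal (fun x => g x * sin (INR n * x))). apply ex_RInt_sin_mode; auto. }
rewrite (RInt_minus (fun x => g' x * cos (INR n * x)) (fun x => INR n * (g x * sin (INR n * x)))) in E.
- rewrite E2 in E. unfold minus, plus, opp in E; simpl in E. unfold fcos. lra.
- apply ex_RInt_cos_mode; auto.
- apply (ex_RInt_scal (fun x => g x * sin (INR n * x))), ex_RInt_sin_mode; auto.
Qed.

Lemma fsin_derive (g g' : R -> R) (n : nat) :
  periodic g -> (forall x, is_derive g x (g' x)) -> (forall x, continuous g' x) ->
  fsin g' n = - INR n * fcos g n.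
Proof.
intros Hp HD Hc.
assert (Hg : forall x, continuous g x).
{ intros x. apply (ex_derive_continuous g). exists (g' x); apply HD. }
assert (E : RInt (fun x => g' x * sin (INR n * x) + INR n * (g x * cos (INR n * x))) 0 (2 * PI) = 0).
{ rewrite (RInt_derive_continuous (fun x => g x * sin (INR n * x))).
  - rewrite sin_mode_period, !Rmult_0_r, sin_0. eqR; ring.
  - intros x. auto_derive. { exists (g' x); apply HD. }
    assert (Dx : Derive (fun x : R => g x) x = g' x) by apply is_derive_unique, HD. rewrite Dx. eqR; ring.
  - intros x. apply (continuous_plus (fun x => g' x * sin (INR n * x)) (fun x => INR n * (g x * cos (INR n * x)))).
    + apply (continuous_mult g' (fun x => sin (INR n * x))); auto. apply continuous_sin_mode.
    + apply (continuous_mult (fun _ => INR n)); [apply continuous_const|].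
      apply (continuous_mult g (fun x => cos (INR n * x))); auto. apply continuous_cos_mode. }
assert (E2 : RInt (fun x => INR n * (g x * cos (INR n * x))) 0 (2 * PI) = INR n * fcos g n).
{ apply (RInt_scal (fun x => g x * cos (INR n * x))). apply ex_RInt_cos_mode; auto. }
rewrite (RInt_plus (fun x => g' x * sin (INR n * x)) (fun x => INR n * (g x * cos (INR n * x)))) in E.
- rewrite E2 in E. unfold plus in E; simpl in E. unfold fsin. lra.
- apply ex_RInt_sin_mode; auto.
- apply (ex_RInt_scal (fun x => g x * cos (INR n * x))), ex_RInt_cos_mode; auto.
Qed.

Lemma fourier_sq_eq (g : R -> R) (n : nat) :
  fourier_sq g n = (fcos g n / (2 * PI)) ^ 2 + (fsin g n / (2 * PI)) ^ 2.
Proof. reflexivity. Qed.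

Lemma fourier_sq_nonneg (g : R -> R) (n : nat) : 0 <= fourier_sq g n.
Proof. rewrite fourier_sq_eq. apply Rplus_le_le_0_compat; apply pow2_ge_0. Qed.

Lemma fourier_sq_derive (g g' : R -> R) (n : nat) :
  periodic g -> (forall x, is_derive g x (g' x)) -> (forall x, continuous g' x) ->
  fourier_sq g' n = INR n ^ 2 * fourier_sq g n.
Proof.
intros Hp HD Hc. rewrite !fourier_sq_eq, (fcos_derive g g'), (fsin_derive g g') by auto.
unfold Rdiv. ring.
Qed.

Lemma fourier_sq_le (g : R -> R) (n : nat) (B : R) :
  (forall x, continuous g x) -> (forall x, Rabs (g x) <= B) -> fourier_sq g n <= 2 * B ^ 2.
Proof.
intros Hc HB. rewrite fourier_sq_eq. assert (Hpi := PI_RGT_0).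
assert (A : forall x, Rabs x <= 2 * PI * B -> (x / (2 * PI)) ^ 2 <= B ^ 2).
{ intros x Hx. rewrite <- !Rsqr_pow2. apply Rsqr_le_abs_1. unfold Rdiv.
  rewrite Rabs_mult, Rabs_inv, (Rabs_pos_eq (2 * PI)) by lra.
  apply Rle_trans with B; [|apply Rle_abs].
  apply Rmult_le_reg_r with (2 * PI); [lra|]. rewrite Rmult_assoc, Rinv_l by lra. lra. }
assert (M : forall w : R -> R, (forall x, continuous w x) -> (forall x, Rabs (w x) <= 1) ->
  Rabs (RInt (fun x => g x * w x) 0 (2 * PI)) <= 2 * PI * B).
{ intros w Hw Hw1. replace (2 * PI * B) with ((2 * PI - 0) * B) by ring. apply abs_RInt_le_const; [lra| |].
  - apply continuous_ex_RInt. intros x; apply (continuous_mult g w); auto.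
  - intros x _. rewrite Rabs_mult. rewrite <- (Rmult_1_r B). apply Rmult_le_compat; auto using Rabs_pos. }
assert (h1 := A (fcos g n)). assert (h2 := A (fsin g n)).
assert (fcos g n / (2 * PI) * (fcos g n / (2 * PI)) = (fcos g n / (2 * PI)) ^ 2) by ring.
assert ((fcos g n / (2 * PI)) ^ 2 <= B ^ 2).
{ apply h1, (M (fun x => cos (INR n * x))); [apply continuous_cos_mode|].
  intros x. apply Rabs_le. destruct (COS_bound (INR n * x)); lra. }
assert ((fsin g n / (2 * PI)) ^ 2 <= B ^ 2).
{ apply h2, (M (fun x => sin (INR n * x))); [apply continuous_sin_mode|].
  intros x. apply Rabs_le. destruct (SIN_bound (INR n * x)); lra. }
lra.
Qed.

(** Each of [N] integrations by parts trades one derivative for a factor [n], squared here; the sup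
    bound then applies to the last derivative. *)
Lemma fourier_sq_decay (N : nat) (g : R -> R) (B : R) (n : nat) :
  periodic g -> bounded_C N g B -> INR n ^ (2 * N) * fourier_sq g n <= 2 * B ^ 2.
Proof.
revert g; induction N as [|N IH]; intros g Hp H.
- simpl (INR n ^ (2 * 0)). rewrite Rmult_1_l. apply fourier_sq_le; destruct H as [H [H' _]]; auto.
- destruct H as [_ [_ [g' [Hg H]]]].
  replace (2 * S N)%nat with (2 * N + 2)%nat by lia. rewrite pow_add, Rmult_assoc.
  rewrite <- (fourier_sq_derive g g'); auto.
  + apply IH; auto. apply (is_derive_periodic g); auto. exists 0. intros x; rewrite Hp; ring.
  + eapply bounded_C_continuous, H.
Qed.

Lemma ex_series_inv_square : ex_series (fun n => / (INR n + 1) ^ 2).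
Proof.
(* The majorant telescopes. *)
apply (ex_series_le (K := R_AbsRing) (V := R_CompleteNormedModule) _ (fun n => 2 * (/ (INR n + 1) - / (INR n + 2)))).
- intros n. assert (h := pos_INR n). change (Rabs (/ (INR n + 1) ^ 2) <= 2 * (/ (INR n + 1) - / (INR n + 2))).
  rewrite Rabs_pos_eq by (apply Rlt_le, Rinv_0_lt_compat, pow_lt; lra).
  replace (2 * (/ (INR n + 1) - / (INR n + 2))) with (2 / ((INR n + 1) * (INR n + 2))) by (field; lra).
  apply Rmult_le_reg_r with ((INR n + 1) ^ 2 * (INR n + 2)). { apply Rmult_lt_0_compat; [apply pow_lt|]; lra. }
  field_simplify; lra.
- apply (ex_series_scal (V := R_NormedModule) 2 (fun n => / (INR n + 1) - / (INR n + 2))).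
  exists 1. change (is_lim_seq (sum_n (fun n => / (INR n + 1) - / (INR n + 2))) 1).
  apply (is_lim_seq_ext (fun n => 1 - / (INR n + 2))).
  + intros n. induction n as [|n IH].
    * rewrite sum_O. simpl. field.
    * rewrite sum_Sn, <- IH. unfold plus; simpl (AbelianGroup.sort _). rewrite S_INR. simpl.
      assert (h := pos_INR n). field. lra.
  + replace (Finite 1) with (Rbar_minus 1 0) by (simpl; f_equal; ring).
    apply is_lim_seq_minus'; [apply is_lim_seq_const|].
    apply (is_lim_seq_ext (fun n => / INR (n + 2))). { intros n. rewrite plus_INR. reflexivity. }
    apply (is_lim_seq_incr_n (fun n => / INR n) 2).
    replace (Finite 0) with (Rbar_inv p_infty) by reflexivity.
    apply is_lim_seq_inv; [apply is_lim_seq_INR|discriminate].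
Qed.

(* The order of differentiability which makes the series of the H^s norm dominated by [sum 1/n^2]. *)
Definition order (s : R) : nat := S (Z.to_nat (up s)).

Lemma Rpower_le_pow (s : R) (n : nat) :
  Rpower (1 + INR n ^ 2) s <= (2 * (INR n + 1) ^ 2) ^ Z.to_nat (up s) .
Proof.
assert (h := pos_INR n).
assert (h1 : 1 <= 1 + INR n ^ 2) by nra.
apply Rle_trans with (Rpower (1 + INR n ^ 2) (INR (Z.to_nat (up s)))).
- apply Rle_Rpower; auto. destruct (archimed s) as [hs _].
  apply Rle_trans with (IZR (up s)); [lra|].
  destruct (Z_le_gt_dec 0 (up s)) as [hz|hz].
  + rewrite INR_IZR_INZ, Z2Nat.id by auto. lra.
  (* For a negative exponent [Z.to_nat] returns 0, which is still an upper bound. *)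
  + apply Rle_trans with 0; [apply IZR_le; lia|apply pos_INR].
- rewrite Rpower_pow by lra. apply pow_incr. nra.
Qed.

(** With [M] the exponent rounded up, the weight is of order [n ^ (2 M)], while [M + 1] bounded
    derivatives give a decay of order [n ^ (-2 (M + 1))]; the product is summable like [1 / n^2].
    The constant depends on [s] alone, which reduces every Sobolev estimate below to one in
    [C^m]. *)
Lemma Hs_norm_bounded_C (s : R) :
  exists C, 0 < C /\ forall g B, 0 <= B -> periodic g -> bounded_C (order s) g B ->
    Hs_finite s g /\ Hs_norm s g <= C * B.
Proof.
set (M := Z.to_nat (up s)).
set (K := 4 * 2 ^ M * 4 ^ (M + 1)).
assert (HK : 1 <= K).
{ unfold K. assert (1 <= 2 ^ M) by (apply pow_R1_Rle; lra). assert (1 <= 4 ^ (M + 1)) by (apply pow_R1_Rle; lra). nra. }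
set (a := fun n => / (INR n + 1) ^ 2).
assert (Ha : forall n, 0 < a n).
{ intros n. apply Rinv_0_lt_compat, pow_lt. assert (h := pos_INR n); lra. }
assert (T : forall g B, 0 <= B -> periodic g -> bounded_C (order s) g B -> forall n,
   0 <= Hs_term s g n <= 2 * K * B ^ 2 * a n).
{ intros g B HB Hp H n.
  assert (Hf := fourier_sq_nonneg g n).
  assert (Hr : 0 < Rpower (1 + INR n ^ 2) s) by apply exp_pos.
  split. { unfold Hs_term. destruct (Nat.eqb n 0); apply Rmult_le_pos; auto; lra. }
  assert (h := pos_INR n).
  assert (D : INR n ^ (2 * (M + 1)) * fourier_sq g n <= 2 * B ^ 2).
  { replace (M + 1)%nat with (order s) by (unfold order, M; lia). apply fourier_sq_decay; auto. }
  assert (D0 : fourier_sq g n <= 2 * B ^ 2).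
  { apply fourier_sq_le. eapply bounded_C_continuous, H. eapply bounded_C_bound, H. }
  (* The factor [4 ^ (M + 1)] comes from [(n + 1)^2 <= 4 n^2] for [n >= 1]; at [n = 0] the plain sup
     bound [D0] is used. *)
  assert (E : ((INR n + 1) ^ 2) ^ (M + 1) * fourier_sq g n <= 4 ^ (M + 1) * (2 * B ^ 2)).
  { destruct n as [|n].
    - simpl (INR 0). rewrite Rplus_0_l, !pow1, Rmult_1_l.
      assert (1 <= 4 ^ (M + 1)) by (apply pow_R1_Rle; lra). nra.
    - apply Rle_trans with ((4 * INR (S n) ^ 2) ^ (M + 1) * fourier_sq g (S n)).
      + apply Rmult_le_compat_r; auto. apply pow_incr. rewrite S_INR. assert (h' := pos_INR n). nra.
      + rewrite Rpow_mult_distr, <- pow_mult, Rmult_assoc. apply Rmult_le_compat_l; auto. apply pow_le; lra. }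
  unfold Hs_term.
  apply Rle_trans with (2 * Rpower (1 + INR n ^ 2) s * fourier_sq g n).
  { apply Rmult_le_compat_r; auto. apply Rmult_le_compat_r; [lra|]. destruct (Nat.eqb n 0); lra. }
  assert (P := Rpower_le_pow s n). fold M in P. rewrite Rpow_mult_distr in P.
  apply Rle_trans with (2 * (2 ^ M * ((INR n + 1) ^ 2) ^ M) * fourier_sq g n).
  { apply Rmult_le_compat_r; auto. lra. }
  assert (E2 : 2 * (2 ^ M * ((INR n + 1) ^ 2) ^ M) * fourier_sq g n
     = 2 * 2 ^ M * a n * (((INR n + 1) ^ 2) ^ (M + 1) * fourier_sq g n)).
  { rewrite pow_add, pow_1. unfold a. field. lra. }
  rewrite E2.
  apply Rle_trans with (2 * 2 ^ M * a n * (4 ^ (M + 1) * (2 * B ^ 2))).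
  { apply Rmult_le_compat_l; auto. apply Rmult_le_pos; [|apply Rlt_le, Ha].
    assert (0 < 2 ^ M) by (apply pow_lt; lra). lra. }
  unfold K. assert (0 <= 2 ^ M * a n * (4 ^ (M + 1) * B ^ 2)).
  { assert (p1 : 0 <= 2 ^ M) by (apply pow_le; lra). assert (p2 : 0 <= 4 ^ (M + 1)) by (apply pow_le; lra).
    assert (p3 := pow2_ge_0 B). specialize (Ha n). apply Rmult_le_pos; apply Rmult_le_pos; lra. }
  lra. }
assert (Sa : 0 <= Series a).
{ replace 0 with (Series (fun n => 0 * a n)). 2: { rewrite Series_scal_l; ring. }
  apply Series_le; [|apply ex_series_inv_square]. intros n. specialize (Ha n). lra. }
exists (sqrt (2 * K * (Series a + 1))). split.
{ apply sqrt_lt_R0. nra. }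
intros g B HB Hp H. specialize (T g B HB Hp H).
assert (X : ex_series (fun n => 2 * K * B ^ 2 * a n)).
{ apply (ex_series_scal (V := R_NormedModule)), ex_series_inv_square. }
split.
- apply (ex_series_le (K := R_AbsRing) (V := R_CompleteNormedModule) _ (fun n => 2 * K * B ^ 2 * a n)); auto.
  intros n. change (Rabs (Hs_term s g n) <= 2 * K * B ^ 2 * a n).
  destruct (T n). rewrite Rabs_pos_eq; auto.
- unfold Hs_norm. rewrite <- (sqrt_pow2 B) at 1 by auto. rewrite <- sqrt_mult by nra.
  apply sqrt_le_1_alt. apply Rle_trans with (Series (fun n => 2 * K * B ^ 2 * a n)).
  + apply Series_le; auto.
  + rewrite Series_scal_l. nra.
Qed.

Lemma Hs_norm_nonneg (s : R) (g : R -> R) : 0 <= Hs_norm s g.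
Proof. apply sqrt_pos. Qed.

Lemma Hs_term_nonneg (s : R) (g : R -> R) (n : nat) : 0 <= Hs_term s g n.
Proof.
unfold Hs_term. apply Rmult_le_pos; [|apply fourier_sq_nonneg].
assert (0 < Rpower (1 + INR n ^ 2) s) by apply exp_pos. destruct (Nat.eqb n 0); lra.
Qed.

Lemma Hs_finite_smooth (s : R) (g : R -> R) : smooth g -> periodic g -> Hs_finite s g.
Proof.
intros Hs Hp. destruct (Hs_norm_bounded_C s) as [C [_ H]].
destruct (smooth_bounded_C (order s) g Hs Hp) as [B [HB HC]].
apply (H g B); auto. lra.
Qed.

Lemma Hs_finite_minus (s : R) (f g : R -> R) :
  (forall x, continuous f x) -> (forall x, continuous g x) ->
  Hs_finite s f -> Hs_finite s g -> Hs_finite s (fun x => f x - g x).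
Proof.
intros Cf Cg Hf Hg.
apply (ex_series_le (K := R_AbsRing) (V := R_CompleteNormedModule) _ (fun n => 2 * Hs_term s f n + 2 * Hs_term s g n)).
- intros n. change (Rabs (Hs_term s (fun x => f x - g x) n) <= 2 * Hs_term s f n + 2 * Hs_term s g n).
  rewrite Rabs_pos_eq by apply Hs_term_nonneg.
  assert (E : fourier_sq (fun x => f x - g x) n <= 2 * fourier_sq f n + 2 * fourier_sq g n).
  { rewrite !fourier_sq_eq.
    assert (E1 : fcos (fun x => f x - g x) n = fcos f n - fcos g n).
    { unfold fcos. rewrite <- (RInt_minus (fun x => f x * cos (INR n * x)) (fun x => g x * cos (INR n * x))) by
       (apply ex_RInt_cos_mode; auto).
      apply RInt_ext. intros x _. unfold minus, plus, opp; simpl. ring. }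
    assert (E2 : fsin (fun x => f x - g x) n = fsin f n - fsin g n).
    { unfold fsin. rewrite <- (RInt_minus (fun x => f x * sin (INR n * x)) (fun x => g x * sin (INR n * x))) by
       (apply ex_RInt_sin_mode; auto).
      apply RInt_ext. intros x _. unfold minus, plus, opp; simpl. ring. }
    rewrite E1, E2. unfold Rdiv. rewrite !Rmult_minus_distr_r.
    assert (Q : forall x y, (x - y) ^ 2 <= 2 * x ^ 2 + 2 * y ^ 2) by (intros x y; assert (h := pow2_ge_0 (x + y)); nra).
    assert (q1 := Q (fcos f n * / (2 * PI)) (fcos g n * / (2 * PI))).
    assert (q2 := Q (fsin f n * / (2 * PI)) (fsin g n * / (2 * PI))). lra. }
  unfold Hs_term. set (c := (if Nat.eqb n 0 then 1 else 2) * Rpower (1 + INR n ^ 2) s).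
  assert (0 < c).
  { unfold c. assert (0 < Rpower (1 + INR n ^ 2) s) by apply exp_pos. destruct (Nat.eqb n 0); lra. }
  nra.
- apply (ex_series_plus (V := R_NormedModule) (fun n => 2 * Hs_term s f n) (fun n => 2 * Hs_term s g n));
    apply (ex_series_scal (V := R_NormedModule)); auto.
Qed.

Lemma Hs_norm_zero (s : R) : Hs_finite s (fun _ => 0) /\ Hs_norm s (fun _ => 0) = 0.
Proof.
destruct (Hs_norm_bounded_C s) as [C [_ H]]. destruct (H (fun _ => 0) 0) as [H1 H2].
- lra.
- intros x; reflexivity.
- generalize (order s). intros n.
  assert (A : forall n, bounded_C n (fun _ => 0) 0).
  { clear. induction n as [|n IH]; repeat split; auto.
    1, 3: intros; apply continuous_const.
    1, 2: intros; rewrite Rabs_R0; lra.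
    exists (fun _ => 0); split; auto. intros; apply (is_derive_const 0). }
  apply A.
- split; auto. assert (h := Hs_norm_nonneg s (fun _ => 0)). lra.
Qed.

Lemma Hs_lift_smooth (s : R) (d : Z) (g : R -> R) : lift d g -> smooth g -> Hs_lift s d g.
Proof.
intros Hl Hs. split; auto. exists (fun _ => g).
assert (E : (fun x => g x - g x) = (fun _ => 0)) by (apply functional_extensionality; intros; ring).
rewrite E. destruct (Hs_norm_zero s) as [H1 H2]. rewrite H2. split; auto. apply is_lim_seq_const.
Qed.

Lemma Hs_lift0_smooth (s : R) (g : R -> R) : periodic g -> smooth g -> Hs_lift s 0 g.
Proof.
intros Hp Hs. apply Hs_lift_smooth; auto. split; [apply smooth_continuous, Hs|].
intros x. rewrite Hp. ring.
Qed.

Lemma Hs_lift_continuous (s : R) (d : Z) (g : R -> R) : Hs_lift s d g -> forall x, continuous g x.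
Proof. intros [[H _] _]; exact H. Qed.

(** One approximant suffices: it is smooth, and its difference with [g] has finite norm by
    definition. Finiteness has to be tracked because [Hs_norm] takes the default value 0 on a
    divergent series, so that a small norm alone would say nothing. *)
Lemma Hs_lift_finite (s : R) (g : R -> R) : Hs_lift s 0 g -> Hs_finite s g.
Proof.
intros [[Hc Hp] [gk [H _]]]. destruct (H 0%nat) as [[Hc' Hp'] [Hs Hf]].
replace g with (fun x => gk 0%nat x - (gk 0%nat x - g x)).
2: { apply functional_extensionality; intros; ring. }
apply Hs_finite_minus; auto.
- intros x. apply (continuous_minus (gk 0%nat) g); auto.
- apply Hs_finite_smooth; auto. intros x. rewrite Hp'. ring.
Qed.

(** The square root of the factor of [fourier_sq g n] in the norm for [n > 0], the 2 standing for
    the modes [n] and [-n]. It enters [fsin_le_Hs_norm] and [Hs_norm_sin] alike and cancels in the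
    final estimate. *)
Definition mode_weight (s : R) (n : nat) : R := sqrt (2 * Rpower (1 + INR n ^ 2) s).

Lemma mode_weight_pos (s : R) (n : nat) : 0 < mode_weight s n.
Proof. apply sqrt_lt_R0. assert (0 < Rpower (1 + INR n ^ 2) s) by apply exp_pos. lra. Qed.

(** A single term of a series of nonnegative terms is kept, and in it only the sine part. *)
Lemma fsin_le_Hs_norm (s : R) (g : R -> R) (n : nat) :
  (0 < n)%nat -> Hs_finite s g -> mode_weight s n * Rabs (fsin g n) <= 2 * PI * Hs_norm s g.
Proof.
intros Hn Hf. assert (Hpi := PI_RGT_0).
assert (T : Hs_term s g n <= Series (Hs_term s g)).
{ assert (A : sum_n (Hs_term s g) n <= Series (Hs_term s g)).
  { apply is_lim_seq_incr_compare.
    - apply Series_correct in Hf. exact Hf.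
    - intros k. rewrite sum_Sn. unfold plus; simpl. assert (h := Hs_term_nonneg s g (S k)). lra. }
  assert (B : Hs_term s g n <= sum_n (Hs_term s g) n).
  { destruct n as [|n]; [lia|]. rewrite sum_Sn. unfold plus; simpl.
    assert (0 <= sum_n (Hs_term s g) n).
    { clear. induction n as [|n IH]; [rewrite sum_O; apply Hs_term_nonneg|].
      rewrite sum_Sn. unfold plus; simpl. assert (h := Hs_term_nonneg s g (S n)). lra. }
    lra. }
  lra. }
assert (0 < Rpower (1 + INR n ^ 2) s) by apply exp_pos.
assert (E : sqrt (2 * Rpower (1 + INR n ^ 2) s * (fsin g n / (2 * PI)) ^ 2) <= Hs_norm s g).
{ apply sqrt_le_1_alt. eapply Rle_trans; [|apply T]. unfold Hs_term.
  replace (Nat.eqb n 0) with false by (symmetry; apply Nat.eqb_neq; lia).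
  apply Rmult_le_compat_l; [lra|]. rewrite fourier_sq_eq.
  assert (h := pow2_ge_0 (fcos g n / (2 * PI))). lra. }
rewrite sqrt_mult in E; [|lra|apply pow2_ge_0].
rewrite <- (Rsqr_pow2 (fsin g n / (2 * PI))), sqrt_Rsqr_abs in E. fold (mode_weight s n) in E.
unfold Rdiv in E. rewrite Rabs_mult, Rabs_inv, (Rabs_pos_eq (2 * PI)) in E by lra.
apply Rmult_le_compat_l with (r := 2 * PI) in E; [|lra].
replace (2 * PI * (mode_weight s n * (Rabs (fsin g n) * / (2 * PI)))) with (mode_weight s n * Rabs (fsin g n)) in E by (field; lra).
exact E.
Qed.

Lemma RInt_cos_mode (k : Z) : k <> 0%Z -> RInt (fun x => cos (IZR k * x)) 0 (2 * PI) = 0.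
Proof.
intros Hk. assert (Hk' : IZR k <> 0) by (apply not_0_IZR, Hk).
rewrite (RInt_derive_continuous (fun x => sin (IZR k * x) / IZR k)).
- replace (IZR k * (2 * PI)) with (2 * PI * IZR k) by ring.
  assert (E : sin (2 * PI * IZR k) = 0).
  { apply sin_eq_0_1. exists (2 * k)%Z. rewrite mult_IZR. ring. }
  rewrite E, Rmult_0_r, sin_0. eqR; field; auto.
- intros x. auto_derive; auto. eqR; field; auto.
- intros x. apply (ex_derive_continuous (fun x => cos (IZR k * x))). auto_derive; auto.
Qed.

Lemma RInt_sin_mode (k : Z) : RInt (fun x => sin (IZR k * x)) 0 (2 * PI) = 0.
Proof.
destruct (Z.eq_dec k 0) as [->|Hk].
{ rewrite (RInt_ext _ (fun _ => 0)). { rewrite RInt_const. unfold scal; simpl; unfold mult; simpl; ring. }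
  intros x _. rewrite Rmult_0_l. apply sin_0. }
assert (Hk' : IZR k <> 0) by (apply not_0_IZR, Hk).
rewrite (RInt_derive_continuous (fun x => - cos (IZR k * x) / IZR k)).
- assert (E : cos (IZR k * (2 * PI)) = 1).
  { assert (A : forall j : nat, cos (IZR (Z.of_nat j) * (2 * PI)) = 1) by (intros j; rewrite <- INR_IZR_INZ; apply cos_mode_period).
    destruct (Z_le_gt_dec 0 k) as [h|h].
    - rewrite <- (Z2Nat.id k h). apply A.
    - rewrite <- cos_neg. replace (- (IZR k * (2 * PI))) with (IZR (- k) * (2 * PI)) by (rewrite opp_IZR; ring).
      rewrite <- (Z2Nat.id (- k)) by lia. apply A. }
  rewrite E, Rmult_0_r, cos_0. eqR; field; auto.
- intros x. auto_derive; auto. eqR; field; auto.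
- intros x. apply (ex_derive_continuous (fun x => sin (IZR k * x))). auto_derive; auto.
Qed.

Lemma ex_RInt_cos (k a b : R) : ex_RInt (fun x => cos (k * x)) a b.
Proof.
apply continuous_ex_RInt; intros x.
apply (ex_derive_continuous (fun x => cos (k * x))). auto_derive; auto.
Qed.

Lemma ex_RInt_sin (k a b : R) : ex_RInt (fun x => sin (k * x)) a b.
Proof.
apply continuous_ex_RInt; intros x.
apply (ex_derive_continuous (fun x => sin (k * x))). auto_derive; auto.
Qed.

Lemma fsin_sin (n m : nat) : (0 < n)%nat ->
  fsin (fun x => sin (INR n * x)) m = if Nat.eqb m n then PI else 0.
Proof.
intros Hn. unfold fsin.
rewrite (RInt_ext _ (fun x => / 2 * (cos (IZR (Z.of_nat n - Z.of_nat m) * x) - cos (IZR (Z.of_nat n + Z.of_nat m) * x)))).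
2: { intros x _. rewrite minus_IZR, plus_IZR, <- !INR_IZR_INZ, Rmult_minus_distr_r, Rmult_plus_distr_r, cos_minus, cos_plus.
     eqR. field. }
rewrite (RInt_scal (fun x => cos (IZR (Z.of_nat n - Z.of_nat m) * x) - cos (IZR (Z.of_nat n + Z.of_nat m) * x))).
2: { apply (ex_RInt_minus (fun x => cos (IZR (Z.of_nat n - Z.of_nat m) * x)) (fun x => cos (IZR (Z.of_nat n + Z.of_nat m) * x)));
   apply ex_RInt_cos. }
rewrite (RInt_minus (fun x => cos (IZR (Z.of_nat n - Z.of_nat m) * x)) (fun x => cos (IZR (Z.of_nat n + Z.of_nat m) * x)))
  by apply ex_RInt_cos.
rewrite (RInt_cos_mode (Z.of_nat n + Z.of_nat m)) by lia.
unfold scal, minus, plus, opp; simpl; unfold mult; simpl.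
destruct (Nat.eqb_spec m n) as [->|h].
- rewrite (RInt_ext _ (fun _ => 1)). { rewrite RInt_const. unfold scal; simpl; unfold mult; simpl. field. }
  intros x _. rewrite Z.sub_diag, Rmult_0_l. apply cos_0.
- rewrite RInt_cos_mode by lia. ring.
Qed.

Lemma fcos_sin (n m : nat) : fcos (fun x => sin (INR n * x)) m = 0.
Proof.
unfold fcos.
rewrite (RInt_ext _ (fun x => / 2 * (sin (IZR (Z.of_nat n + Z.of_nat m) * x) + sin (IZR (Z.of_nat n - Z.of_nat m) * x)))).
2: { intros x _. rewrite minus_IZR, plus_IZR, <- !INR_IZR_INZ, Rmult_minus_distr_r, Rmult_plus_distr_r, sin_minus, sin_plus.
     eqR. field. }
rewrite (RInt_scal (fun x => sin (IZR (Z.of_nat n + Z.of_nat m) * x) + sin (IZR (Z.of_nat n - Z.of_nat m) * x))).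
2: { apply (ex_RInt_plus (fun x => sin (IZR (Z.of_nat n + Z.of_nat m) * x)) (fun x => sin (IZR (Z.of_nat n - Z.of_nat m) * x)));
   apply ex_RInt_sin. }
rewrite (RInt_plus (fun x => sin (IZR (Z.of_nat n + Z.of_nat m) * x)) (fun x => sin (IZR (Z.of_nat n - Z.of_nat m) * x)))
  by apply ex_RInt_sin.
rewrite !RInt_sin_mode. unfold scal, plus; simpl; unfold mult; simpl. ring.
Qed.

Lemma Hs_norm_sin (s : R) (n : nat) : (0 < n)%nat ->
  Hs_norm s (fun x => sin (INR n * x)) = mode_weight s n / 2.
Proof.
intros Hn. assert (Hpi := PI_RGT_0). unfold Hs_norm.
set (g := fun x => sin (INR n * x)).
assert (T : forall m, Hs_term s g m = if Nat.eqb m n then 2 * Rpower (1 + INR n ^ 2) s / 4 else 0).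
{ intros m. unfold Hs_term. rewrite fourier_sq_eq. unfold g at 1 2.
  rewrite fcos_sin, fsin_sin by auto. destruct (Nat.eqb_spec m n) as [->|h].
  - replace (Nat.eqb n 0) with false by (symmetry; apply Nat.eqb_neq; lia). field. lra.
  - unfold Rdiv. rewrite Rmult_0_l. ring. }
assert (E : Series (Hs_term s g) = 2 * Rpower (1 + INR n ^ 2) s / 4).
{ apply is_series_unique.
  change (is_lim_seq (sum_n (Hs_term s g)) (2 * Rpower (1 + INR n ^ 2) s / 4)).
  apply (is_lim_seq_ext_loc (fun _ => 2 * Rpower (1 + INR n ^ 2) s / 4)); [|apply is_lim_seq_const].
  exists n. intros m Hm.
  assert (A : forall k, sum_n (Hs_term s g) k = if Nat.leb n k then 2 * Rpower (1 + INR n ^ 2) s / 4 else 0).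
  { intros k; induction k as [|k IH].
    - rewrite sum_O, T. destruct (Nat.eqb_spec 0 n); destruct (Nat.leb_spec n 0); try lia; auto.
    - rewrite sum_Sn, IH, T. unfold plus; simpl (AbelianGroup.sort _).
      destruct (Nat.eqb_spec (S k) n); destruct (Nat.leb_spec n k); destruct (Nat.leb_spec n (S k)); try lia; simpl; lra. }
  rewrite A. destruct (Nat.leb_spec n m); auto; lia. }
rewrite E. unfold mode_weight.
assert (0 < Rpower (1 + INR n ^ 2) s) by apply exp_pos.
rewrite sqrt_div by lra. f_equal. replace 4 with (2 * 2) by ring. apply sqrt_square; lra.
Qed.

(** * Curves in the Sobolev space and critical points of the energy *)

(** The remainder [g r - g t - (r - t) V t] is the integral of [V tau - V t] from [t] to [r], small
    in [C^m] and hence in the Sobolev norm. The division of [eps] by [C] absorbs the constant of the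
    comparison. *)
Lemma Hs_C1_curve (s : R) (g V : R -> R -> R) :
  (forall n, ydiff n V) -> (forall t, periodic (V t)) ->
  (forall t y, 0 <= t <= 1 -> is_derive (fun t => g t y) t (V t y)) ->
  forall t, 0 <= t <= 1 -> forall eps, 0 < eps -> exists delta, 0 < delta /\
    forall r, 0 <= r <= 1 -> Rabs (r - t) < delta ->
      Hs_norm s (fun y => g r y - g t y - (r - t) * V t y) <= eps * Rabs (r - t) /\
      Hs_norm s (fun y => V r y - V t y) <= eps.
Proof.
intros HV Hp HD t Ht eps He.
destruct (Hs_norm_bounded_C s) as [C [HC H]].
assert (He' : 0 < eps / C) by (apply Rdiv_lt_0_compat; auto).
assert (Hc := ydiff_continuous2 _ _ (HV 0%nat)).
destruct (ydiff_bounded_C_uniform (order s) V t (HV _) Hp _ He') as [d1 [Hd1 H1]].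
destruct (bounded_C_RInt_increment (order s) V t (HV _) Hp _ He') as [d2 [Hd2 H2]].
exists (Rmin d1 d2). split; [apply Rmin_pos; auto|]. intros r Hr Hrt.
assert (Hr1 := Rlt_le_trans _ _ _ Hrt (Rmin_l _ _)). assert (Hr2 := Rlt_le_trans _ _ _ Hrt (Rmin_r _ _)).
split.
- assert (E : (fun y => g r y - g t y - (r - t) * V t y) = (fun y => RInt (fun tau => V tau y - V t y) t r)).
  { apply functional_extensionality. intros y.
    rewrite (RInt_minus (fun tau => V tau y) (fun _ => V t y)).
    - assert (E : RInt (fun tau => V tau y) t r = g r y - g t y).
      { apply is_RInt_unique, (is_RInt_derive (fun t => g t y) (fun t => V t y)).
        - intros x Hx. apply HD. unfold Rmin, Rmax in Hx. destruct (Rle_dec t r); lra.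
        - intros x _. apply continuous2_slice_l, Hc. }
      rewrite E, RInt_const. reflexivity.
    - apply continuous_ex_RInt. intros x. apply continuous2_slice_l, Hc.
    - apply ex_RInt_const. }
  rewrite E. replace (eps * Rabs (r - t)) with (C * (eps / C * Rabs (r - t))) by (field; lra).
  apply H; [|intros y; apply RInt_ext; intros; rewrite !Hp; auto|apply H2; auto].
  apply Rmult_le_pos; [lra|apply Rabs_pos].
- replace eps with (C * (eps / C)) by (field; lra). apply H; [lra| |auto].
  intros y. rewrite !Hp. auto.
Qed.

Lemma smooth_of_derive (f f' : R -> R) :
  (forall x, is_derive f x (f' x)) -> smooth f' -> smooth f.
Proof.
intros HD Hs k x. destruct k as [|[|k]]; [exact I|exists (f' x); apply HD|].
apply (ex_derive_ext (Derive_n f' k)); [|apply (Hs (S k) x)].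
intros z. transitivity (Derive_n (Derive_n f 1) k z).
- apply Derive_n_ext. intros y. symmetry. apply is_derive_unique, HD.
- rewrite Derive_n_comp. f_equal. lia.
Qed.

(** * Inverses of circle diffeomorphisms and the metric in Lagrangian coordinates *)

Lemma diffeo_expanding (eta : R -> R) :
  diffeo eta -> exists m, 0 < m /\ forall a b, a <= b -> m * (b - a) <= eta b - eta a.
Proof.
intros [[Hc Hl] H]. assert (Hpi := PI_RGT_0).
destruct (continuity_ab_min (Derive eta) 0 (2 * PI)) as [M [HM _]]; [lra| |].
{ intros c _. apply continuity_pt_filterlim, H. }
(* The minimum of the derivative over one period; periodicity makes it a lower bound everywhere. *)
exists (Derive eta M). split; [apply H|]. intros a b hab.
assert (HD : forall x, is_derive eta x (Derive eta x)) by (intros; apply Derive_correct, H).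
destruct (MVT_gen eta a b (Derive eta)) as [c [_ E]].
- intros x _. apply HD.
- intros x _. apply continuity_pt_filterlim, Hc.
- rewrite E. apply Rmult_le_compat_r; [lra|].
  destruct (periodic_reduce c) as [y [Hy P]]. rewrite (P (Derive eta)).
  + apply HM, Hy.
  + apply (is_derive_periodic eta); auto. exists (2 * PI * 1). auto.
Qed.

(** The function [eta y - y] is periodic, hence bounded by some [B], so that [x] lies between
    [eta (x - B)] and [eta (x + B)]. *)
Lemma diffeo_surjective (eta : R -> R) (x : R) : diffeo eta -> exists y, eta y = x.
Proof.
intros [[Hc Hl] _].
destruct (periodic_bounded (fun y => eta y - y)) as [B [HB H]].
{ intros y. apply (continuous_minus eta (fun y => y)); auto. apply continuous_id. }
{ intros y. rewrite Hl. ring. }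
assert (h1 := H (x - B)). assert (h2 := H (x + B)). simpl in h1, h2.
apply Rabs_le_between in h1, h2.
destruct (IVT_gen eta (x - B) (x + B) x) as [y [_ Hy]].
- intros z. apply continuity_pt_filterlim, Hc.
- rewrite Rmin_left, Rmax_right by lra. lra.
- exists y; auto.
Qed.

Lemma inverse_right (eta : R -> R) (x : R) : diffeo eta -> eta (inverse eta x) = x.
Proof. intros H. apply (epsilon_spec (inhabits 0) (fun y => eta y = x)), diffeo_surjective, H. Qed.

Lemma inverse_continuous (eta : R -> R) (x : R) : diffeo eta -> continuous (inverse eta) x.
Proof.
intros H. destruct (diffeo_expanding eta H) as [m [Hm E]].
apply continuity_pt_filterlim, continuity_pt_locally. intros eps.
assert (He : 0 < m * eps) by (apply Rmult_lt_0_compat; auto; apply cond_pos).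
exists (mkposreal _ He). intros y Hy. change (Rabs (y - x) < m * eps) in Hy.
rewrite <- (inverse_right eta y H), <- (inverse_right eta x H) in Hy.
set (a := inverse eta y) in *. set (b := inverse eta x) in *.
apply Rabs_def2 in Hy. apply Rabs_def1; apply Rnot_le_lt; intros K.
- assert (h := E b a). assert (0 < eps) by apply cond_pos. nra.
- assert (h := E a b). assert (0 < eps) by apply cond_pos. nra.
Qed.

Lemma inverse_shift (eta : R -> R) (x : R) :
  diffeo eta -> inverse eta (x + 2 * PI) = inverse eta x + 2 * PI.
Proof.
intros H. rewrite <- (inverse_spec eta (inverse eta x + 2 * PI) H). f_equal.
destruct H as [[Hc Hl] H']. rewrite Hl, inverse_right by (repeat split; auto; apply H'). ring.
Qed.

(** Substitute [x = eta y]: there [rho = 1 / v] and [dx = v dy], so [lam (rho) dx = 3 v^2 dy] and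
    [rho dx = dy]. The substitution produces the interval from [eta 0] to [eta 0 + 2 PI], which
    periodicity moves back to [[0, 2 PI]]. *)
Lemma metric_lagrangian (p w : fpair) (v : R -> R) :
  diffeo (fst p) -> (forall y, is_derive (fst p) y (v y)) ->
  (forall y, continuous (fst w) y) -> (forall y, continuous (snd w) y) ->
  periodic (fst w) -> periodic (snd w) ->
  metric (fun rho => 3 / rho) p w w =
  RInt (fun y => 3 * (v y) ^ 2 * (snd w y) ^ 2 + (fst w y) ^ 2) 0 (2 * PI).
Proof.
intros Hp Hv C1 C2 P1 P2. unfold metric. cbv zeta.
set (eta := fst p) in *.
assert (Dv : forall y, Derive eta y = v y) by (intros; apply is_derive_unique, Hv).
assert (Hv0 : forall y, 0 < v y) by (intros y; rewrite <- Dv; apply Hp).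
assert (Cv : forall y, continuous v y).
{ intros y. apply (continuous_ext (Derive eta)); auto. apply Hp. }
set (G0 := fun y => 3 * v y * snd w y ^ 2 + / v y * fst w y ^ 2).
assert (CG0 : forall y, continuous G0 y).
{ intros y. assert (sq : forall f : R -> R, continuous f y -> continuous (fun y => f y ^ 2) y).
  { intros f Hf. apply (continuous_comp f (fun z => z ^ 2)); auto.
    apply (ex_derive_continuous (fun z : R => z ^ 2)). auto_derive; auto. }
  apply (continuous_plus (fun y => 3 * v y * snd w y ^ 2) (fun y => / v y * fst w y ^ 2)).
  - apply (continuous_mult (fun y => 3 * v y) (fun y => snd w y ^ 2)); auto.
    apply (continuous_mult (fun _ => 3) v); auto. apply continuous_const.
  - apply (continuous_mult (fun y => / v y) (fun y => fst w y ^ 2)); auto.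
    apply (continuous_comp v Rinv); auto. apply (ex_derive_continuous Rinv).
    apply (ex_derive_inv (fun z => z)). apply ex_derive_id. apply Rgt_not_eq, Hv0. }
set (G := fun x => G0 (inverse eta x)).
assert (CG : forall x, continuous G x).
{ intros x. apply (continuous_comp (inverse eta) G0); auto. apply inverse_continuous, Hp. }
assert (Pv : periodic v).
{ apply (is_derive_periodic eta); auto. exists (2 * PI * 1). destruct Hp as [[_ Hl] _]; auto. }
assert (PG : periodic G).
{ intros x. unfold G, G0. rewrite inverse_shift by auto. rewrite Pv, P1, P2. reflexivity. }
rewrite (RInt_ext _ G).
2: { intros x _. unfold G, G0, density. rewrite Dv. eqR. assert (h := Hv0 (inverse eta x)). field. lra. }
assert (E : eta (2 * PI) = eta 0 + 2 * PI).
{ destruct Hp as [[_ Hl] _]. specialize (Hl 0). rewrite Rplus_0_l in Hl. rewrite Hl. ring. }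
rewrite <- (RInt_periodic_shift G (eta 0) CG PG), <- E.
rewrite <- (RInt_comp G eta v 0 (2 * PI)).
- apply RInt_ext. intros y _. unfold G, G0. rewrite inverse_spec by auto.
  change (v y * (3 * v y * snd w y ^ 2 + / v y * fst w y ^ 2) = 3 * v y ^ 2 * snd w y ^ 2 + fst w y ^ 2).
  assert (h := Hv0 y). field. lra.
- intros; apply CG.
- intros; split; auto.
Qed.

(** * The first variation of the energy *)

Definition dint (f : R -> R -> R) : R := RInt (fun t => RInt (f t) 0 (2 * PI)) 0 1.

Lemma dint_linear (f g : R -> R -> R) (a : R) :
  continuous2 f -> continuous2 g ->
  dint (fun t x => f t x + a * g t x) = dint f + a * dint g.
Proof.
intros Hf Hg. unfold dint.
rewrite (RInt_ext _ (fun t => RInt (f t) 0 (2 * PI) + a * RInt (g t) 0 (2 * PI))).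
- rewrite (RInt_plus (fun t => RInt (f t) 0 (2 * PI)) (fun t => a * RInt (g t) 0 (2 * PI))).
  + unfold plus; simpl. f_equal. apply (RInt_scal (fun t => RInt (g t) 0 (2 * PI))).
    apply continuous_ex_RInt, continuous_RInt_param, Hg.
  + apply continuous_ex_RInt, continuous_RInt_param, Hf.
  + apply (ex_RInt_scal (fun t => RInt (g t) 0 (2 * PI))), continuous_ex_RInt, continuous_RInt_param, Hg.
- intros t _. rewrite (RInt_plus (f t) (fun x => a * g t x)).
  + unfold plus; simpl. f_equal. apply (RInt_scal (g t)).
    apply continuous_ex_RInt. intros; apply continuous2_slice, Hg.
  + apply continuous_ex_RInt. intros; apply continuous2_slice, Hf.
  + apply (ex_RInt_scal (g t)), continuous_ex_RInt. intros; apply continuous2_slice, Hg.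
Qed.

(** Uniform continuity on [[0, 1] x [0, 2 PI]] provides a time step [d / 2] over which [f] changes
    by less than 1; the bound at [t = 0] is propagated through finitely many such steps. *)
Lemma periodic_bounded_strip (f : R -> R -> R) :
  continuous2 f -> (forall t, periodic (f t)) ->
  exists B, 0 < B /\ forall t x, 0 <= t <= 1 -> Rabs (f t x) <= B.
Proof.
intros Hc Hp. assert (Hpi := PI_RGT_0).
destruct (uniform_continuity_2d f 0 1 0 (2 * PI) (fun x y _ _ => Hc x y) (mkposreal _ Rlt_0_1)) as [d Hd].
assert (h := cond_pos d). simpl in Hd.
destruct (periodic_bounded (f 0)) as [B [HB H0]]; auto. { intros; apply continuous2_slice, Hc. }
assert (A : forall n : nat, forall t x, 0 <= t <= 1 -> 0 <= x <= 2 * PI -> t <= INR n * (d / 2) ->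
   Rabs (f t x) <= B + INR n).
{ induction n as [|n IH]; intros t x Ht Hx Htn.
  - simpl in Htn. replace t with 0 by lra. simpl. rewrite Rplus_0_r. auto.
  - rewrite S_INR in *. set (t' := Rmax 0 (t - d / 2)).
    assert (Ht' : 0 <= t' <= t /\ t - d / 2 <= t' /\ t' <= INR n * (d / 2)).
    { assert (h' := pos_INR n). unfold t', Rmax. destruct (Rle_dec 0 (t - d / 2)); repeat split; try lra.
      apply Rmult_le_pos; lra. }
    assert (I1 : Rabs (f t' x) <= B + INR n) by (apply IH; lra).
    assert (I2 : Rabs (f t x - f t' x) < 1).
    { apply Hd; try lra. rewrite Rabs_pos_eq; lra. rewrite Rminus_diag, Rabs_R0; auto. }
    replace (f t x) with (f t' x + (f t x - f t' x)) by ring.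
    eapply Rle_trans; [apply Rabs_triang|]. lra. }
destruct (INR_unbounded (1 / (d / 2))) as [n Hn].
exists (B + INR n). split. { assert (h' := pos_INR n). lra. }
intros t x Ht. destruct (periodic_reduce x) as [y [Hy P]]. rewrite (P _ (Hp t)). apply A; auto.
apply Rle_trans with 1; [lra|]. apply Rmult_lt_compat_r with (r := d / 2) in Hn; [|lra].
replace (1 / (d / 2) * (d / 2)) with 1 in Hn by (field; lra). lra.
Qed.

Definition dspace (h : R -> R -> R) (t x : R) : R := Derive (h t) x.

Lemma variation_regular (h : R -> R -> R) : variation h ->
  continuous2 h /\ continuous2 (dspace h) /\ continuous2 (dtime h) /\
  (forall t x, is_derive (h t) x (dspace h t x)) /\
  (forall t x, is_derive (fun r => h r x) t (dtime h t x)) /\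
  (forall t, periodic (h t)) /\ (forall t, periodic (dspace h t)) /\ (forall t, periodic (dtime h t)).
Proof.
intros [[D [D0 HD]] [Hp _]].
assert (E0 : forall t x, h t x = D 0%nat 0%nat t x) by (intros; symmetry; auto).
assert (Ds : forall t x, is_derive (h t) x (D 0%nat 1%nat t x)).
{ intros t x. apply (is_derive_ext (D 0%nat 0%nat t)); auto. apply HD. }
assert (Dt : forall t x, is_derive (fun r => h r x) t (D 1%nat 0%nat t x)).
{ intros t x. apply (is_derive_ext (fun r => D 0%nat 0%nat r x)); auto. apply HD. }
assert (E1 : forall t x, dspace h t x = D 0%nat 1%nat t x) by (intros; apply is_derive_unique, Ds).
assert (E2 : forall t x, dtime h t x = D 1%nat 0%nat t x) by (intros; apply is_derive_unique, Dt).
refine (conj _ (conj _ (conj _ (conj _ (conj _ (conj _ (conj _ _))))))).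
- intros t x. apply (continuity_2d_pt_ext (D 0%nat 0%nat)); auto. apply HD.
- intros t x. apply (continuity_2d_pt_ext (D 0%nat 1%nat)); auto. apply HD.
- intros t x. apply (continuity_2d_pt_ext (D 1%nat 0%nat)); auto. apply HD.
- intros t x. rewrite E1. auto.
- intros t x. rewrite E2. auto.
- intros t x. apply Hp.
- intros t. apply (is_derive_periodic (h t)).
  + intros x. rewrite E1. auto.
  + exists 0. intros x. rewrite Hp. ring.
- intros t x. apply Derive_ext. intros r. apply Hp.
Qed.

Lemma fsub_eq (f g : R -> R) : (fun x => f x + -1 * g x) = (fun x => f x - g x).
Proof. apply functional_extensionality. intros x. ring. Qed.

(* In Lagrangian coordinates the energy is 1/2 int int (3 eta_x^2 F_t^2 + eta_t^2), a quartic polynomial in the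
   variation parameter; [Hcrit] is the vanishing of its linear coefficient. *)
Lemma geodesic_criterion (s : R) (eta F U V v : R -> R -> R) (m : R) :
  (forall n, ydiff n v) -> (forall n, ydiff n U) -> (forall n, ydiff n V) ->
  (forall t, periodic (U t)) -> (forall t, periodic (V t)) ->
  0 < m -> (forall t y, m <= v t y) ->
  (forall t y, eta t (y + 2 * PI) = eta t y + 2 * PI) ->
  (forall t y, is_derive (eta t) y (v t y)) ->
  (forall t, periodic (F t)) -> (forall t, smooth (F t)) ->
  (forall t y, 0 <= t <= 1 -> is_derive (fun t => eta t y) t (U t y)) ->
  (forall t y, 0 <= t <= 1 -> is_derive (fun t => F t y) t (V t y)) ->
  (forall h k, variation h -> variation k ->
     dint (fun t x => 3 * v t x * V t x ^ 2 * dspace h t x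
                      + 3 * v t x ^ 2 * V t x * dtime k t x + U t x * dtime h t x) = 0) ->
  geodesic (fun rho => 3 / rho) s (fun t => (eta t, F t)) (fun t => (U t, V t)).
Proof.
intros Rv RU RV PU PV Hm Hv Heta Dv PF SF DU DV Hcrit.
assert (Cv := ydiff_continuous2 _ _ (Rv 0%nat)).
assert (CU := ydiff_continuous2 _ _ (RU 0%nat)).
assert (CV := ydiff_continuous2 _ _ (RV 0%nat)).
assert (Seta : forall t, smooth (eta t)).
{ intros t. apply (smooth_of_derive (eta t) (v t)); auto. apply ydiff_smooth, Rv. }
assert (Leta : forall t, lift 1 (eta t)).
{ intros t. split; [apply smooth_continuous, Seta|]. intros x. rewrite Heta. ring. }
assert (Pv : forall t, periodic (v t)).
{ intros t. apply (is_derive_periodic (eta t)); auto. exists (2 * PI). auto. }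
split; [split|].
- intros t _. refine (conj (conj _ (conj (conj _ _) _)) (conj _ _)); simpl; auto.
  + apply Hs_lift_smooth; auto.
  + intros x. refine (conj _ (conj _ _)).
    * exists (v t x). apply Dv.
    * apply (continuous_ext (v t)); [intros; symmetry; apply is_derive_unique, Dv|].
      apply continuous2_slice, Cv.
    * rewrite (is_derive_unique _ _ _ (Dv t x)). eapply Rlt_le_trans; [apply Hm|apply Hv].
  + apply Hs_lift0_smooth; auto.
  + apply Hs_lift0_smooth; auto. apply ydiff_smooth, RU.
  + apply Hs_lift0_smooth; auto. apply ydiff_smooth, RV.
- intros t Ht eps He.
  destruct (Hs_C1_curve s eta U RU PU DU t Ht (eps / 2)) as [d1 [Hd1 H1]]; [lra|].
  destruct (Hs_C1_curve s F V RV PV DV t Ht (eps / 2)) as [d2 [Hd2 H2]]; [lra|].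
  exists (Rmin d1 d2). split; [apply Rmin_pos; auto|]. intros r Hr Hrt.
  destruct (H1 r Hr (Rlt_le_trans _ _ _ Hrt (Rmin_l _ _))) as [A1 A2].
  destruct (H2 r Hr (Rlt_le_trans _ _ _ Hrt (Rmin_r _ _))) as [B1 B2].
  unfold fnorm, fsub, fadd, fscal; simpl. rewrite !fsub_eq. split; [|lra].
  replace (fun x => eta r x + -1 * eta t x - (r - t) * U t x) with (fun x => eta r x - eta t x - (r - t) * U t x)
    by (apply functional_extensionality; intros; ring).
  replace (fun x => F r x + -1 * F t x - (r - t) * V t x) with (fun x => F r x - F t x - (r - t) * V t x)
    by (apply functional_extensionality; intros; ring).
  lra.
- intros h k Hh Hk. assert (W := Hcrit h k Hh Hk).
  destruct (variation_regular h Hh) as [Ch [Chx [Cht [Dhx [Dht [Ph [Phx Pht]]]]]]].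
  destruct (variation_regular k Hk) as [Ck [Ckx [Ckt [Dkx [Dkt [Pk [Pkx Pkt]]]]]]].
  set (hx := dspace h) in *. set (ht := dtime h) in *. set (kt := dtime k) in *.
  destruct (periodic_bounded_strip hx Chx Phx) as [B [HB HhB]].
  (* Coefficients of the powers of [e] in [3 (v + e hx)^2 (V + e kt)^2 + (U + e ht)^2]; [c1] is half
     the linear one, to match the form of [Hcrit]. *)
  set (c0 := fun t x => 3 * v t x ^ 2 * V t x ^ 2 + U t x ^ 2).
  set (c1 := fun t x => 3 * v t x * V t x ^ 2 * hx t x + 3 * v t x ^ 2 * V t x * kt t x + U t x * ht t x) in *.
  set (c2 := fun t x => 3 * (v t x ^ 2 * kt t x ^ 2 + 4 * v t x * hx t x * V t x * kt t x + hx t x ^ 2 * V t x ^ 2) + ht t x ^ 2).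
  set (c3 := fun t x => 6 * (v t x * hx t x * kt t x ^ 2 + hx t x ^ 2 * V t x * kt t x)).
  set (c4 := fun t x => 3 * (hx t x ^ 2 * kt t x ^ 2)).
  assert (Kc : forall c, continuous2 (fun _ _ => c)) by (intros c t x; apply continuity_2d_pt_const).
  assert (Km : forall f g, continuous2 f -> continuous2 g -> continuous2 (fun t x => f t x * g t x)).
  { intros f g Hf Hg t x. apply continuity_2d_pt_mult; auto. }
  assert (Kp : forall f g, continuous2 f -> continuous2 g -> continuous2 (fun t x => f t x + g t x)).
  { intros f g Hf Hg t x. apply continuity_2d_pt_plus; auto. }
  assert (Ks : forall f, continuous2 f -> continuous2 (fun t x => f t x ^ 2)).
  { intros f Hf. apply (Km f (fun t x => f t x * 1)); auto. }
  assert (K0 : continuous2 c0) by (unfold c0; auto 10).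
  assert (K1 : continuous2 c1) by (unfold c1; auto 10).
  assert (K2 : continuous2 c2) by (unfold c2; auto 14).
  assert (K3 : continuous2 c3) by (unfold c3; auto 14).
  assert (K4 : continuous2 c4) by (unfold c4; auto 10).
  (* For [e] below this radius [|e hx| <= m / 2], so [eta + e h] is still a diffeomorphism and the
     Lagrangian formula holds. Hence the comparison with the polynomial is only local in [e]. *)
  assert (He0 : 0 < m / (2 * B)) by (apply Rdiv_lt_0_compat; lra).
  apply (is_derive_ext_loc (fun e => / 2 * (dint c0 + e * (2 * dint c1 + e * (dint c2 + e * (dint c3 + e * dint c4)))))).
  + exists (mkposreal _ He0). intros e He. change (Rabs (e - 0) < m / (2 * B)) in He. rewrite Rminus_0_r in He.
    unfold energy. eqR. f_equal.
    assert (Q : dint (fun t x => c0 t x + e * (2 * c1 t x + e * (c2 t x + e * (c3 t x + e * c4 t x))))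
      = dint c0 + e * (2 * dint c1 + e * (dint c2 + e * (dint c3 + e * dint c4)))).
    { rewrite (dint_linear c0 (fun t x => 2 * c1 t x + e * (c2 t x + e * (c3 t x + e * c4 t x))) e); auto 14.
      f_equal. f_equal.
      rewrite (dint_linear (fun t x => 2 * c1 t x) (fun t x => c2 t x + e * (c3 t x + e * c4 t x)) e); auto 14.
      f_equal.
      { replace (fun t x => 2 * c1 t x) with (fun t x => c1 t x + 1 * c1 t x).
        - rewrite dint_linear; auto. ring.
        - apply functional_extensionality; intros t; apply functional_extensionality; intros x. ring. }
      f_equal. rewrite (dint_linear c2 (fun t x => c3 t x + e * c4 t x) e); auto 14.
      f_equal. f_equal. apply dint_linear; auto. }
    rewrite <- Q. unfold dint. apply RInt_ext. intros t Ht. rewrite Rmin_left, Rmax_right in Ht by lra.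
    set (v' := fun x => v t x + e * hx t x).
    assert (Hd : forall x, is_derive (fun x => eta t x + e * h t x) x (v' x)).
    { intros x. apply (is_derive_plus (eta t) (fun x => e * h t x)); auto.
      apply (is_derive_scal (h t) x e (hx t x)); auto. }
    assert (Hd' : forall x, Derive (fun x => eta t x + e * h t x) x = v' x) by (intros; apply is_derive_unique, Hd).
    rewrite (metric_lagrangian _ _ v').
    * apply RInt_ext. intros x _. unfold fadd, fscal, v', c0, c1, c2, c3, c4; simpl.
      fold ht kt. eqR. ring.
    * refine (conj (conj _ _) _).
      { simpl. intros x. apply (ex_derive_continuous (fun x => eta t x + e * h t x)). exists (v' x); auto. }
      { simpl. intros x. rewrite Heta, Ph. ring. }
      simpl. intros x. split; [exists (v' x); auto|]. split.
      { apply (continuous_ext v'); [intros; symmetry; auto|].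
        apply (continuous2_slice (fun t x => v t x + e * hx t x)). apply Kp; auto. }
      rewrite Hd'. unfold v'. assert (b := HhB t x). assert (hv := Hv t x).
      assert (Rabs (e * hx t x) <= m / 2).
      { rewrite Rabs_mult. replace (m / 2) with (m / (2 * B) * B) by (field; lra).
        apply Rmult_le_compat; try apply Rabs_pos; lra. }
      apply Rabs_le_between in H. lra.
    * exact Hd.
    * intros x. apply (continuous2_slice (fun t x => U t x + e * ht t x)). apply Kp; auto.
    * intros x. apply (continuous2_slice (fun t x => V t x + e * kt t x)). apply Kp; auto.
    * intros x. simpl. fold ht. rewrite PU, Pht. auto.
    * intros x. simpl. fold kt. rewrite PV, Pkt. auto.
  + rewrite W. auto_derive; auto. ring.
Qed.

(** * Simple waves *)

(** The difference quotient of the inverse is [/ S], where [S = h / k] is a difference quotient of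
    [eta], and the expansion bound keeps [S >= m]. *)
Lemma inverse_derive (eta : R -> R) (y : R) :
  diffeo eta -> is_derive (inverse eta) y (/ Derive eta (inverse eta y)).
Proof.
intros H. destruct (diffeo_expanding eta H) as [m [Hm E]].
set (z := inverse eta y). set (l := Derive eta z).
assert (Hl : 0 < l) by apply H.
assert (HD : derivable_pt_lim eta z l) by (apply is_derive_Reals, Derive_correct, H).
apply is_derive_Reals. intros eps He.
(* The error is [|S - l| / (S l)]; as [S >= m], closeness [eps m l] of [S] to [l] makes it less than
   [eps]. *)
assert (He' : 0 < eps * (m * l)) by (apply Rmult_lt_0_compat; auto; apply Rmult_lt_0_compat; auto).
destruct (HD _ He') as [d Hd].
assert (Hc := inverse_continuous eta y H). apply continuity_pt_filterlim, continuity_pt_locally with (eps := d) in Hc.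
destruct Hc as [d' Hd']. exists d'. intros h Hh0 Hh.
assert (Hk : Rabs (inverse eta (y + h) - z) < d).
{ apply Hd'. change (Rabs (y + h - y) < d'). replace (y + h - y) with h by ring. auto. }
set (k := inverse eta (y + h) - z) in *.
assert (Eh : eta (z + k) - eta z = h).
{ unfold k. replace (z + (inverse eta (y + h) - z)) with (inverse eta (y + h)) by ring.
  unfold z. rewrite !inverse_right by auto. ring. }
assert (Hk0 : k <> 0). { intros K. rewrite K, Rplus_0_r in Eh. lra. }
specialize (Hd k Hk0 Hk). rewrite Eh in Hd.
set (S := h / k) in *.
assert (HS : m <= S).
{ unfold S. destruct (Rlt_dec 0 k) as [p|p].
  - apply Rmult_le_reg_r with k; auto. unfold Rdiv. rewrite Rmult_assoc, Rinv_l by auto.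
    assert (e := E z (z + k)). lra.
  - apply Rmult_le_reg_r with (- k); [lra|]. replace (h / k * - k) with (- h) by (field; auto).
    assert (e := E (z + k) z). lra. }
replace ((inverse eta (y + h) - inverse eta y) / h) with (/ S).
2: { unfold S. fold z. fold k. field. auto. }
replace (/ S - / l) with (- (S - l) * / (S * l)) by (field; lra).
rewrite Rabs_mult, Rabs_Ropp, Rabs_inv, (Rabs_pos_eq (S * l)).
2: { apply Rmult_le_pos; lra. }
apply Rmult_lt_reg_r with (S * l). { apply Rmult_lt_0_compat; lra. }
rewrite Rmult_assoc, Rinv_l, Rmult_1_r. 2: { apply Rmult_integral_contrapositive; split; lra. }
eapply Rlt_le_trans; [apply Hd|]. apply Rmult_le_compat_l; [lra|]. apply Rmult_le_compat_r; lra.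
Qed.

(** Continuity of [g] is enough because the other factor vanishes at [t0]. This allows
    [foot_derive_t] to differentiate an expression that contains the still undifferentiated foot. *)
Lemma is_derive_mult_vanishing (g : R -> R) (t0 : R) :
  continuous g t0 -> is_derive (fun t => (t - t0) * g t) t0 (g t0).
Proof.
intros Hg. apply is_derive_Reals. intros eps He.
apply continuity_pt_filterlim, continuity_pt_locally with (eps := mkposreal _ He) in Hg.
destruct Hg as [d Hd]. exists d. intros h Hh0 Hh.
replace (((t0 + h - t0) * g (t0 + h) - (t0 - t0) * g t0) / h - g t0) with (g (t0 + h) - g t0) by (field; auto).
apply Hd. change (Rabs (t0 + h - t0) < d). replace (t0 + h - t0) with h by ring. auto.
Qed.

(** The identity on a neighbourhood of [[0, 1]], so that two-sided time derivatives at the endpoints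
    are not affected; bounded by 2, so that one smallness condition on the profile works for all
    times. *)
Definition clamp (t : R) : R := Rmax (-1) (Rmin 2 t).

Lemma clamp_id (t : R) : -1 <= t <= 2 -> clamp t = t.
Proof. intros H. unfold clamp. rewrite Rmin_right, Rmax_right; lra. Qed.

Lemma clamp_bound (t : R) : Rabs (clamp t) <= 2.
Proof. unfold clamp, Rmax, Rmin. apply Rabs_le. destruct (Rle_dec 2 t); destruct (Rle_dec _ _); lra. Qed.

Lemma clamp_lipschitz (t u : R) : Rabs (clamp t - clamp u) <= Rabs (t - u).
Proof.
unfold clamp, Rmax, Rmin.
destruct (Rle_dec 2 t); destruct (Rle_dec 2 u); repeat destruct (Rle_dec _ _);
unfold Rabs; repeat destruct (Rcase_abs _); lra.
Qed.

Lemma clamp_continuous (t : R) : continuous clamp t.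
Proof.
apply continuity_pt_filterlim, continuity_pt_locally. intros eps. exists eps. intros u Hu.
eapply Rle_lt_trans; [apply clamp_lipschitz|apply Hu].
Qed.

(** Differentiation under the inner integral, then the fundamental theorem in [t]; no exchange of
    integrals is involved. The derivative is requested on the open interval where the clamp is the
    identity. *)
Lemma dint_time_derivative (Q Qt : R -> R -> R) :
  continuous2 Q -> continuous2 Qt ->
  (forall t x, -1 < t < 2 -> is_derive (fun t => Q t x) t (Qt t x)) ->
  dint Qt = RInt (Q 1) 0 (2 * PI) - RInt (Q 0) 0 (2 * PI).
Proof.
intros HQ HQt HD.
assert (N : forall t, 0 <= t <= 1 -> locally t (fun u => -1 < u < 2)).
{ intros t Ht. exists (mkposreal _ Rlt_0_1). intros u Hu. change (Rabs (u - t) < 1) in Hu. apply Rabs_def2 in Hu. lra. }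
apply is_RInt_unique, (is_RInt_derive (fun t => RInt (Q t) 0 (2 * PI)) (fun t => RInt (Qt t) 0 (2 * PI))).
- intros t Ht. rewrite Rmin_left, Rmax_right in Ht by lra.
  assert (E : RInt (fun x => Derive (fun u => Q u x) t) 0 (2 * PI) = RInt (Qt t) 0 (2 * PI)).
  { apply RInt_ext. intros x _. apply is_derive_unique, HD. lra. }
  rewrite <- E. apply (is_derive_RInt_param Q).
  + generalize (N t Ht). apply filter_imp. intros u Hu x _. exists (Qt u x). apply HD, Hu.
  + intros x _. apply (continuity_2d_pt_ext_loc Qt); [|apply HQt].
    destruct (N t Ht) as [d Hd]. exists d. intros u w Hu _. symmetry. apply is_derive_unique, HD, Hd, Hu.
  + generalize (N t Ht). apply filter_imp. intros u _. apply continuous_ex_RInt. intros; apply continuous2_slice, HQ.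
- intros t _. apply continuous_RInt_param, HQt.
Qed.

Lemma dint_space_derivative (Q Qx : R -> R -> R) :
  continuous2 Qx -> (forall t, periodic (Q t)) ->
  (forall t x, is_derive (Q t) x (Qx t x)) -> dint Qx = 0.
Proof.
intros HQx Hp HD. unfold dint. rewrite (RInt_ext _ (fun _ => 0)).
- rewrite RInt_const. unfold scal; simpl; unfold mult; simpl. ring.
- intros t _. rewrite (RInt_derive_continuous (Q t)); auto.
  + assert (h := Hp t 0). rewrite Rplus_0_l in h. rewrite h. eqR; ring.
  + intros; apply continuous2_slice, HQx.
Qed.

Lemma ydiff_RInt (n : nat) (V : R -> R -> R) (a b : R) :
  ydiff n V -> ydiff n (fun _ y => RInt (fun t => V t y) a b).
Proof.
revert V; induction n as [|n IH]; intros V HV; assert (Hc := ydiff_continuous2 _ _ HV); split.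
1, 3: apply (continuous2_of_r (fun y => RInt (fun t => V t y) a b));
  apply (continuous_RInt_param (fun y t => V t y)); intros t y; apply continuous2_swap, Hc.
- exact I.
- destruct HV as [_ [V' [HD HV]]]. exists (fun _ y => RInt (fun t => V' t y) a b). split; auto.
  intros _ y. apply is_derive_RInt_continuous2; auto. eapply ydiff_continuous2; eauto.
Qed.

(** Here [r0 = 1 / eta0'] is the initial density read at the Lagrangian label. The bound [/ 24] is
    chosen so that [|6 beta t r0 dr0| <= 6 * 2 / 24 = 1 / 2] for clamped times: no shock forms and
    the Jacobian of the characteristics stays at least [1 / 2]. *)
Record wave_profile (beta : R) (eta0 r0 dr0 : R -> R) : Prop := {
  wp_smooth : forall n, ydiff n (fun _ => r0);
  wp_dsmooth : forall n, ydiff n (fun _ => dr0);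
  wp_derive : forall y, is_derive r0 y (dr0 y);
  wp_periodic : periodic r0;
  wp_range : forall y, 0 < r0 y <= 2;
  wp_small : forall y, Rabs (beta * (r0 y * dr0 y)) <= / 24;
  wp_eta : forall y, is_derive eta0 y (/ r0 y);
  wp_shift : forall y, eta0 (y + 2 * PI) = eta0 y + 2 * PI }.

(* [r = 1 / eta_x] is constant along the characteristics [y = z + 3 beta t r0(z)^2]; time is clamped so that
   these remain diffeomorphisms for all [t]. *)
Definition characteristic (beta : R) (r0 : R -> R) (t z : R) : R := z + 3 * beta * clamp t * r0 z ^ 2.

Definition foot (beta : R) (r0 : R -> R) (t : R) : R -> R := inverse (characteristic beta r0 t).

Definition jacobian (beta : R) (r0 dr0 : R -> R) (t z : R) : R := 1 + 6 * beta * clamp t * (r0 z * dr0 z).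

Lemma jacobian_ge (beta : R) (eta0 r0 dr0 : R -> R) (t z : R) :
  wave_profile beta eta0 r0 dr0 -> / 2 <= jacobian beta r0 dr0 t z.
Proof.
intros H. assert (h1 := wp_small _ _ _ _ H z). assert (h2 := clamp_bound t). unfold jacobian.
assert (Rabs (6 * beta * clamp t * (r0 z * dr0 z)) <= / 2).
{ replace (6 * beta * clamp t * (r0 z * dr0 z)) with (6 * (clamp t * (beta * (r0 z * dr0 z)))) by ring.
  rewrite !(Rabs_mult 6), (Rabs_mult (clamp t)), (Rabs_pos_eq 6) by lra.
  assert (Rabs (clamp t) * Rabs (beta * (r0 z * dr0 z)) <= 2 * / 24) by (apply Rmult_le_compat; auto using Rabs_pos).
  lra. }
apply Rabs_le_between in H0. lra.
Qed.

Lemma jacobian_ydiff (beta : R) (eta0 r0 dr0 : R -> R) (n : nat) :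
  wave_profile beta eta0 r0 dr0 -> ydiff n (jacobian beta r0 dr0).
Proof.
intros H. apply ydiff_plus; [apply ydiff_const|]. apply ydiff_mult.
- apply (ydiff_of_l n (fun t => 6 * beta * clamp t)). intros t.
  apply (continuous_mult (fun _ => 6 * beta) clamp); [apply continuous_const|apply clamp_continuous].
- apply ydiff_mult; [apply (wp_smooth _ _ _ _ H)|apply (wp_dsmooth _ _ _ _ H)].
Qed.

Lemma characteristic_derive (beta : R) (eta0 r0 dr0 : R -> R) (t z : R) :
  wave_profile beta eta0 r0 dr0 ->
  is_derive (characteristic beta r0 t) z (jacobian beta r0 dr0 t z).
Proof.
intros H. unfold characteristic, jacobian. assert (D := wp_derive _ _ _ _ H z). auto_derive.
- exists (dr0 z). exact D.
- assert (E : Derive (fun x : R => r0 x) z = dr0 z) by apply is_derive_unique, D.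
  rewrite E. ring.
Qed.

Lemma characteristic_diffeo (beta : R) (eta0 r0 dr0 : R -> R) (t : R) :
  wave_profile beta eta0 r0 dr0 -> diffeo (characteristic beta r0 t).
Proof.
intros H. assert (D := fun z => characteristic_derive beta eta0 r0 dr0 t z H).
refine (conj (conj _ _) _).
- intros z. apply (ex_derive_continuous (characteristic beta r0 t)). eexists; apply D.
- intros z. unfold characteristic. rewrite (wp_periodic _ _ _ _ H). ring.
- intros z. refine (conj _ (conj _ _)).
  + eexists; apply D.
  + apply (continuous_ext (jacobian beta r0 dr0 t)); [intros; symmetry; apply is_derive_unique, D|].
    apply continuous2_slice. apply (ydiff_continuous2 0). eapply jacobian_ydiff; eauto.
  + rewrite (is_derive_unique _ _ _ (D z)). assert (h := jacobian_ge _ _ _ _ t z H). lra.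
Qed.

Lemma foot_spec (beta : R) (eta0 r0 dr0 : R -> R) (t y : R) :
  wave_profile beta eta0 r0 dr0 ->
  foot beta r0 t y + 3 * beta * clamp t * r0 (foot beta r0 t y) ^ 2 = y.
Proof. intros H. apply (inverse_right (characteristic beta r0 t)). eapply characteristic_diffeo, H. Qed.

Lemma foot_shift (beta : R) (eta0 r0 dr0 : R -> R) (t y : R) :
  wave_profile beta eta0 r0 dr0 -> foot beta r0 t (y + 2 * PI) = foot beta r0 t y + 2 * PI.
Proof. intros H. apply inverse_shift. eapply characteristic_diffeo, H. Qed.

Lemma characteristic_expanding (beta : R) (eta0 r0 dr0 : R -> R) (t a b : R) :
  wave_profile beta eta0 r0 dr0 ->
  Rabs (a - b) <= 2 * Rabs (characteristic beta r0 t a - characteristic beta r0 t b).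
Proof.
intros H. assert (D := fun z => characteristic_derive beta eta0 r0 dr0 t z H).
destruct (MVT_gen (characteristic beta r0 t) b a (jacobian beta r0 dr0 t)) as [c [_ E]].
- intros; apply D.
- intros. apply continuity_pt_filterlim, (ex_derive_continuous (characteristic beta r0 t)). eexists; apply D.
- rewrite E, Rabs_mult. assert (h := jacobian_ge _ _ _ _ t c H).
  rewrite (Rabs_pos_eq (jacobian _ _ _ _ _)) by lra. assert (p := Rabs_pos (a - b)). nra.
Qed.

(** The foot is Lipschitz: the foot of [(t', y')], carried along its characteristic to time [t],
    lands within [12 |beta| |t - t'|] of [y'], with [12 = 3 * 2^2] from [r0 <= 2], and the time-[t]
    characteristic map contracts distances by at most a factor 2. *)
Lemma foot_continuous2 (beta : R) (eta0 r0 dr0 : R -> R) :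
  wave_profile beta eta0 r0 dr0 -> continuous2 (foot beta r0).
Proof.
intros H.
assert (L : forall t y t' y', Rabs (foot beta r0 t y - foot beta r0 t' y')
   <= 2 * (Rabs (y - y') + 12 * Rabs beta * Rabs (t - t'))).
{ intros t y t' y'. eapply Rle_trans; [apply (characteristic_expanding _ _ _ _ t _ _ H)|].
  apply Rmult_le_compat_l; [lra|].
  assert (S := foot_spec beta eta0 r0 dr0 t y H). fold (characteristic beta r0 t (foot beta r0 t y)) in S. rewrite S.
  assert (S' := foot_spec beta eta0 r0 dr0 t' y' H).
  replace (y - characteristic beta r0 t (foot beta r0 t' y')) with
    ((y - y') - 3 * beta * r0 (foot beta r0 t' y') ^ 2 * (clamp t - clamp t')).
  2: { unfold characteristic. rewrite <- S' at 1. ring. }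
  eapply Rle_trans; [apply Rabs_triang|]. rewrite Rabs_Ropp. apply Rplus_le_compat_l.
  rewrite Rabs_mult. apply Rmult_le_compat; auto using Rabs_pos, clamp_lipschitz.
  rewrite !Rabs_mult, (Rabs_pos_eq 3) by lra.
  assert (h := wp_range _ _ _ _ H (foot beta r0 t' y')).
  rewrite (Rabs_pos_eq (r0 _ ^ 2)) by apply pow2_ge_0.
  assert (r0 (foot beta r0 t' y') ^ 2 <= 4) by nra. assert (p := Rabs_pos beta). nra. }
intros t y eps.
assert (p := Rabs_pos beta).
assert (Hd : 0 < eps / (2 * (1 + 12 * Rabs beta))) by (apply Rdiv_lt_0_compat; [apply cond_pos|lra]).
exists (mkposreal _ Hd). intros u w Hu Hw. simpl in Hu, Hw.
eapply Rle_lt_trans; [apply L|]. set (d := eps / (2 * (1 + 12 * Rabs beta))) in *.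
assert (Ee : pos eps = 2 * (d + 12 * Rabs beta * d)) by (unfold d; field; lra).
rewrite Ee. assert (12 * Rabs beta * Rabs (u - t) <= 12 * Rabs beta * d) by (apply Rmult_le_compat_l; lra). lra.
Qed.

Lemma foot_derive_y (beta : R) (eta0 r0 dr0 : R -> R) (t y : R) :
  wave_profile beta eta0 r0 dr0 ->
  is_derive (foot beta r0 t) y (/ jacobian beta r0 dr0 t (foot beta r0 t y)).
Proof.
intros H. assert (D := characteristic_diffeo beta eta0 r0 dr0 t H).
rewrite <- (is_derive_unique _ _ _ (characteristic_derive beta eta0 r0 dr0 t (foot beta r0 t y) H)).
apply inverse_derive, D.
Qed.

Lemma locally_clamp (t : R) : -1 < t < 2 -> locally t (fun u => clamp u = u).
Proof.
intros H. assert (Hd : 0 < Rmin (t + 1) (2 - t)) by (apply Rmin_pos; lra).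
exists (mkposreal _ Hd). intros u Hu. change (Rabs (u - t) < Rmin (t + 1) (2 - t)) in Hu.
assert (h1 := Rmin_l (t + 1) (2 - t)). assert (h2 := Rmin_r (t + 1) (2 - t)).
apply Rabs_def2 in Hu. apply clamp_id. lra.
Qed.

(** Let [z u] be the foot of [(u, y)]. The time-[t] characteristic map sends [z u] to
    [y - 3 beta (u - t) r0 (z u)^2], so [z u] is the time-[t] foot of that point. The chain rule
    then needs only the spatial derivative of the foot and the continuity of [z], thanks to the
    factor [u - t]. *)
Lemma foot_derive_t (beta : R) (eta0 r0 dr0 : R -> R) (t y : R) :
  wave_profile beta eta0 r0 dr0 -> -1 < t < 2 ->
  is_derive (fun t => foot beta r0 t y) t
    (- 3 * beta * r0 (foot beta r0 t y) ^ 2 * / jacobian beta r0 dr0 t (foot beta r0 t y)).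
Proof.
intros H Ht. assert (D := characteristic_diffeo beta eta0 r0 dr0 t H).
set (z := fun u => foot beta r0 u y). set (w := fun u => r0 (z u) ^ 2).
assert (Cw : continuous w t).
{ apply (continuous_comp z (fun x => r0 x ^ 2)).
  - apply continuous2_slice_l. eapply foot_continuous2; eauto.
  - apply (ex_derive_continuous (fun x => r0 x ^ 2)). auto_derive. eexists. apply (wp_derive _ _ _ _ H). }
assert (Ez : locally t (fun u => foot beta r0 t (y + -3 * beta * ((u - t) * w u)) = z u)).
{ generalize (locally_clamp t Ht). apply filter_imp. intros u Hu.
  rewrite <- (inverse_spec _ (z u) D). unfold foot. f_equal. unfold characteristic, w.
  assert (S := foot_spec beta eta0 r0 dr0 u y H). fold (z u) in S. rewrite Hu in S.
  rewrite (clamp_id t) by lra. rewrite <- S. ring. }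
apply (is_derive_ext_loc _ _ _ _ Ez).
assert (E : y + - 3 * beta * ((t - t) * w t) = y) by ring.
assert (C := is_derive_comp (foot beta r0 t) (fun u => y + - 3 * beta * ((u - t) * w u)) t
   (/ jacobian beta r0 dr0 t (foot beta r0 t y)) (- 3 * beta * w t)).
apply C.
- rewrite E. eapply foot_derive_y, H.
- replace (- 3 * beta * w t) with (0 + - 3 * beta * w t) by ring.
  apply (is_derive_plus (fun _ => y) (fun u => - 3 * beta * ((u - t) * w u))); [apply (is_derive_const y)|].
  apply (is_derive_scal (fun u => (u - t) * w u) t (- 3 * beta)). apply is_derive_mult_vanishing, Cw.
Qed.

(* The Euler-Lagrange equations are [(eta_x^2 F_t)_t = 0] and [eta_tt + 3 (eta_x F_t^2)_x = 0].  With
   [eta_x^2 F_t = b] the second one is satisfied as soon as [eta_t = 3 beta (1 / eta_x - 1)], [beta^2 = b^2]. *)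
Lemma simple_wave (s beta b : R) (eta0 r0 dr0 : R -> R) :
  wave_profile beta eta0 r0 dr0 -> beta ^ 2 = b ^ 2 ->
  exists eta1 F1,
    exp_graph (fun rho => 3 / rho) s
      ((eta0, fun _ => 0), (fun y => 3 * beta * (r0 y - 1), fun y => b * r0 y ^ 2)) (eta1, F1) /\
    smooth eta1 /\ lift 1 eta1 /\ smooth F1 /\ periodic F1 /\
    (forall y, exists z, z + 3 * beta * r0 z ^ 2 = y /\ eta1 y = eta0 z + 3 * beta * (2 * r0 z - 1)).
Proof.
intros H Hb.
set (Y := foot beta r0). set (J := jacobian beta r0 dr0).
assert (CY : continuous2 Y) by (eapply foot_continuous2, H).
assert (HJ : forall t z, J t z <> 0).
{ intros t z. assert (h := jacobian_ge _ _ _ _ t z H). unfold J; lra. }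
assert (RJ : forall n, ydiff n (fun t z => / J t z)).
{ intros n. apply ydiff_inv; auto. eapply jacobian_ydiff, H. }
assert (DY : forall t y, is_derive (Y t) y (/ J t (Y t y))) by (intros; eapply foot_derive_y, H).
assert (SY : forall t y, Y t (y + 2 * PI) = Y t y + 2 * PI) by (intros; eapply foot_shift, H).
assert (Rcomp : forall n a, ydiff n a -> ydiff n (fun t y => a t (Y t y))).
{ intros n a Ha. apply (ydiff_comp n a (fun t z => / J t z) Y); auto. }
set (r := fun t y => r0 (Y t y)).
set (ry := fun t y => / J t (Y t y) * dr0 (Y t y)).
assert (Hr : forall t y, 0 < r t y <= 2) by (intros; apply (wp_range _ _ _ _ H)).
assert (Rr : forall n, ydiff n r).
{ intros n. apply (Rcomp n (fun _ => r0)), (wp_smooth _ _ _ _ H). }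
assert (Cr := ydiff_continuous2 _ _ (Rr 0%nat)).
assert (Cry : continuous2 ry).
{ apply (ydiff_continuous2 0). apply (Rcomp 0%nat (fun t z => / J t z * dr0 z)).
  apply ydiff_mult; auto. apply (wp_dsmooth _ _ _ _ H). }
assert (Dry : forall t y, is_derive (r t) y (ry t y)).
{ intros t y. apply (is_derive_comp r0 (Y t)); auto. apply (wp_derive _ _ _ _ H). }
assert (Pr : forall t, periodic (r t)).
{ intros t y. unfold r. rewrite SY. apply (wp_periodic _ _ _ _ H). }
assert (DYt : forall t y, -1 < t < 2 -> is_derive (fun t => Y t y) t (- 3 * beta * r t y ^ 2 * / J t (Y t y))).
{ intros; apply (foot_derive_t _ _ _ _ _ _ H); auto. }
(* The transport equation [r_t + 3 beta r^2 r_y = 0], which is [eta_t = 3 beta (r - 1)]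
   differentiated in [y]. *)
assert (Drt : forall t y, -1 < t < 2 -> is_derive (fun t => r t y) t (- 3 * beta * r t y ^ 2 * ry t y)).
{ intros t y Ht. unfold ry. rewrite <- Rmult_assoc.
  apply (is_derive_comp r0 (fun t => Y t y)); auto. apply (wp_derive _ _ _ _ H). }
set (v := fun t y => / r t y).
set (U := fun t y => 3 * beta * (r t y + -1)).
set (V := fun t y => b * (r t y * r t y)).
(* Along a characteristic the total derivative of [eta] is [eta_t + 3 beta r^2 eta_y = 3 beta (r -
   1) + 3 beta r], a constant because [r] is; integrating from the foot gives this formula. *)
set (eta := fun t y => eta0 (Y t y) + 3 * beta * clamp t * (2 * r t y - 1)).
set (F := (fun t y => RInt (fun u => V u y) 0 t) : R -> R -> R).
assert (RV : forall n, ydiff n V).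
{ intros n. apply ydiff_mult; [apply ydiff_const|]. apply ydiff_mult; auto. }
assert (RU : forall n, ydiff n U).
{ intros n. apply ydiff_mult; [apply ydiff_const|]. apply ydiff_plus; auto. apply ydiff_const. }
assert (Rv : forall n, ydiff n v).
{ intros n. apply ydiff_inv; auto. intros t y. assert (h := Hr t y). lra. }
assert (CV := ydiff_continuous2 _ _ (RV 0%nat)).
assert (Seta : forall t y, eta t (y + 2 * PI) = eta t y + 2 * PI).
{ intros t y. unfold eta. rewrite SY, Pr, (wp_shift _ _ _ _ H). ring. }
assert (Deta : forall t y, is_derive (eta t) y (v t y)).
{ intros t y.
  assert (D1 : is_derive (fun y => eta0 (Y t y)) y (/ J t (Y t y) * / r t y)).
  { apply (is_derive_comp eta0 (Y t)); auto. apply (wp_eta _ _ _ _ H). }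
  (* As [ry = dr0 / J], the sum is [(1 / r + 6 beta t dr0) / J] with clamped [t], and the numerator
     equals [J / r]. *)
  replace (v t y) with (/ J t (Y t y) * / r t y + 3 * beta * clamp t * (2 * ry t y - 0)).
  - apply (is_derive_plus (fun y => eta0 (Y t y)) (fun y => 3 * beta * clamp t * (2 * r t y - 1))); auto.
    apply (is_derive_scal (fun y => 2 * r t y - 1) y (3 * beta * clamp t)).
    apply (is_derive_minus (fun y => 2 * r t y) (fun _ => 1)); [|apply (is_derive_const 1)].
    apply (is_derive_scal (r t) y 2), Dry.
  - unfold ry, v. assert (h := Hr t y). assert (h' := HJ t (Y t y)).
    assert (EJ : J t (Y t y) = 1 + 6 * beta * clamp t * (r t y * dr0 (Y t y))) by reflexivity.
    apply Rmult_eq_reg_r with (J t (Y t y) * r t y).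
    2: { apply Rmult_integral_contrapositive; split; lra. }
    field_simplify; [|lra|split; lra]. rewrite EJ. ring. }
assert (Detat : forall t y, 0 <= t <= 1 -> is_derive (fun t => eta t y) t (U t y)).
{ intros t y Ht. assert (Ht' : -1 < t < 2) by lra.
  apply (is_derive_ext_loc (fun t => eta0 (Y t y) + 3 * beta * (t * (2 * r t y - 1)))).
  { generalize (locally_clamp t Ht'). apply filter_imp. intros u Hu. unfold eta. rewrite Hu. eqR; ring. }
  assert (D1 : is_derive (fun t => eta0 (Y t y)) t (- 3 * beta * r t y ^ 2 * / J t (Y t y) * / r t y)).
  { apply (is_derive_comp eta0 (fun t => Y t y)); auto. apply (wp_eta _ _ _ _ H). }
  assert (D2 : is_derive (fun t => t * (2 * r t y - 1)) t
     (1 * (2 * r t y - 1) + t * (2 * (- 3 * beta * r t y ^ 2 * ry t y) - 0))).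
  { apply (is_derive_mult (fun t => t) (fun t => 2 * r t y - 1)); [apply (is_derive_id t)| |intros; apply Rmult_comm].
    apply (is_derive_minus (fun t => 2 * r t y) (fun _ => 1)); [|apply (is_derive_const 1)].
    apply (is_derive_scal (fun t => r t y) t 2), Drt. lra. }
  replace (U t y) with (- 3 * beta * r t y ^ 2 * / J t (Y t y) * / r t y +
     3 * beta * (1 * (2 * r t y - 1) + t * (2 * (- 3 * beta * r t y ^ 2 * ry t y) - 0))).
  - apply (is_derive_plus (fun t => eta0 (Y t y)) (fun t => 3 * beta * (t * (2 * r t y - 1)))); auto.
    apply (is_derive_scal (fun t => t * (2 * r t y - 1)) t (3 * beta)); auto.
  - unfold ry, U. assert (h := Hr t y). assert (h' := HJ t (Y t y)).
    assert (EJ : J t (Y t y) = 1 + 6 * beta * clamp t * (r t y * dr0 (Y t y))) by reflexivity.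
    rewrite clamp_id in EJ by lra.
    apply Rmult_eq_reg_r with (J t (Y t y)); auto.
    field_simplify; [|split; lra]. rewrite EJ. ring. }
assert (SF : forall t, smooth (F t)).
{ intros t. apply (ydiff_smooth (fun _ y => RInt (fun u => V u y) 0 t) t). intros n. apply ydiff_RInt, RV. }
assert (PV : forall t, periodic (V t)). { intros t y. unfold V. rewrite Pr. auto. }
assert (PF : forall t, periodic (F t)).
{ intros t y. unfold F. apply RInt_ext. intros u _. apply PV. }
assert (DF : forall t y, is_derive (fun t => F t y) t (V t y)).
{ intros t y. apply (is_derive_RInt (fun u => V u y) (fun t => F t y) 0 t).
  - exists (mkposreal _ Rlt_0_1). intros u _. apply (RInt_correct (V := R_CompleteNormedModule)).
    apply continuous_ex_RInt. intros; apply continuous2_slice_l, CV.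
  - apply continuous2_slice_l, CV. }
assert (Seta1 : smooth (eta 1)).
{ apply (smooth_of_derive (eta 1) (v 1)); auto. apply ydiff_smooth, Rv. }
assert (Y0 : forall y, Y 0 y = y).
{ intros y. assert (S := foot_spec beta eta0 r0 dr0 0 y H). fold Y in S. rewrite clamp_id in S by lra. lra. }
exists (eta 1), (F 1). split; [|refine (conj Seta1 (conj (conj _ _) (conj (SF 1) (conj (PF 1) _))))].
- exists (fun t => (eta t, F t)), (fun t => (U t, V t)). refine (conj _ (conj _ (conj _ eq_refl))).
  + apply (geodesic_criterion s eta F U V v (/ 2)); auto.
    * intros t y. unfold U. rewrite Pr. auto.
    * lra.
    * intros t y. apply Rinv_le_contravar; apply Hr.
    * intros h k Hh Hk.
      destruct (variation_regular h Hh) as [Ch [Chx [Cht [Dhx [Dht [Ph [Phx Pht]]]]]]].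
      destruct (variation_regular k Hk) as [Ck [_ [Ckt [_ [Dkt [_ [_ _]]]]]]].
      set (hx := dspace h) in *. set (ht := dtime h) in *. set (kt := dtime k) in *.
      assert (Kc : forall c, continuous2 (fun _ _ => c)) by (intros c t x; apply continuity_2d_pt_const).
      assert (Km : forall f g, continuous2 f -> continuous2 g -> continuous2 (fun t x => f t x * g t x)).
      { intros f g Hf Hg t x. apply continuity_2d_pt_mult; auto. }
      assert (Kp : forall f g, continuous2 f -> continuous2 g -> continuous2 (fun t x => f t x + g t x)).
      { intros f g Hf Hg t x. apply continuity_2d_pt_plus; auto. }
      assert (Ks : forall f, continuous2 f -> continuous2 (fun t x => f t x ^ 2)).
      { intros f Hf. apply (Km f (fun t x => f t x * 1)); auto. }
      (* [Qt] is the time derivative of [r h], by the transport equation, and [Bx] the space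
         derivative of [beta r^3 h]. Their sum is [r ht + beta r^3 hx], so by [beta^2 = b^2] the
         first variation is a combination of [kt], [ht], [Qt] and [Bx]. All four integrate to 0,
         since [h] and [k] vanish at both ends and are periodic. *)
      set (Qt := fun t x => - 3 * beta * r t x ^ 2 * ry t x * h t x + r t x * ht t x).
      set (Bx := fun t x => 3 * beta * r t x ^ 2 * ry t x * h t x + beta * (r t x * r t x ^ 2) * hx t x).
      assert (CQ : continuous2 Qt) by (unfold Qt; auto 14).
      assert (CB : continuous2 Bx) by (unfold Bx; auto 14).
      assert (Z1 : dint kt = 0).
      { rewrite (dint_time_derivative k kt); auto. destruct Hk as [_ [_ Hk]].
        rewrite (RInt_ext (k 1) (fun _ => 0)), (RInt_ext (k 0) (fun _ => 0)); [ring| |]; intros; apply Hk. }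
      assert (Z2 : dint ht = 0).
      { rewrite (dint_time_derivative h ht); auto. destruct Hh as [_ [_ Hh]].
        rewrite (RInt_ext (h 1) (fun _ => 0)), (RInt_ext (h 0) (fun _ => 0)); [ring| |]; intros; apply Hh. }
      assert (Z3 : dint Qt = 0).
      { rewrite (dint_time_derivative (fun t x => r t x * h t x) Qt); auto.
        - destruct Hh as [_ [_ Hh]].
          rewrite (RInt_ext (fun x => r 1 x * h 1 x) (fun _ => 0)), (RInt_ext (fun x => r 0 x * h 0 x) (fun _ => 0)); [ring| |];
          intros x _; destruct (Hh x) as [e0 e1]; rewrite ?e0, ?e1; eqR; ring.
        - intros t x Ht. apply (is_derive_mult (fun t => r t x) (fun t => h t x)); auto. intros; apply Rmult_comm. }
      assert (Z4 : dint Bx = 0).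
      { apply (dint_space_derivative (fun t x => beta * (r t x * r t x ^ 2) * h t x)); auto.
        - intros t x. rewrite Pr, Ph. auto.
        - intros t x. assert (e1 := Dry t x). assert (e2 := Dhx t x). auto_derive.
          { repeat split; eexists; eauto. }
          assert (E1 : Derive (fun x => r t x) x = ry t x) by apply is_derive_unique, e1.
          assert (E2 : Derive (fun x => h t x) x = hx t x) by apply is_derive_unique, e2.
          rewrite E1, E2. unfold Bx. ring. }
      replace (fun t x => 3 * v t x * V t x ^ 2 * hx t x + 3 * v t x ^ 2 * V t x * kt t x + U t x * ht t x)
        with (fun t x => 3 * b * kt t x + (3 * beta) * (-1 * ht t x + 1 * (Qt t x + 1 * Bx t x))).
      2: { apply functional_extensionality; intros t; apply functional_extensionality; intros x.
           assert (h1 := Hr t x). unfold Qt, Bx, U, V, v.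
           replace (3 * / r t x * (b * (r t x * r t x)) ^ 2 * hx t x) with (3 * b ^ 2 * r t x ^ 3 * hx t x) by (field; lra).
           rewrite <- Hb. field. lra. }
      rewrite (dint_linear (fun t x => 3 * b * kt t x) (fun t x => -1 * ht t x + 1 * (Qt t x + 1 * Bx t x)) (3 * beta)); auto 14.
      rewrite (dint_linear (fun t x => -1 * ht t x) (fun t x => Qt t x + 1 * Bx t x) 1); auto 14.
      rewrite (dint_linear Qt Bx 1); auto.
      assert (S : forall c f, continuous2 f -> dint (fun t x => c * f t x) = c * dint f).
      { intros c f Hf. replace (fun t x => c * f t x) with (fun t x => f t x + (c - 1) * f t x)
         by (apply functional_extensionality; intros; apply functional_extensionality; intros; ring).
        rewrite dint_linear; auto. ring. }
      rewrite (S (3 * b) kt), (S (-1) ht); auto. rewrite Z1, Z2, Z3, Z4. ring.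
  + assert (E1 : eta 0 = eta0).
    { apply functional_extensionality; intros y. unfold eta. rewrite Y0, clamp_id by lra. ring. }
    assert (E2 : F 0 = fun _ => 0).
    { apply functional_extensionality; intros y. apply (RInt_point 0 (fun u => V u y)). }
    rewrite E1, E2. reflexivity.
  + assert (E1 : U 0 = fun y => 3 * beta * (r0 y - 1)).
    { apply functional_extensionality; intros y. unfold U, r. rewrite Y0. ring. }
    assert (E2 : V 0 = fun y => b * r0 y ^ 2).
    { apply functional_extensionality; intros y. unfold V, r. rewrite Y0. ring. }
    rewrite E1, E2. reflexivity.
- apply smooth_continuous, Seta1.
- intros y. rewrite Seta. ring.
- intros y. exists (Y 1 y). assert (S := foot_spec beta eta0 r0 dr0 1 y H). rewrite clamp_id in S by lra. split.
  + fold Y in S. lra.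
  + unfold eta. rewrite clamp_id by lra. unfold r. ring.
Qed.

(** * Simple waves issuing from a cosine *)

(** The reciprocal of the derivative of [y + a cos (n y)], the [r0] of the corresponding profile. *)
Definition wave_ratio (n : nat) (a y : R) : R := / (1 - a * (INR n * sin (INR n * y))).

Definition wave_data (n : nat) (beta b a : R) : bpair :=
  ((fun y => y + a * cos (INR n * y), fun _ => 0),
   (fun y => 3 * beta * (wave_ratio n a y - 1), fun y => b * wave_ratio n a y ^ 2)).

Definition base_data (b : R) : bpair := ((fun y => y, fun _ => 0), (fun _ => 0, fun _ => b)).

Lemma wave_data_0 (n : nat) (beta b : R) : wave_data n beta b 0 = base_data b.
Proof.
unfold wave_data, base_data, wave_ratio. f_equal; f_equal; apply functional_extensionality; intros y.
- ring.
- rewrite Rmult_0_l, Rminus_0_r, Rinv_1. ring.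
- rewrite Rmult_0_l, Rminus_0_r, Rinv_1. ring.
Qed.

(** The first condition keeps the derivative of [y + a cos (n y)] at least [1 / 2], so the ratio is
    at most 2. In the second, [192 = 24 * 2^3]: the quantity bounded by [/ 24] in [wave_profile]
    carries the cube of the ratio. *)
Definition small_amplitude (n : nat) (beta a : R) : Prop :=
  Rabs a * INR n <= / 2 /\ 192 * Rabs beta * Rabs a * INR n ^ 2 <= 1.

Lemma sin_term_bound (n : nat) (beta a y : R) : small_amplitude n beta a ->
  Rabs (a * (INR n * sin (INR n * y))) <= / 2.
Proof.
intros [H _]. rewrite !Rabs_mult, (Rabs_pos_eq (INR n)) by apply pos_INR.
assert (Rabs (sin (INR n * y)) <= 1) by (apply Rabs_le; destruct (SIN_bound (INR n * y)); lra).
assert (h := Rabs_pos a). assert (h' := pos_INR n). assert (0 <= Rabs a * INR n) by nra. nra.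
Qed.

Lemma wave_ratio_range (n : nat) (beta a y : R) : small_amplitude n beta a -> 0 < wave_ratio n a y <= 2.
Proof.
intros H. assert (h := sin_term_bound n beta a y H). apply Rabs_le_between in h. unfold wave_ratio.
split; [apply Rinv_0_lt_compat; lra|]. replace 2 with (/ / 2) by field. apply Rinv_le_contravar; lra.
Qed.

Lemma wave_ratio_inv (n : nat) (beta a y : R) : small_amplitude n beta a ->
  wave_ratio n a y * (1 - a * (INR n * sin (INR n * y))) = 1.
Proof.
intros H. assert (h := sin_term_bound n beta a y H). apply Rabs_le_between in h. unfold wave_ratio.
apply Rinv_l. lra.
Qed.

Lemma trig_mode_period (n : nat) (y : R) :
  cos (INR n * (y + 2 * PI)) = cos (INR n * y) /\ sin (INR n * (y + 2 * PI)) = sin (INR n * y).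
Proof.
rewrite Rmult_plus_distr_l, cos_plus, sin_plus, cos_mode_period, sin_mode_period. split; ring.
Qed.

Lemma wave_ratio_periodic (n : nat) (a : R) : periodic (wave_ratio n a).
Proof. intros y. unfold wave_ratio. rewrite (proj2 (trig_mode_period n y)). auto. Qed.

Lemma ydiff_wave_ratio (n : nat) (beta : R) (c : R -> R) (m : nat) :
  (forall t, continuous c t) -> (forall t, small_amplitude n beta (c t)) ->
  ydiff m (fun t y => wave_ratio n (c t) y).
Proof.
intros Hc Ha. unfold wave_ratio. apply ydiff_inv.
- intros t y. assert (h := sin_term_bound n beta (c t) y (Ha t)). apply Rabs_le_between in h. lra.
- replace (fun t y => 1 - c t * (INR n * sin (INR n * y))) with
    (fun t y => 1 + -1 * (c t * (INR n * sin (INR n * y)))).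
  2: { apply functional_extensionality; intros; apply functional_extensionality; intros; ring. }
  apply ydiff_plus; [apply ydiff_const|]. apply ydiff_mult; [apply ydiff_const|].
  apply ydiff_mult; [apply ydiff_of_l, Hc|]. apply ydiff_mult; [apply ydiff_const|].
  apply (ydiff_trig (INR n) m).
Qed.

Lemma wave_profile_cos (n : nat) (beta a : R) : small_amplitude n beta a ->
  wave_profile beta (fun y => y + a * cos (INR n * y)) (wave_ratio n a)
    (fun y => a * INR n ^ 2 * (cos (INR n * y) * (wave_ratio n a y * wave_ratio n a y))).
Proof.
intros H.
assert (Hr : forall y, 0 < wave_ratio n a y <= 2) by (intros; eapply wave_ratio_range, H).
assert (RR : forall m, ydiff m (fun _ : R => wave_ratio n a)).
{ intros m. apply (ydiff_wave_ratio n beta (fun _ => a)); auto. intros; apply continuous_const. }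
split; auto.
- intros m. apply ydiff_mult; [apply ydiff_const|]. apply ydiff_mult; [apply (ydiff_trig (INR n) m)|].
  apply ydiff_mult; auto.
- intros y. assert (h := sin_term_bound n beta a y H). apply Rabs_le_between in h. unfold wave_ratio. auto_derive.
  + lra.
  + field. lra.
- apply wave_ratio_periodic.
- intros y. assert (h := Hr y). set (r := wave_ratio n a y) in *.
  replace (beta * (r * (a * INR n ^ 2 * (cos (INR n * y) * (r * r))))) with
    ((beta * a * INR n ^ 2) * (cos (INR n * y) * r ^ 3)) by ring.
  rewrite Rabs_mult.
  assert (h1 : Rabs (beta * a * INR n ^ 2) <= / 192).
  { rewrite !Rabs_mult, (Rabs_pos_eq (INR n ^ 2)) by apply pow2_ge_0. destruct H as [_ H]. lra. }
  assert (h2 : Rabs (cos (INR n * y) * r ^ 3) <= 1 * 2 ^ 3).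
  { rewrite Rabs_mult. apply Rmult_le_compat; try apply Rabs_pos.
    - apply Rabs_le. destruct (COS_bound (INR n * y)); lra.
    - rewrite Rabs_pos_eq by (apply pow_le; lra). apply pow_incr. lra. }
  apply Rle_trans with (/ 192 * (1 * 2 ^ 3)); [|lra]. apply Rmult_le_compat; auto using Rabs_pos.
- intros y. unfold wave_ratio. rewrite Rinv_inv. auto_derive; auto. ring.
- intros y. rewrite (proj1 (trig_mode_period n y)). ring.
Qed.

Lemma cos_lipschitz (x y : R) : Rabs (cos x - cos y) <= Rabs (x - y).
Proof.
destruct (MVT_gen cos y x (fun z => - sin z)) as [c [_ E]].
- intros. auto_derive; auto. ring.
- intros. apply continuity_cos.
- rewrite E, Rabs_mult, Rabs_Ropp.
  assert (Rabs (sin c) <= 1) by (apply Rabs_le; destruct (SIN_bound c); lra).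
  assert (h := Rabs_pos (x - y)). nra.
Qed.

(** With [z] the foot of [y] at time 1, the endpoint is exactly
    [y + a cos (n z) - 3 beta (r - 1)^2], and [r - 1] is of order [a n]. Replacing [z] by
    [y - 3 beta] shifts the phase by at most [18 |beta| |a| n^2], the quadratic term is at most
    [12 |beta| n^2 a^2], and [30 = 18 + 12]. *)
Lemma exp_at_wave (s : R) (n : nat) (beta b a : R) :
  small_amplitude n beta a -> beta ^ 2 = b ^ 2 ->
  exists eta1 F1,
    exp_graph (fun rho => 3 / rho) s (wave_data n beta b a) (eta1, F1) /\
    smooth eta1 /\ lift 1 eta1 /\ smooth F1 /\ periodic F1 /\
    (forall y, Rabs (eta1 y - (y + a * cos (INR n * (y - 3 * beta)))) <= 30 * Rabs beta * INR n ^ 2 * a ^ 2).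
Proof.
intros H Hb.
destruct (simple_wave s beta b _ _ _ (wave_profile_cos n beta a H) Hb)
  as [eta1 [F1 [HG [S1 [L1 [S2 [P2 HE]]]]]]].
exists eta1, F1. do 5 (split; [assumption|]). intros y.
destruct (HE y) as [z [Hz Ez]]. rewrite Ez.
assert (h := wave_ratio_range n beta a z H). assert (e := wave_ratio_inv n beta a z H).
set (r := wave_ratio n a z) in *. set (N := INR n) in *. assert (HN : 0 <= N) by apply pos_INR.
assert (Hs : Rabs (sin (N * z)) <= 1) by (apply Rabs_le; destruct (SIN_bound (N * z)); lra).
assert (Er : r - 1 = r * (a * (N * sin (N * z)))) by lra.
assert (pa := Rabs_pos a). assert (pb := Rabs_pos beta).
assert (B1 : Rabs (r - 1) <= 2 * (Rabs a * N)).
{ rewrite Er, !Rabs_mult, (Rabs_pos_eq r), (Rabs_pos_eq N) by lra.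
  assert (0 <= Rabs a * N) by nra. assert (Rabs a * (N * Rabs (sin (N * z))) <= Rabs a * N) by nra.
  assert (0 <= Rabs a * (N * Rabs (sin (N * z)))) by (repeat apply Rmult_le_pos; auto; apply Rabs_pos). nra. }
replace (z + a * cos (N * z) + 3 * beta * (2 * r - 1) - (y + a * cos (N * (y - 3 * beta))))
  with (a * (cos (N * z) - cos (N * (y - 3 * beta))) + - (3 * beta * ((r - 1) * (r - 1)))) by (rewrite <- Hz; ring).
eapply Rle_trans; [apply Rabs_triang|].
assert (B2 : Rabs (cos (N * z) - cos (N * (y - 3 * beta))) <= 18 * Rabs beta * (Rabs a * N ^ 2)).
{ eapply Rle_trans; [apply cos_lipschitz|].
  replace (N * z - N * (y - 3 * beta)) with (- (3 * (beta * N * ((r - 1) * (r + 1))))) by (rewrite <- Hz; ring).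
  rewrite Rabs_Ropp, !Rabs_mult, (Rabs_pos_eq 3), (Rabs_pos_eq N), (Rabs_pos_eq (r + 1)) by lra.
  assert (Rabs (r - 1) * (r + 1) <= 2 * (Rabs a * N) * 3).
  { apply Rmult_le_compat; try apply Rabs_pos; lra. }
  assert (0 <= Rabs beta * N) by nra. nra. }
assert (B3 : Rabs ((r - 1) * (r - 1)) <= 4 * (Rabs a * N) ^ 2).
{ rewrite Rabs_mult. assert (p := Rabs_pos (r - 1)). nra. }
rewrite Rabs_Ropp, !(Rabs_mult a), !(Rabs_mult (3 * beta)), !(Rabs_mult 3), (Rabs_pos_eq 3) by lra.
assert (Ea : a ^ 2 = Rabs a * Rabs a) by (rewrite <- Rabs_mult, Rabs_pos_eq by nra; ring).
rewrite Ea.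
assert (Rabs a * Rabs (cos (N * z) - cos (N * (y - 3 * beta))) <= Rabs a * (18 * Rabs beta * (Rabs a * N ^ 2)))
  by (apply Rmult_le_compat_l; auto).
assert (3 * Rabs beta * Rabs ((r - 1) * (r - 1)) <= 3 * Rabs beta * (4 * (Rabs a * N) ^ 2))
  by (apply Rmult_le_compat_l; lra).
replace (30 * Rabs beta * N ^ 2 * (Rabs a * Rabs a)) with
  (Rabs a * (18 * Rabs beta * (Rabs a * N ^ 2)) + 3 * Rabs beta * (4 * (Rabs a * N) ^ 2)) by ring.
lra.
Qed.

(** Near [t = 0] the functions [g t] stay within 1 of [g 0] in [C^m], so one constant bounds their
    norms. The scalar [c] is kept apart to exhibit the power of the amplitude later on. *)
Lemma Hs_norm_family (s : R) (g : R -> R -> R) :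
  (forall n, ydiff n g) -> (forall t, periodic (g t)) ->
  exists K delta, 0 < K /\ 0 < delta /\
    forall t, Rabs t < delta -> forall c, Hs_norm s (fun y => c * g t y) <= K * Rabs c.
Proof.
intros Hg Hp. destruct (Hs_norm_bounded_C s) as [C [HC H]].
destruct (ydiff_bounded_C_uniform (order s) g 0 (Hg _) Hp 1 Rlt_0_1) as [d [Hd Hd']].
destruct (smooth_bounded_C (order s) (g 0)) as [B [HB HB']]; auto. { apply ydiff_smooth, Hg. }
exists (C * (1 + B)), d. split; [apply Rmult_lt_0_compat; lra|]. split; auto.
intros t Ht c. replace (C * (1 + B) * Rabs c) with (C * (Rabs c * (1 + B))) by ring. apply H.
- apply Rmult_le_pos; [apply Rabs_pos|lra].
- intros y. rewrite Hp; auto.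
- apply bounded_C_scal. replace (g t) with (fun y => (g t y - g 0 y) + g 0 y).
  2: { apply functional_extensionality; intros; ring. }
  apply bounded_C_plus; auto. apply Hd'. rewrite Rminus_0_r; auto.
Qed.

Lemma fsin_linear (f g : R -> R) (c : R) (n : nat) :
  (forall x, continuous f x) -> (forall x, continuous g x) ->
  fsin (fun x => f x + c * g x) n = fsin f n + c * fsin g n.
Proof.
intros Hf Hg. unfold fsin.
rewrite (RInt_ext _ (fun x => f x * sin (INR n * x) + c * (g x * sin (INR n * x)))) by (intros; eqR; ring).
rewrite (RInt_plus (fun x => f x * sin (INR n * x)) (fun x => c * (g x * sin (INR n * x)))).
- unfold plus; simpl. f_equal. apply (RInt_scal (fun x => g x * sin (INR n * x))), ex_RInt_sin_mode, Hg.
- apply ex_RInt_sin_mode, Hf.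
- apply (ex_RInt_scal (fun x => g x * sin (INR n * x))), ex_RInt_sin_mode, Hg.
Qed.

Lemma fsin_bound (f : R -> R) (B : R) (n : nat) :
  (forall x, continuous f x) -> (forall x, Rabs (f x) <= B) -> Rabs (fsin f n) <= 2 * PI * B.
Proof.
intros Hf HB. assert (Hpi := PI_RGT_0). replace (2 * PI * B) with ((2 * PI - 0) * B) by ring.
apply abs_RInt_le_const; [lra|apply ex_RInt_sin_mode, Hf|].
intros x _. rewrite Rabs_mult, <- (Rmult_1_r B). apply Rmult_le_compat; auto using Rabs_pos.
apply Rabs_le. destruct (SIN_bound (INR n * x)); lra.
Qed.

Lemma fsin_cos_shift (n : nat) (c : R) : (0 < n)%nat ->
  fsin (fun y => cos (INR n * (y - c))) n = PI * sin (INR n * c).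
Proof.
intros Hn.
assert (Cc : forall x, continuous (fun x => cos (INR n * x)) x) by apply continuous_cos_mode.
assert (Cs : forall x, continuous (fun x => sin (INR n * x)) x) by apply continuous_sin_mode.
replace (fun y => cos (INR n * (y - c))) with
  (fun y => cos (INR n * c) * cos (INR n * y) + sin (INR n * c) * sin (INR n * y)).
2: { apply functional_extensionality; intros y. rewrite Rmult_minus_distr_l, cos_minus. ring. }
rewrite (fsin_linear (fun y => cos (INR n * c) * cos (INR n * y)) (fun y => sin (INR n * y))); auto.
2: { intros x. apply (continuous_mult (fun _ => cos (INR n * c)) (fun x => cos (INR n * x))); auto. apply continuous_const. }
rewrite fsin_sin, Nat.eqb_refl by auto.
assert (E : fsin (fun y => cos (INR n * c) * cos (INR n * y)) n = 0).
{ unfold fsin. rewrite (RInt_ext _ (fun x => cos (INR n * c) * (sin (INR n * x) * cos (INR n * x)))) by (intros; eqR; ring).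
  rewrite (RInt_scal (fun x => sin (INR n * x) * cos (INR n * x))) by (apply (ex_RInt_cos_mode (fun x => sin (INR n * x))), Cs).
  change (cos (INR n * c) * fcos (fun x => sin (INR n * x)) n = 0). rewrite fcos_sin. ring. }
rewrite E. ring.
Qed.

(** * Expansion of the initial data in the amplitude *)

Definition wave_tangent (n : nat) (beta b : R) : bpair :=
  ((fun y => cos (INR n * y), fun _ => 0),
   (fun y => 3 * beta * INR n * sin (INR n * y), fun y => 2 * b * INR n * sin (INR n * y))).

(** With [S = n sin (n y)] and [r = 1 / (1 - a S)], these are the exact identities
    [r - 1 - a S = a^2 S^2 r] and [r^2 - 1 - 2 a S = a^2 (3 S^2 - 2 a S^3) r^2]. The closed form
    makes the quadratic bound a matter of bounding a smooth family. *)
Definition wave_remainder (n : nat) (beta b a : R) : bpair :=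
  ((fun _ => 0, fun _ => 0),
   (fun y => 3 * beta * a ^ 2 * ((INR n * sin (INR n * y)) ^ 2 * wave_ratio n a y),
    fun y => b * a ^ 2 * ((3 * (INR n * sin (INR n * y)) ^ 2 - 2 * a * (INR n * sin (INR n * y)) ^ 3)
                          * wave_ratio n a y ^ 2))).

Lemma wave_data_expansion (n : nat) (beta b a : R) : small_amplitude n beta a ->
  bsub (wave_data n beta b a) (base_data b) =
  badd (bscal a (wave_tangent n beta b)) (wave_remainder n beta b a).
Proof.
intros H. unfold bsub, badd, bscal, fadd, fscal, wave_data, base_data, wave_tangent, wave_remainder; simpl.
f_equal; f_equal; apply functional_extensionality; intros y; try ring.
all: assert (e := wave_ratio_inv n beta a y H); assert (h := wave_ratio_range n beta a y H);
  set (r := wave_ratio n a y) in *; set (S := INR n * sin (INR n * y)) in *;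
  assert (Er : r = / (1 - a * S)) by reflexivity;
  assert (Hn : 1 - a * S <> 0) by (intros K; rewrite K in e; lra).
- replace (3 * beta * INR n * sin (INR n * y)) with (3 * beta * S) by (unfold S; ring). rewrite Er. field. auto.
- replace (2 * b * INR n * sin (INR n * y)) with (2 * b * S) by (unfold S; ring). rewrite Er. field. auto.
Qed.

Lemma wave_data_increment (n : nat) (beta b a : R) : small_amplitude n beta a ->
  bsub (wave_data n beta b a) (base_data b) =
  ((fun y => a * cos (INR n * y), fun _ => 0),
   (fun y => 3 * beta * a * (INR n * sin (INR n * y) * wave_ratio n a y),
    fun y => b * a * ((2 * (INR n * sin (INR n * y)) - a * (INR n * sin (INR n * y)) ^ 2) * wave_ratio n a y ^ 2))).
Proof.
intros H. unfold bsub, badd, bscal, fadd, fscal, wave_data, base_data; simpl.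
f_equal; f_equal; apply functional_extensionality; intros y; try ring.
all: assert (e := wave_ratio_inv n beta a y H);
  set (r := wave_ratio n a y) in *; set (S := INR n * sin (INR n * y)) in *;
  assert (Er : r = / (1 - a * S)) by reflexivity;
  assert (Hn : 1 - a * S <> 0) by (intros K; rewrite K in e; lra); rewrite Er; field; auto.
Qed.

Lemma fnorm_zero_l (s : R) (f g : R -> R) : f = (fun _ => 0) -> fnorm s (f, g) = Hs_norm s g.
Proof. intros ->. unfold fnorm; simpl. rewrite (proj2 (Hs_norm_zero s)). ring. Qed.

Lemma fnorm_zero_r (s : R) (f g : R -> R) : g = (fun _ => 0) -> fnorm s (f, g) = Hs_norm s f.
Proof. intros ->. unfold fnorm; simpl. rewrite (proj2 (Hs_norm_zero s)). ring. Qed.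

Lemma wave_data_norms (s : R) (n : nat) (beta b : R) :
  exists K a1, 0 < K /\ 0 < a1 /\ forall a, 0 < a < a1 ->
    small_amplitude n beta a /\
    bnorm s (wave_remainder n beta b a) <= K * a ^ 2 /\
    bnorm s (bsub (wave_data n beta b a) (base_data b)) <= K * a.
Proof.
assert (hN := pos_INR n). assert (hb := Rabs_pos beta). assert (hN2 := pow2_ge_0 (INR n)).
(* For [|a| <= 2 / D] the first two summands give the two conditions of [small_amplitude]; the last
   keeps [D] positive when [n = 0]. *)
set (D := 4 * INR n + 384 * Rabs beta * INR n ^ 2 + 1).
assert (hD0 : 0 <= Rabs beta * INR n ^ 2) by (apply Rmult_le_pos; auto).
assert (hD : 0 < D) by (unfold D; lra).
assert (SA : forall a, Rabs a <= 2 / D -> small_amplitude n beta a).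
{ intros a Ha. assert (pa := Rabs_pos a).
  assert (Ha' : Rabs a * D <= 2).
  { apply Rmult_le_compat_r with (r := D) in Ha; [|lra]. replace (2 / D * D) with 2 in Ha by (field; lra). auto. }
  assert (0 <= Rabs a * INR n) by (apply Rmult_le_pos; auto).
  assert (0 <= Rabs a * (Rabs beta * INR n ^ 2)) by (apply Rmult_le_pos; auto).
  unfold D in Ha'. split; nra. }
(* The amplitude becomes a function of an auxiliary parameter [t = D a], clamped so as to be
   admissible for every [t]; the data then form families to which [Hs_norm_family] applies. *)
set (c := fun t => / D * clamp t).
assert (Cc : forall t, continuous c t).
{ intros t. apply (continuous_mult (fun _ => / D) clamp); [apply continuous_const|apply clamp_continuous]. }
assert (Sc : forall t, small_amplitude n beta (c t)).
{ intros t. apply SA. unfold c. rewrite Rabs_mult, Rabs_pos_eq by (apply Rlt_le, Rinv_0_lt_compat, hD).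
  unfold Rdiv. rewrite Rmult_comm. apply Rmult_le_compat_r; [apply Rlt_le, Rinv_0_lt_compat, hD|apply clamp_bound]. }
set (r := fun t y => wave_ratio n (c t) y).
assert (Rr : forall m, ydiff m r) by (intros m; apply (ydiff_wave_ratio n beta); auto).
assert (Pr : forall t, periodic (r t)) by (intros; apply wave_ratio_periodic).
set (S := fun _ y : R => INR n * sin (INR n * y)).
assert (RS : forall m, ydiff m S) by (intros m; apply ydiff_mult; [apply ydiff_const|apply (ydiff_trig (INR n) m)]).
assert (PS : forall t, periodic (S t)) by (intros t y; unfold S; rewrite (proj2 (trig_mode_period n y)); auto).
assert (Rk : forall k m, ydiff m (fun _ _ => k)) by (intros; apply ydiff_const).
assert (Rc : forall m, ydiff m (fun t _ => c t)) by (intros; apply ydiff_of_l, Cc).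
assert (Rpow : forall f k, (forall m, ydiff m f) -> forall m, ydiff m (fun t y => f t y ^ k)).
{ intros f k Hf m. induction k as [|k IH]; simpl; auto. apply ydiff_mult; auto. }
assert (Rsub : forall f g m, ydiff m f -> ydiff m g -> ydiff m (fun t y => f t y - g t y)).
{ intros f g m Hf Hg. replace (fun t y => f t y - g t y) with (fun t y => f t y + -1 * g t y).
  - apply ydiff_plus; auto. apply ydiff_mult; auto.
  - apply functional_extensionality; intros; apply functional_extensionality; intros; ring. }
destruct (Hs_norm_family s (fun _ y => cos (INR n * y))) as [K1 [d1 [HK1 [Hd1 H1]]]].
{ intros m. apply (ydiff_trig (INR n) m). }
{ intros t y. rewrite (proj1 (trig_mode_period n y)); auto. }
destruct (Hs_norm_family s (fun t y => S t y * r t y)) as [K2 [d2 [HK2 [Hd2 H2]]]].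
{ intros m. apply ydiff_mult; auto. }
{ intros t y. rewrite PS, Pr; auto. }
destruct (Hs_norm_family s (fun t y => (2 * S t y - c t * S t y ^ 2) * r t y ^ 2)) as [K3 [d3 [HK3 [Hd3 H3]]]].
{ intros m. apply ydiff_mult; auto. apply (Rsub (fun t y => 2 * S t y) (fun t y => c t * S t y ^ 2)); apply ydiff_mult; auto. }
{ intros t y. rewrite PS, Pr; auto. }
destruct (Hs_norm_family s (fun t y => S t y ^ 2 * r t y)) as [K4 [d4 [HK4 [Hd4 H4]]]].
{ intros m. apply ydiff_mult; auto. }
{ intros t y. rewrite PS, Pr; auto. }
destruct (Hs_norm_family s (fun t y => (3 * S t y ^ 2 - 2 * c t * S t y ^ 3) * r t y ^ 2)) as [K5 [d5 [HK5 [Hd5 H5]]]].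
{ intros m. apply ydiff_mult; auto. apply (Rsub (fun t y => 3 * S t y ^ 2) (fun t y => 2 * c t * S t y ^ 3)).
  - apply ydiff_mult; auto.
  - apply (ydiff_mult m (fun t y => 2 * c t) (fun t y => S t y ^ 3)); auto. apply ydiff_mult; auto. }
{ intros t y. rewrite PS, Pr; auto. }
(* The 1 confines [t] to the region where the clamp is the identity, so that [c t = a]. *)
set (d := Rmin 1 (Rmin d1 (Rmin d2 (Rmin d3 (Rmin d4 d5))))).
assert (Hd : 0 < d /\ d <= 1 /\ d <= d1 /\ d <= d2 /\ d <= d3 /\ d <= d4 /\ d <= d5).
{ unfold d, Rmin. repeat destruct (Rle_dec _ _); lra. }
set (K := K1 + K2 * (3 * Rabs beta) + K3 * Rabs b + K4 * (3 * Rabs beta) + K5 * Rabs b).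
assert (hbb := Rabs_pos b).
assert (Q2 : 0 <= K2 * (3 * Rabs beta)) by (apply Rmult_le_pos; lra).
assert (Q3 : 0 <= K3 * Rabs b) by (apply Rmult_le_pos; lra).
assert (Q4 : 0 <= K4 * (3 * Rabs beta)) by (apply Rmult_le_pos; lra).
assert (Q5 : 0 <= K5 * Rabs b) by (apply Rmult_le_pos; lra).
exists K, (d / D). split; [unfold K; lra|]. split; [apply Rdiv_lt_0_compat; lra|].
intros a Ha. set (t := D * a).
assert (Ht : 0 < t < d).
{ unfold t. split; [apply Rmult_lt_0_compat; lra|]. destruct Ha as [_ Ha].
  apply Rmult_lt_compat_l with (r := D) in Ha; auto. replace (D * (d / D)) with d in Ha by (field; lra). auto. }
assert (Rt : Rabs t = t) by (apply Rabs_pos_eq; lra).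
assert (Ec : c t = a). { unfold c. rewrite clamp_id by lra. unfold t. field. lra. }
assert (SAa : small_amplitude n beta a) by (rewrite <- Ec; auto).
split; auto.
specialize (H1 t ltac:(lra)). specialize (H2 t ltac:(lra)). specialize (H3 t ltac:(lra)).
specialize (H4 t ltac:(lra)). specialize (H5 t ltac:(lra)).
unfold r in H1, H2, H3, H4, H5. rewrite Ec in H2, H3, H4, H5. unfold S in H2, H3, H4, H5.
assert (Ra : Rabs a = a) by (apply Rabs_pos_eq; lra).
assert (Ra2 : Rabs (a ^ 2) = a ^ 2) by (apply Rabs_pos_eq, pow2_ge_0).
assert (pa2 := pow2_ge_0 a).
split.
- unfold wave_remainder, bnorm; cbv [fst snd]. rewrite fnorm_zero_l by reflexivity. rewrite (proj2 (Hs_norm_zero s)).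
  unfold fnorm; cbv [fst snd].
  specialize (H4 (3 * beta * a ^ 2)). specialize (H5 (b * a ^ 2)).
  rewrite !Rabs_mult, Ra2, (Rabs_pos_eq 3) in H4 by lra. rewrite !Rabs_mult, Ra2 in H5.
  apply Rle_trans with ((K4 * (3 * Rabs beta) + K5 * Rabs b) * a ^ 2).
  + lra.
  + apply Rmult_le_compat_r; auto. unfold K. lra.
- rewrite wave_data_increment by auto. unfold bnorm; cbv [fst snd]. rewrite fnorm_zero_r by reflexivity.
  unfold fnorm; cbv [fst snd].
  specialize (H1 a). specialize (H2 (3 * beta * a)). specialize (H3 (b * a)).
  rewrite Ra in H1. rewrite !Rabs_mult, Ra, (Rabs_pos_eq 3) in H2 by lra. rewrite !Rabs_mult, Ra in H3.
  apply Rle_trans with ((K1 + K2 * (3 * Rabs beta) + K3 * Rabs b) * a).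
  + lra.
  + apply Rmult_le_compat_r; [lra|]. unfold K. lra.
Qed.

Lemma small_amplitude_0 (n : nat) (beta : R) : small_amplitude n beta 0.
Proof. unfold small_amplitude. rewrite Rabs_R0. lra. Qed.

(** A simple wave of amplitude 0 is the geodesic [eta = y], [F = b t]; the frequency 0 is
    arbitrary. *)
Lemma exp_domain_base (s b : R) : exp_domain (fun rho => 3 / rho) s (base_data b).
Proof.
destruct (exp_at_wave s 0 b b 0 (small_amplitude_0 0 b) eq_refl) as [eta1 [F1 [H _]]].
rewrite wave_data_0 in H. exists (eta1, F1); auto.
Qed.

Lemma tangent_smooth (s : R) (f g : R -> R) :
  smooth f /\ periodic f -> smooth g /\ periodic g -> tangent s (f, g).
Proof. intros [] []. split; apply Hs_lift0_smooth; auto. Qed.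

Lemma smooth_periodic_const (c : R) : smooth (fun _ => c) /\ periodic (fun _ => c).
Proof.
split; [|intros x; auto]. apply (ydiff_smooth (fun _ _ => c) 0). intros; apply ydiff_const.
Qed.

Lemma smooth_periodic_cos (n : nat) (c : R) :
  smooth (fun y => c * cos (INR n * y)) /\ periodic (fun y => c * cos (INR n * y)).
Proof.
split.
- apply (ydiff_smooth (fun _ y => c * cos (INR n * y)) 0). intros m.
  apply ydiff_mult; [apply ydiff_const|]. apply (ydiff_trig (INR n) m).
- intros y. rewrite (proj1 (trig_mode_period n y)); auto.
Qed.

Lemma smooth_periodic_sin (n : nat) (c : R) :
  smooth (fun y => c * sin (INR n * y)) /\ periodic (fun y => c * sin (INR n * y)).
Proof.
split.
- apply (ydiff_smooth (fun _ y => c * sin (INR n * y)) 0). intros m.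
  apply ydiff_mult; [apply ydiff_const|]. apply (ydiff_trig (INR n) m).
- intros y. rewrite (proj2 (trig_mode_period n y)); auto.
Qed.

Lemma btangent_wave_tangent (s : R) (n : nat) (beta b : R) : btangent s (wave_tangent n beta b).
Proof.
split; apply tangent_smooth.
- replace (fun y => cos (INR n * y)) with (fun y => 1 * cos (INR n * y)); [apply smooth_periodic_cos|].
  apply functional_extensionality; intros; ring.
- apply smooth_periodic_const.
- apply smooth_periodic_sin.
- apply smooth_periodic_sin.
Qed.

Lemma btangent_wave_remainder (s : R) (n : nat) (beta b a : R) :
  small_amplitude n beta a -> btangent s (wave_remainder n beta b a).
Proof.
intros H.
assert (Rr : forall m, ydiff m (fun _ : R => wave_ratio n a)).
{ intros m. apply (ydiff_wave_ratio n beta (fun _ => a)); auto. intros; apply continuous_const. }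
assert (RS : forall m, ydiff m (fun _ y : R => INR n * sin (INR n * y))).
{ intros m; apply ydiff_mult; [apply ydiff_const|apply (ydiff_trig (INR n) m)]. }
assert (Rpow : forall f k, (forall m, ydiff m f) -> forall m, ydiff m (fun t y => f t y ^ k)).
{ intros f k Hf m. induction k as [|k IH]; simpl; [apply ydiff_const|]. apply ydiff_mult; auto. }
split; apply tangent_smooth; [apply smooth_periodic_const|apply smooth_periodic_const| |]; split.
- apply (ydiff_smooth (fun _ y => 3 * beta * a ^ 2 * ((INR n * sin (INR n * y)) ^ 2 * wave_ratio n a y)) 0).
  intros m. apply ydiff_mult; [apply ydiff_const|]. apply ydiff_mult; auto.
- intros y. rewrite (proj2 (trig_mode_period n y)), wave_ratio_periodic. auto.
- replace (fun y => b * a ^ 2 * ((3 * (INR n * sin (INR n * y)) ^ 2 - 2 * a * (INR n * sin (INR n * y)) ^ 3)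
     * wave_ratio n a y ^ 2)) with
   (fun y => b * a ^ 2 * ((3 * (INR n * sin (INR n * y)) ^ 2 + - 2 * a * (INR n * sin (INR n * y)) ^ 3)
     * wave_ratio n a y ^ 2)).
  2: { apply functional_extensionality; intros; ring. }
  apply (ydiff_smooth (fun _ y => b * a ^ 2 * ((3 * (INR n * sin (INR n * y)) ^ 2 + - 2 * a * (INR n * sin (INR n * y)) ^ 3)
     * wave_ratio n a y ^ 2)) 0).
  intros m. apply ydiff_mult; [apply ydiff_const|]. apply ydiff_mult.
  + apply ydiff_plus; apply ydiff_mult; try apply ydiff_const;
      apply (Rpow (fun _ y => INR n * sin (INR n * y))); auto.
  + apply (Rpow (fun _ => wave_ratio n a) 2%nat); auto.
- intros y. rewrite (proj2 (trig_mode_period n y)), wave_ratio_periodic. auto.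
Qed.

(** * The n-th sine coefficient of the derivative *)

Lemma fsin_Hs_bound (s : R) (n : nat) : (0 < n)%nat ->
  exists C, 0 < C /\ forall g, Hs_finite s g -> Rabs (fsin g n) <= C * Hs_norm s g.
Proof.
intros Hn. assert (W := mode_weight_pos s n). assert (Hpi := PI_RGT_0).
exists (2 * PI / mode_weight s n). split; [apply Rdiv_lt_0_compat; lra|].
intros g Hg. assert (h := fsin_le_Hs_norm s g n Hn Hg).
apply Rmult_le_reg_l with (mode_weight s n); auto.
replace (mode_weight s n * (2 * PI / mode_weight s n * Hs_norm s g)) with (2 * PI * Hs_norm s g) by (field; lra).
auto.
Qed.

Lemma fnorm_fst (s : R) (w : fpair) : Hs_norm s (fst w) <= fnorm s w.
Proof. unfold fnorm. assert (h := Hs_norm_nonneg s (snd w)). lra. Qed.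

(** The limit of vanishing amplitude, after division by [a]: [A eps] will be the error of
    differentiability and [B a] the contribution of the quadratic terms. The range of [a] may depend
    on [eps]. *)
Lemma eq_of_forall_linear_bound (x A B : R) :
  0 <= A -> 0 <= B ->
  (forall eps, 0 < eps -> exists a1, 0 < a1 /\ forall a, 0 < a < a1 -> Rabs x <= A * eps + B * a) -> x = 0.
Proof.
intros HA HB H. destruct (Req_dec x 0) as [h|h]; auto. exfalso.
assert (p := Rabs_pos_lt x h).
assert (He : 0 < Rabs x / (4 * (A + 1))) by (apply Rdiv_lt_0_compat; lra).
destruct (H _ He) as [a1 [Ha1 K]].
set (a := Rmin (a1 / 2) (Rabs x / (4 * (B + 1)))).
assert (Hq : 0 < Rabs x / (4 * (B + 1))) by (apply Rdiv_lt_0_compat; lra).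
assert (Ha : 0 < a < a1).
{ unfold a, Rmin. destruct (Rle_dec _ _); lra. }
specialize (K a Ha).
assert (h1 : A * (Rabs x / (4 * (A + 1))) <= Rabs x / 4).
{ replace (Rabs x / 4) with ((A + 1) * (Rabs x / (4 * (A + 1)))) by (field; lra). apply Rmult_le_compat_r; lra. }
assert (h2 : B * a <= Rabs x / 4).
{ replace (Rabs x / 4) with ((B + 1) * (Rabs x / (4 * (B + 1)))) by (field; lra).
  apply Rmult_le_compat; try lra. apply Rmin_r. }
lra.
Qed.

(* The n-th Fourier mode of the derivative in the direction of a simple wave is obtained from the explicit endpoint
   of the geodesic, which to first order is [y + a cos (n (y - 3 beta))]. *)
Lemma derivative_on_wave (s : R) (n : nat) (beta b : R) (E : bpair -> fpair) (L : bpair -> fpair) :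
  (0 < n)%nat -> beta ^ 2 = b ^ 2 ->
  (forall z q, exp_graph (fun rho => 3 / rho) s z q -> E z = q) ->
  bounded_linear s L ->
  (forall eps, 0 < eps -> exists delta, 0 < delta /\
     forall z', exp_domain (fun rho => 3 / rho) s z' -> bnorm s (bsub z' (base_data b)) < delta ->
       fnorm s (fsub (fsub (E z') (E (base_data b))) (L (bsub z' (base_data b))))
         <= eps * bnorm s (bsub z' (base_data b))) ->
  fsin (fst (L (wave_tangent n beta b))) n = PI * sin (INR n * (3 * beta)).
Proof.
intros Hn Hb HE [LT [Ladd [Lscal [M HM]]]] Hdiff.
assert (Hpi := PI_RGT_0).
destruct (wave_data_norms s n beta b) as [K [a1 [HK [Ha1 HW]]]].
destruct (fsin_Hs_bound s n Hn) as [C [HC Hfs]].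
set (W := wave_tangent n beta b).
assert (TW : btangent s W) by apply btangent_wave_tangent.
set (K2 := 30 * Rabs beta * INR n ^ 2).
assert (HK2 : 0 <= K2).
{ unfold K2. apply Rmult_le_pos; [|apply pow2_ge_0]. assert (h := Rabs_pos beta). lra. }
assert (pM := Rabs_pos M).
rewrite <- (fsin_cos_shift n (3 * beta) Hn).
set (T := fun y => cos (INR n * (y - 3 * beta))).
assert (CT : forall x, continuous T x).
{ intros x. apply (ex_derive_continuous T). unfold T. auto_derive. auto. }
apply Rminus_diag_uniq.
(* [C K] comes from the Frechet remainder, at most [eps K a] in norm; [C |M| K] from the image under
   [L] of the quadratic part of the data; [2 PI K2] from the error in the endpoint of the wave. *)
apply (eq_of_forall_linear_bound _ (C * K) (C * (Rabs M * K) + 2 * PI * K2)).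
{ apply Rmult_le_pos; lra. }
{ apply Rplus_le_le_0_compat; apply Rmult_le_pos; try lra. apply Rmult_le_pos; lra. }
intros eps He. destruct (Hdiff eps He) as [delta [Hdelta Hd]].
exists (Rmin a1 (delta / K)). split; [apply Rmin_pos; auto; apply Rdiv_lt_0_compat; auto|].
intros a Ha. assert (m1 := Rmin_l a1 (delta / K)). assert (m2 := Rmin_r a1 (delta / K)).
destruct (HW a ltac:(lra)) as [SA [HR HZ]].
destruct (exp_at_wave s n beta b a SA Hb) as [eta [F [Hg [S1 [L1 [S2 [P2 Heta]]]]]]].
(* At amplitude 0 the error bound vanishes, so the base geodesic ends exactly at the identity. *)
destruct (exp_at_wave s n beta b 0 (small_amplitude_0 n beta) Hb) as [eta' [F' [Hg' [S1' [L1' [S2' [P2' Heta']]]]]]].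
rewrite wave_data_0 in Hg'.
assert (Eid : forall y, eta' y = y).
{ intros y. specialize (Heta' y). apply Rabs_le_between in Heta'. lra. }
set (Z := wave_data n beta b a) in *. set (R0 := wave_remainder n beta b a) in *.
assert (TR : btangent s R0) by (apply btangent_wave_remainder; auto).
assert (Hdd : bnorm s (bsub Z (base_data b)) < delta).
{ eapply Rle_lt_trans; [apply HZ|]. destruct Ha as [_ Ha].
  apply Rlt_le_trans with (K * (delta / K)); [apply Rmult_lt_compat_l; lra|]. right. field. lra. }
specialize (Hd Z (ex_intro _ _ Hg) Hdd). rewrite (HE _ _ Hg), (HE _ _ Hg') in Hd.
assert (EL : L (bsub Z (base_data b)) = fadd (fscal a (L W)) (L R0)).
{ unfold Z. rewrite (wave_data_expansion n beta b a SA). fold W R0. rewrite Ladd, Lscal; auto.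
  split; apply tangent_smooth.
  - apply smooth_periodic_cos.
  - replace (fun x => a * snd (fst W) x) with (fun _ : R => 0)
      by (apply functional_extensionality; intros; unfold W; simpl; ring). apply smooth_periodic_const.
  - replace (fun x => a * fst (snd W) x) with (fun x => (a * (3 * beta * INR n)) * sin (INR n * x))
      by (apply functional_extensionality; intros; unfold W; simpl; ring). apply smooth_periodic_sin.
  - replace (fun x => a * snd (snd W) x) with (fun x => (a * (2 * b * INR n)) * sin (INR n * x))
      by (apply functional_extensionality; intros; unfold W; simpl; ring). apply smooth_periodic_sin. }
assert (FW : Hs_lift s 0 (fst (L W))) by apply (LT W TW).
assert (FR : Hs_lift s 0 (fst (L R0))) by apply (LT R0 TR).
assert (CW := Hs_lift_continuous _ _ _ FW). assert (CR := Hs_lift_continuous _ _ _ FR).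
assert (FZ : Hs_lift s 0 (fst (L (bsub Z (base_data b))))).
{ apply LT. unfold Z. rewrite wave_data_increment by auto.
  split.
  - apply tangent_smooth; [apply smooth_periodic_cos|apply smooth_periodic_const].
  - assert (Rr : forall m, ydiff m (fun _ : R => wave_ratio n a)).
    { intros m. apply (ydiff_wave_ratio n beta (fun _ => a)); auto. intros; apply continuous_const. }
    assert (RS : forall m, ydiff m (fun _ y : R => INR n * sin (INR n * y))).
    { intros m; apply ydiff_mult; [apply ydiff_const|apply (ydiff_trig (INR n) m)]. }
    apply tangent_smooth; split.
    + apply (ydiff_smooth (fun _ y => 3 * beta * a * (INR n * sin (INR n * y) * wave_ratio n a y)) 0).
      intros m. apply ydiff_mult; [apply ydiff_const|]. apply ydiff_mult; auto.
    + intros y. rewrite (proj2 (trig_mode_period n y)), wave_ratio_periodic. auto.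
    + replace (fun y => b * a * ((2 * (INR n * sin (INR n * y)) - a * (INR n * sin (INR n * y)) ^ 2) * wave_ratio n a y ^ 2))
      with (fun y => b * a * ((2 * (INR n * sin (INR n * y)) + - a * ((INR n * sin (INR n * y)) * (INR n * sin (INR n * y))))
         * (wave_ratio n a y * wave_ratio n a y))) by (apply functional_extensionality; intros; ring).
      apply (ydiff_smooth (fun _ y => b * a * ((2 * (INR n * sin (INR n * y)) + - a * ((INR n * sin (INR n * y)) * (INR n * sin (INR n * y))))
         * (wave_ratio n a y * wave_ratio n a y))) 0).
      intros m. apply ydiff_mult; [apply ydiff_const|]. apply ydiff_mult; [|apply ydiff_mult; auto].
      apply ydiff_plus; apply ydiff_mult; auto; try apply ydiff_const. apply ydiff_mult; auto.
    + intros y. rewrite (proj2 (trig_mode_period n y)), wave_ratio_periodic. auto. }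
assert (Ceta := smooth_continuous eta S1).
set (D := fun y => eta y + -1 * eta' y).
assert (SD : smooth D /\ periodic D).
{ split.
  - apply (smooth_of_derive D (fun y => Derive eta y - 1)).
    + intros y. apply (is_derive_ext (fun y => eta y - y)). { intros; unfold D. rewrite Eid. eqR; ring. }
      apply (is_derive_minus eta (fun y => y)); [apply Derive_correct, (S1 1%nat y)|apply (is_derive_id y)].
    + assert (SS := smooth_derive eta S1). intros k x. destruct k as [|k]; [exact I|].
      destruct (smooth_periodic_const 1) as [c1 _].
      apply (ex_derive_n_minus (Derive eta) (fun _ => 1)).
      * apply filter_forall. intros z j _. apply SS.
      * apply filter_forall. intros z j _. apply c1.
  - intros y. unfold D. rewrite !Eid. destruct L1 as [_ L1]. rewrite L1. ring. }
destruct SD as [SD PD].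
assert (CD := smooth_continuous D SD).
(* First component of the Frechet remainder. Its sine coefficient is small, and linearity splits it
   into the known displacement, [a] times the wanted coefficient, and the image of the quadratic
   part. *)
set (X := fun y => D y - fst (L (bsub Z (base_data b))) y).
assert (NX : Hs_norm s X <= eps * (K * a)).
{ eapply Rle_trans; [|eapply Rle_trans; [apply Hd|apply Rmult_le_compat_l; [lra|apply HZ]]].
  eapply Rle_trans; [|apply fnorm_fst]. right. f_equal. unfold X, D. apply functional_extensionality; intros y.
  unfold fsub, fadd, fscal; simpl. ring. }
assert (FX : Hs_finite s X).
{ apply Hs_finite_minus; auto.
  - apply (Hs_lift_continuous _ _ _ FZ).
  - apply Hs_finite_smooth; auto.
  - apply Hs_lift_finite, FZ. }
assert (IX : fsin X n = fsin D n - a * fsin (fst (L W)) n - fsin (fst (L R0)) n).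
{ unfold X. rewrite EL. unfold fadd, fscal; simpl.
  replace (fun y => D y - (a * fst (L W) y + fst (L R0) y)) with
    (fun y => (D y + - a * fst (L W) y) + -1 * fst (L R0) y) by (apply functional_extensionality; intros; ring).
  rewrite (fsin_linear (fun y => D y + - a * fst (L W) y) (fst (L R0))), (fsin_linear D (fst (L W))); auto.
  - ring.
  - intros x. apply (continuous_plus D (fun y => - a * fst (L W) y)); auto.
    apply (continuous_mult (fun _ => - a) (fst (L W))); auto. apply continuous_const. }
assert (ID : Rabs (fsin D n - a * fsin T n) <= 2 * PI * (K2 * a ^ 2)).
{ replace (fsin D n - a * fsin T n) with (fsin (fun y => D y + - a * T y) n) by (rewrite fsin_linear; auto; ring).
  apply fsin_bound.
  - intros x. apply (continuous_plus D (fun y => - a * T y)); auto.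
    apply (continuous_mult (fun _ => - a) T); auto. apply continuous_const.
  - intros y. unfold D, T. rewrite Eid. eapply Rle_trans; [|apply (Heta y)]. right. f_equal. ring. }
assert (BX := Hfs X FX).
assert (BR := Hfs _ (Hs_lift_finite _ _ FR)).
assert (NR : Hs_norm s (fst (L R0)) <= Rabs M * (K * a ^ 2)).
{ eapply Rle_trans; [apply fnorm_fst|]. eapply Rle_trans; [apply HM; auto|].
  assert (nb : 0 <= bnorm s R0).
  { unfold bnorm, fnorm. assert (q := Hs_norm_nonneg s).
    assert (q1 := q (fst (fst R0))). assert (q2 := q (snd (fst R0))). assert (q3 := q (fst (snd R0))). assert (q4 := q (snd (snd R0))). lra. }
  apply Rle_trans with (Rabs M * bnorm s R0); [apply Rmult_le_compat_r; auto; apply Rle_abs|].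
  apply Rmult_le_compat_l; auto. }
assert (NX' : C * Hs_norm s X <= C * (eps * (K * a))) by (apply Rmult_le_compat_l; lra).
assert (NR' : C * Hs_norm s (fst (L R0)) <= C * (Rabs M * (K * a ^ 2))) by (apply Rmult_le_compat_l; lra).
fold W in IX |- *. fold T.
set (x := fsin T n) in *. set (y := fsin (fst (L W)) n) in *.
set (u := fsin X n) in *. set (w := fsin (fst (L R0)) n) in *. set (dd := fsin D n) in *.
assert (G : a * Rabs (y - x) <= a * (C * K * eps + (C * (Rabs M * K) + 2 * PI * K2) * a)).
{ rewrite <- (Rabs_pos_eq a) at 1 by lra. rewrite <- Rabs_mult.
  replace (a * (y - x)) with ((dd - a * x) + (- u + - w)) by (rewrite IX; ring).
  eapply Rle_trans; [apply Rabs_triang|].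
  assert (t := Rabs_triang (- u) (- w)). rewrite !Rabs_Ropp in t.
  replace (a * (C * K * eps + (C * (Rabs M * K) + 2 * PI * K2) * a)) with
    (2 * PI * (K2 * a ^ 2) + (C * (eps * (K * a)) + C * (Rabs M * (K * a ^ 2)))) by ring. lra. }
apply Rmult_le_reg_l with a; [lra|]. exact G.
Qed.

Definition sine_velocity (n : nat) : bpair :=
  ((fun _ => 0, fun _ => 0), (fun y => sin (INR n * y), fun _ => 0)).

Lemma btangent_sine_velocity (s : R) (n : nat) : btangent s (sine_velocity n).
Proof.
split; apply tangent_smooth; try apply smooth_periodic_const.
replace (fun y => sin (INR n * y)) with (fun y => 1 * sin (INR n * y)); [apply smooth_periodic_sin|].
apply functional_extensionality; intros; ring.
Qed.

Lemma bnorm_sine_velocity (s : R) (n : nat) : (0 < n)%nat -> bnorm s (sine_velocity n) = mode_weight s n / 2.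
Proof.
intros Hn. unfold bnorm, sine_velocity; cbv [fst snd]. rewrite !fnorm_zero_r by reflexivity.
rewrite (proj2 (Hs_norm_zero s)), Hs_norm_sin by auto. ring.
Qed.

(** Of the components of [wave_tangent] only the velocity of [eta] depends on [beta], and it is odd
    in it. *)
Lemma wave_tangent_difference (n : nat) (b : R) :
  badd (wave_tangent n b b) (bscal (-1) (wave_tangent n (- b) b)) = bscal (6 * b * INR n) (sine_velocity n).
Proof.
unfold badd, bscal, fadd, fscal, wave_tangent, sine_velocity; simpl.
f_equal; f_equal; apply functional_extensionality; intros y; ring.
Qed.

(** The two waves have phase shifts [3 b] and [- 3 b], and the sine is odd, so their coefficients
    add up in the difference. The factor [6 b n] is not divided out, which lets the identity hold at
    [b = 0] too. *)
Lemma derivative_on_sine (s : R) (n : nat) (b : R) (E : bpair -> fpair) (L : bpair -> fpair) :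
  (0 < n)%nat ->
  (forall z q, exp_graph (fun rho => 3 / rho) s z q -> E z = q) ->
  bounded_linear s L ->
  (forall eps, 0 < eps -> exists delta, 0 < delta /\
     forall z', exp_domain (fun rho => 3 / rho) s z' -> bnorm s (bsub z' (base_data b)) < delta ->
       fnorm s (fsub (fsub (E z') (E (base_data b))) (L (bsub z' (base_data b))))
         <= eps * bnorm s (bsub z' (base_data b))) ->
  6 * b * INR n * fsin (fst (L (sine_velocity n))) n = 2 * PI * sin (3 * b * INR n).
Proof.
intros Hn HE HL Hd.
assert (A1 := derivative_on_wave s n b b E L Hn eq_refl HE HL Hd).
assert (A2 := derivative_on_wave s n (- b) b E L Hn ltac:(ring) HE HL Hd).
destruct HL as [LT [Ladd [Lscal _]]].
assert (T1 := btangent_wave_tangent s n b b). assert (T2 := btangent_wave_tangent s n (- b) b).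
assert (TS := btangent_sine_velocity s n).
assert (T3 : btangent s (bscal (-1) (wave_tangent n (- b) b))).
{ replace (bscal (-1) (wave_tangent n (- b) b)) with
    (((fun y => -1 * cos (INR n * y), fun _ : R => 0) : fpair,
      (fun y => 3 * b * INR n * sin (INR n * y), fun y => (- 2 * b * INR n) * sin (INR n * y)) : fpair) : bpair).
  - split; apply tangent_smooth.
    + apply smooth_periodic_cos.
    + apply smooth_periodic_const.
    + apply smooth_periodic_sin.
    + apply smooth_periodic_sin.
  - unfold bscal, fscal, wave_tangent; simpl. f_equal; f_equal; apply functional_extensionality; intros y; ring. }
assert (EL : fscal (6 * b * INR n) (L (sine_velocity n)) =
   fadd (L (wave_tangent n b b)) (fscal (-1) (L (wave_tangent n (- b) b)))).
{ rewrite <- Lscal, <- wave_tangent_difference, Ladd, Lscal; auto. }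
assert (C : forall W, btangent s W -> forall x, continuous (fst (L W)) x).
{ intros W HW. apply (Hs_lift_continuous s 0). apply LT, HW. }
assert (E0 : fsin (fst (fscal (6 * b * INR n) (L (sine_velocity n)))) n = 6 * b * INR n * fsin (fst (L (sine_velocity n))) n).
{ unfold fscal; simpl.
  replace (fun x => 6 * b * INR n * fst (L (sine_velocity n)) x) with (fun x => (fun _ => 0) x + 6 * b * INR n * fst (L (sine_velocity n)) x)
    by (apply functional_extensionality; intros; ring).
  rewrite fsin_linear; auto; [|intros; apply continuous_const].
  assert (Z : fsin (fun _ => 0) n = 0).
  { unfold fsin. rewrite (RInt_ext _ (fun _ => 0)) by (intros; eqR; ring). rewrite RInt_const. unfold scal; simpl; unfold mult; simpl; ring. }
  rewrite Z. ring. }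
rewrite <- E0, EL. unfold fadd, fscal; simpl. rewrite fsin_linear, A1, A2; auto.
replace (INR n * (3 * b)) with (3 * b * INR n) by ring.
replace (INR n * (3 * - b)) with (- (3 * b * INR n)) by ring. rewrite sin_neg. ring.
Qed.

(** * Failure of continuity at zero velocity *)

Lemma bnorm_base_data (s : R) : exists K, 0 < K /\
  forall b, 0 <= b -> bnorm s (bsub (base_data b) (base_data 0)) <= K * b.
Proof.
destruct (Hs_norm_family s (fun _ _ => 1)) as [K [d [HK [Hd H]]]].
{ intros; apply ydiff_const. }
{ intros t y; auto. }
exists K; split; auto. intros b Hb.
replace (bsub (base_data b) (base_data 0)) with (((fun _ => 0, fun _ => 0) : fpair, (fun _ => 0, fun _ => b * 1) : fpair) : bpair).
2: { unfold bsub, badd, bscal, fadd, fscal, base_data; simpl. f_equal; f_equal; apply functional_extensionality; intros y; ring. }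
unfold bnorm; cbv [fst snd]. rewrite !fnorm_zero_l by reflexivity. rewrite (proj2 (Hs_norm_zero s)), Rplus_0_l.
assert (Q := H 0). rewrite Rabs_R0 in Q. specialize (Q Hd b). rewrite (Rabs_pos_eq b) in Q by auto. exact Q.
Qed.

Theorem theorem4p3 (s : R) (hs : 3 / 2 < s) :
  ~ exp_is_C1 (fun rho : R => 3 / rho) s.
Proof.
intros [E [HE [DE HDE]]]. assert (Hpi := PI_RGT_0).
destruct (HDE (base_data 0) (exp_domain_base s 0)) as [HL0 [_ Hcont]].
(* The tolerance [/ 8] moves the sine coefficient by at most [PI / 8], hence two images apart by at
   most [PI / 4 <= 1], whereas the coefficients found below are 2 and 0. *)
destruct (Hcont (/ 8)) as [delta [Hdelta Hc]]; [lra|].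
destruct (bnorm_base_data s) as [K [HK HbK]].
(* The frequency is chosen after [delta]: this bound puts every [base_data b] with
   [0 <= b <= PI / (3 n)] within [delta] of [base_data 0]. *)
destruct (INR_unbounded (K * PI / (3 * delta))) as [n Hn].
assert (Hn0 : 0 < K * PI / (3 * delta)).
{ apply Rdiv_lt_0_compat; [apply Rmult_lt_0_compat|]; lra. }
assert (Hn' : (0 < n)%nat) by (apply INR_lt; simpl; lra).
assert (HN : 0 < INR n) by lra.
assert (W := mode_weight_pos s n).
(* The norm of [sin (n x)] is [mode_weight s n / 2], and the coefficient bound divides by the same
   weight: [2 PI * (1 / 8) * (1 / 2) = PI / 8], uniformly in [s] and [n]. *)
assert (Close : forall b, 0 <= b <= PI / (3 * INR n) ->
  Rabs (fsin (fst (DE (base_data b) (sine_velocity n))) n - fsin (fst (DE (base_data 0) (sine_velocity n))) n) <= PI / 8).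
{ intros b Hb.
  assert (Hd : bnorm s (bsub (base_data b) (base_data 0)) < delta).
  { eapply Rle_lt_trans; [apply HbK; lra|]. apply Rle_lt_trans with (K * (PI / (3 * INR n))); [apply Rmult_le_compat_l; lra|].
    apply Rmult_lt_reg_r with (3 * INR n); [lra|].
    apply Rmult_lt_compat_r with (r := 3 * delta) in Hn; [|lra].
    replace (K * PI / (3 * delta) * (3 * delta)) with (K * PI) in Hn by (field; lra).
    replace (K * (PI / (3 * INR n)) * (3 * INR n)) with (K * PI) by (field; lra). lra. }
  assert (TS := btangent_sine_velocity s n).
  assert (Q := Hc _ (exp_domain_base s b) Hd _ TS). rewrite bnorm_sine_velocity in Q by auto.
  destruct (HDE _ (exp_domain_base s b)) as [[LT _] _]. destruct HL0 as [LT0 _].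
  destruct (LT _ TS) as [F1 _]. destruct (LT0 _ TS) as [F0 _].
  set (f := fst (DE (base_data b) (sine_velocity n))) in *. set (g := fst (DE (base_data 0) (sine_velocity n))) in *.
  assert (Cf := Hs_lift_continuous _ _ _ F1). assert (Cg := Hs_lift_continuous _ _ _ F0).
  assert (N : Hs_norm s (fun x => f x - g x) <= / 8 * (mode_weight s n / 2)).
  { eapply Rle_trans; [|apply Q]. eapply Rle_trans; [|apply fnorm_fst]. right. f_equal.
    unfold fsub, fadd, fscal; simpl. symmetry; apply fsub_eq. }
  assert (FF : Hs_finite s (fun x => f x - g x)) by (apply Hs_finite_minus; auto; apply Hs_lift_finite; auto).
  assert (B := fsin_le_Hs_norm s _ n Hn' FF).
  replace (fsin f n - fsin g n) with (fsin (fun x => f x - g x) n).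
  - apply Rmult_le_reg_l with (mode_weight s n); auto. eapply Rle_trans; [apply B|].
    replace (mode_weight s n * (PI / 8)) with (2 * PI * (/ 8 * (mode_weight s n / 2))) by field.
    apply Rmult_le_compat_l; lra.
  - rewrite <- fsub_eq. rewrite fsin_linear by auto. ring. }
assert (Value : forall b, 6 * b * INR n * fsin (fst (DE (base_data b) (sine_velocity n))) n = 2 * PI * sin (3 * b * INR n)).
{ intros b. destruct (HDE _ (exp_domain_base s b)) as [HL [Hdiff _]].
  apply (derivative_on_sine s n b E (DE (base_data b))); auto. }
set (b1 := PI / (6 * INR n)). set (b2 := PI / (3 * INR n)).
assert (Hb1 : 0 <= b1 <= PI / (3 * INR n)).
{ unfold b1. split; [apply Rlt_le, Rdiv_lt_0_compat; lra|].
  unfold Rdiv. apply Rmult_le_compat_l; [lra|]. apply Rinv_le_contravar; lra. }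
assert (Hb2 : 0 <= b2 <= PI / (3 * INR n)).
{ split; [|apply Rle_refl]. apply Rlt_le, Rdiv_lt_0_compat; lra. }
assert (V1 := Value b1). assert (V2 := Value b2). assert (C1 := Close b1 Hb1). assert (C2 := Close b2 Hb2).
replace (6 * b1 * INR n) with PI in V1 by (unfold b1; field; lra).
replace (3 * b1 * INR n) with (PI / 2) in V1 by (unfold b1; field; lra).
replace (6 * b2 * INR n) with (2 * PI) in V2 by (unfold b2; field; lra).
replace (3 * b2 * INR n) with PI in V2 by (unfold b2; field; lra).
rewrite sin_PI2 in V1. rewrite sin_PI in V2.
set (x1 := fsin (fst (DE (base_data b1) (sine_velocity n))) n) in *.
set (x2 := fsin (fst (DE (base_data b2) (sine_velocity n))) n) in *.
assert (x1 = 2). { apply Rmult_eq_reg_l with PI; lra. }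
assert (x2 = 0). { apply Rmult_eq_reg_l with (2 * PI); lra. }
apply Rabs_le_between in C1, C2. assert (h := PI_4). lra.
Qed.
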